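(* Let $a,b,z\in\mathbb{V}$ be pairwise orthogonal vectors with $|a|=|b|>0$ and let $\phi>0$. Consider the control $$u(s)=a\cos(2\phi s)+b\sin(2\phi s)+z$$ and let $s\mapsto\gamma(s,a,b,z,2\phi)$ be the corresponding horizontal curve in $\mathbb{F}_3$ starting from the origin. Then $\gamma(\cdot,a,b,z,2\phi)$ minimizes length up to the time $$t_{\mathrm{cut}}(a,b,z,\phi)=\frac{Q^{-1}\big(|z|^2/|a|^2\big)}{\phi},$$ where $t_{\mathrm{cut}}(a,b,z,\phi)=\sup\{\bar s>0:\gamma(\cdot,a,b,z,2\phi)\text{ is a length-minimizer on }[0,\bar s]\}$.
   Context: $\mathbb{V}$ is a three-dimensional real vector space with inner product. $\mathbb{F}_3=\mathbb{V}\times\wedge^2\mathbb{V}$ has the Lie group law $(x,t)\cdot(\xi,\tau)=(x+\xi,\,t+\tau+\frac12 x\wedge\xi)$. A curve $\gamma=(x,t)\in W^{1,2}((0,T),\mathbb{F}_3)$ is horizontal with control $u\in L^2((0,T),\mathbb{V})$ if $\dot x=u$ and $\dot t=\frac12 x\wedge u$ almost everywhere; its length is $\int_0^T|u|\,ds$. The distance $d$ between two points is the infimum of lengths of horizontal curves joining them. A horizontal curve is a length-minimizer on $[0,\bar s]$ if its length on $[0,\bar s]$ equals the distance between its endpoints. For a given control $u$, the corresponding curve solves $\dot x=u$, $\dot t=\frac12x\wedge u$, $(x(0),t(0))=(0,0)$. For $\theta>0$ let $$S(\theta)=\frac{\sin\theta}{\theta},\quad U(\theta)=\frac{\theta-\sin\theta\cos\theta}{4\theta^2},\quad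 V(\theta)=\frac{\sin\theta-\theta\cos\theta}{2\theta^2},\quad Q(\theta)=-\frac{U(\theta)S(\theta)}{V(\theta)}.$$ Let $\phi_1\in\,]\pi,\frac32\pi[$ be the first positive zero of $V$ (i.e. the first positive solution of $\tan\theta=\theta$). The function $Q$ restricted to $[\pi,\phi_1[$ is a strictly increasing bijection onto $[0,+\infty[$, and $Q^{-1}:[0,+\infty[\,\to[\pi,\phi_1[$ denotes the inverse of this restriction. *)

(* Defs.v *)
From HB Require Import structures.
From mathcomp Require Import all_boot all_order all_algebra sesquilinear.
From mathcomp Require Import all_classical all_reals all_analysis.

Set Implicit Arguments.
Unset Strict Implicit.
Unset Printing Implicit Defensive.

Import Order.TTheory GRing.Theory Num.Theory.
Import numFieldNormedType.Exports.

Local Open Scope classical_set_scope.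
Local Open Scope ring_scope.

(* [W], with the product [wedge], is the exterior square of [V], up to unique
   isomorphism: [wedge] is the universal alternating bilinear map on [V]. *)
Definition exterior_square (R : realType) (V W : lmodType R)
    (wedge : {bilinear V -> V -> W}) : Prop :=
  (forall x, wedge x x = 0) /\
  forall (U : lmodType R) (f : {bilinear V -> V -> U}),
    (forall x, f x x = 0) ->
    exists2 g : {linear W -> U}, (forall x y, g (wedge x y) = f x y) &
      forall h : {linear W -> U},
        (forall x y, h (wedge x y) = f x y) -> h =1 g.

Section sobolev.
Context {R : realType}.
Notation mu := (@lebesgue_measure R).

Definition L2 (T : R) (f : R -> R) : Prop :=
  measurable_fun `]0, T[ f /\
  (\int[mu]_(s in `]0%R, T[) (f s ^+ 2)%:E < +oo)%E.

(* The support is required to lie in a compact subinterval of ]0, T[. *)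
Definition test_function (T : R) (p : R -> R) : Prop :=
  [/\ forall s, derivable p s 1, continuous (derive1 p) &
      exists c d : R, [/\ 0 < c, d < T &
        forall s, s \notin `[c, d] -> p s = 0]].

(* [f] belongs to W^{1,2}(]0, T[), with weak derivative [f'] in L^2;
   [f] is required to be the representative that is continuous on [0, T], so
   that its values at 0 and T make sense.  Testing against C^1 or C^oo
   functions of compact support gives the same space. *)
Definition W12 (T : R) (f f' : R -> R) : Prop :=
  [/\ {within `[0, T], continuous f}, L2 T f, L2 T f' &
      forall p, test_function T p ->
        \int[mu]_(s in `]0, T[) (f s * derive1 p s) =
        - \int[mu]_(s in `]0, T[) (f' s * p s)].

(* For functions with values in a finite-dimensional space, L^2 and W^{1,2}
   are understood componentwise, i.e., after composing with linear forms. *)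
Definition L2v (E : lmodType R) (T : R) (f : R -> E) : Prop :=
  forall l : {scalar E}, L2 T (fun s => l (f s)).

Definition W12v (E : lmodType R) (T : R) (f f' : R -> E) : Prop :=
  forall l : {scalar E}, W12 T (fun s => l (f s)) (fun s => l (f' s)).

End sobolev.

Section carnot.
Context {R : realType} {V : vectType R} {W : lmodType R}.
Variables (dot : {dot V for idfun}) (wedge : {bilinear V -> V -> W}).
Notation mu := (@lebesgue_measure R).

Definition vnorm (v : V) : R := Num.sqrt (dot v v).

(* The curve [g = (x, t)] in F_3 = V * W is horizontal on ]0, T[ with control
   [u]; its values outside [0, T] are irrelevant. *)
Definition horizontal (T : R) (g : R -> V * W) (u : R -> V) : Prop :=
  [/\ L2v T u, W12v T (fun s => (g s).1) u &
      W12v T (fun s => (g s).2)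
             (fun s => (2^-1 : R) *: wedge (g s).1 (u s))].

Definition length (T : R) (u : R -> V) : \bar R :=
  (\int[mu]_(s in `]0%R, T[) (vnorm (u s))%:E)%E.

Definition dist (p q : V * W) : \bar R :=
  ereal_inf [set L | exists T g u,
    [/\ 0 < T, horizontal T g u, g 0 = p, g T = q & L = length T u]].

Definition length_minimizer (g : R -> V * W) (u : R -> V) (s : R) : Prop :=
  horizontal s g u /\ length s u = dist (g 0) (g s).

Definition t_cut (g : R -> V * W) (u : R -> V) : \bar R :=
  ereal_sup [set s%:E | s in [set s | 0 < s /\ length_minimizer g u s]].

End carnot.

Definition control {R : realType} {V : vectType R} (a b z : V) (w : R) :
    R -> V :=
  fun s => cos (w * s) *: a + sin (w * s) *: b + z.

(* The formulas below are only meant for positive arguments. *)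
Section cut_functions.
Context {R : realType}.
Implicit Type x : R.

Definition Sfun x := sin x / x.
Definition Ufun x := (x - sin x * cos x) / (4 * x ^+ 2).
Definition Vfun x := (sin x - x * cos x) / (2 * x ^+ 2).
Definition Qfun x := - (Ufun x * Sfun x / Vfun x).

Definition phi1 : R := inf [set x | 0 < x /\ Vfun x = 0].

(* [Qfun] is a bijection from [pi, phi1[ to [0, +oo[, so that the default value
   of the partial inverse is not used on [0, +oo[. *)
Definition Qinv : R -> R := 'pinv_(fun=> 0) `[pi, phi1[ Qfun.

End cut_functions.

(* Main.v *)
(* At the time tc the endpoint (x, t) has x orthogonal to the plane of t: it lies
   on the axis fixed by the rotations preserving t.

   Minimality up to tc.  Take a competitor X with the same endpoint, parametrized
   on [0, 1] with constant speed L, and let r be the length of its chord.  Project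
   it, minus the chord, to a plane.  A planar loop y with area A and barycentre P
   satisfies int |y'|^2 >= 4 th A + kappa(th) |P|^2 with kappa = 2 sin / V, for
   all th in ]0, phi1[ (a calibration by a Riccati equation).  The endpoint
   conditions express A through P, and rotating the plane around the axis, with
   the tilt of the plane of the circular part of the helix, makes one coordinate
   of P vanish.  What remains is an inequality in one variable |P|, in which th
   is free; optimizing th, it follows from the monotonicity of S, and yields
   L^2 >= tc^2 (|a|^2 + |z|^2).

   Non-minimality after tc.  Rotating the arc on [0, tc] around the axis gives a
   curve of the same length and endpoint with a corner, which can be shortened. *)
From HB Require Import structures.
Require Import Defs.
From mathcomp Require Import all_boot all_order all_algebra sesquilinear.
From mathcomp Require Import all_classical all_reals all_analysis.
From mathcomp Require Import ssrAC measurable_realfun ring lra.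

Set Implicit Arguments.
Unset Strict Implicit.
Unset Printing Implicit Defensive.

Import Order.TTheory GRing.Theory Num.Theory.
Import numFieldNormedType.Exports.

Local Open Scope classical_set_scope.
Local Open Scope ring_scope.

(** * Absolutely continuous functions *)

Section absolute_continuity.
Context {R : realType}.
Notation mu := (@lebesgue_measure R).
Implicit Types (T a b c s : R) (f g h D m : R -> R).

(** The function Q is a compatibility condition. With the phase chosen so that the circular arc is
    symmetric, one coordinate of x and one of t vanish at the end of the arc for every tilt of its
    plane. Placing x on the axis of t then leaves two homogeneous linear equations for the cosine
    and sine of the tilt; their determinant vanishes exactly when Q of the half-angle is
    [|z|^2 / |a|^2]. The calibration is singular at its initial time, so its clock starts at a small
    [e], which tends to 0 only in the final inequality. Constant speed is encoded by a normalized
    arclength that enters the inequality as one more absolutely continuous function, next to the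
    original time. Minimality before tc follows from that at tc by continuing a competitor along the
    helix. *)

Definition cont_on a b f := forall s, a <= s <= b -> forall e, 0 < e ->
  exists2 d, 0 < d & forall r, a <= r <= b -> `|r - s| < d -> `|f r - f s| < e.

Lemma within_cont_on a b f :
  {within `[a, b], continuous f} <-> cont_on a b f.
Proof.
rewrite subspace_continuousP; split=> [cf s sab e e0|cf s].
  have sab' : `[a, b]%classic s by rewrite /= in_itv.
  have /cvgrPdist_lt /(_ e e0) := cf s sab'.
  rewrite near_withinE => /nbhs_ballP [d /= d0 dP].
  exists d => // r rab rs.
  rewrite distrC; apply: dP; last by rewrite /= in_itv.
  by rewrite /ball /= distrC.
rewrite /= in_itv /= => sab; apply/cvgrPdist_lt => e e0.
rewrite near_withinE; apply/nbhs_ballP.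
have [d d0 dP] := cf s sab e e0.
exists d => //= r; rewrite /ball /= => sr.
rewrite in_itv /= => rab; rewrite distrC; apply: dP => //.
by rewrite distrC.
Qed.

(* A continuous-induction version of the mean value inequality, in which the
   parameter is only required to be dominated by a monotone function. *)
Lemma increment_principle T D m :
  (forall r s, 0 <= r -> r <= s -> s <= T -> m r <= m s) ->
  (forall s, 0 <= s <= T -> forall e, 0 < e -> exists2 d, 0 < d &
     forall r, 0 <= r <= T -> `|r - s| < d ->
       `|D r - D s| <= e * `|m r - m s|) ->
  forall s, 0 <= s <= T -> D s = D 0.
Proof.
move=> mm loc s /andP[s0 sT].
suff H e : 0 < e -> `|D s - D 0| <= e * (m s - m 0).
  apply/eqP; rewrite -subr_eq0 -normr_le0; apply/ler_addgt0Pr => e e0.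
  rewrite add0r.
  have ms : 0 <= m s - m 0 by rewrite subr_ge0; apply: mm.
  have k0 : 0 < m s - m 0 + 1 by lra.
  apply: (le_trans (H (e / (m s - m 0 + 1)) _)); first exact: divr_gt0.
  rewrite mulrAC ler_pdivrMr// ler_wpM2l ?(ltW e0)//; lra.
move=> e0.
pose A := [set r | 0 <= r <= s /\ `|D r - D 0| <= e * (m r - m 0)].
have A0 : A 0 by split; rewrite ?lexx ?s0// !subrr normr0 mulr0.
have hA : has_sup A by split; [exists 0|exists s => r [/andP[]]].
set z := sup A.
have zs : z <= s by apply: ge_sup; [exists 0|move=> r [/andP[]]].
have z0 : 0 <= z by apply: ub_le_sup => //; case: hA.
have zT : 0 <= z <= T by lra.
have [d d0 dP] := loc z zT e e0.
have [r Ar zr] := sup_adherent d0 hA; rewrite -/z in zr.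
have rz : r <= z by apply: ub_le_sup => //; case: hA.
case: (Ar) => /andP[r0 rs] Dr.
have Az : A z.
  split; first by rewrite z0 zs.
  have : `|D r - D z| <= e * `|m r - m z|.
    by apply: dP; [lra|rewrite distrC ger0_norm; lra].
  rewrite (distrC (m r)) (ger0_norm (_ : 0 <= m z - m r)); last first.
    by rewrite subr_ge0; apply: mm => //; lra.
  move=> Hd.
  have -> : D z - D 0 = - (D r - D z) + (D r - D 0) by ring.
  apply: (le_trans (ler_normD _ _)); rewrite normrN; lra.
case: (ltrP z s) => [zlt|sz]; last first.
  have E : z = s by apply/le_anti; rewrite zs.
  by case: Az => _; rewrite E.
pose w := Num.min s (z + d / 2).
have wz : z < w by rewrite lt_min zlt /= ltrDl; lra.
have ws : w <= s by rewrite ge_min lexx.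
have wd : w <= z + d / 2 by rewrite ge_min lexx orbT.
have Aw : A w.
  split; first lra.
  have : `|D w - D z| <= e * `|m w - m z|.
    by apply: dP; [lra|rewrite ger0_norm; lra].
  rewrite (ger0_norm (_ : 0 <= m w - m z)); last first.
    by rewrite subr_ge0; apply: mm => //; lra.
  move=> Hd; case: Az => _ Hz.
  have -> : D w - D 0 = (D w - D z) + (D z - D 0) by ring.
  apply: (le_trans (ler_normD _ _)); lra.
have : w <= z by apply: ub_le_sup => //; case: hA.
by rewrite leNgt wz.
Qed.

(** The derivative is carried along as a given function, so that later identities hold at every
    point of [0, T] for the chosen representative, with no almost-everywhere quantifier. *)
Definition ac T f f' := mu.-integrable `[0, T] (EFin \o f') /\
  forall s, 0 <= s <= T -> f s = f 0 + \int[mu]_(r in `[0, s]) f' r.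

Lemma integrable_sub a b c d f : c <= a -> b <= d ->
  mu.-integrable `[c, d] (EFin \o f) -> mu.-integrable `[a, b] (EFin \o f).
Proof.
move=> ca bd; apply: integrableS => //.
by apply: subset_itv; rewrite bnd_simp.
Qed.

Lemma Rint_sub a b c f : a <= b -> b <= c ->
  mu.-integrable `[a, c] (EFin \o f) ->
  \int[mu]_(r in `[a, c]) f r - \int[mu]_(r in `[a, b]) f r =
  \int[mu]_(r in `[b, c]) f r.
Proof.
move=> ab bc fi; rewrite Rintegral_itvB ?bnd_simp//.
rewrite Rintegral_itv_obnd_cbnd//.
by apply: integrableS fi => //; apply: subset_itv; rewrite bnd_simp.
Qed.

Lemma ac_sub T f f' a b : ac T f f' -> 0 <= a -> a <= b -> b <= T ->
  f b - f a = \int[mu]_(r in `[a, b]) f' r.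
Proof.
move=> [fi fE] a0 ab bT; rewrite fE ?(fE a); [|lra..].
rewrite opprD addrACA subrr add0r Rint_sub//.
exact: integrable_sub fi.
Qed.

Lemma ac_cont T f f' : 0 <= T -> ac T f f' -> cont_on 0 T f.
Proof.
move=> T0 [fi fE].
have /within_cont_on c := parameterized_integral_continuous T0 fi.
move=> s sT e e0; have [d d0 dP] := c s sT e e0.
exists d => // r rT rs; rewrite fE// (fE s)//.
by rewrite opprD addrACA subrr add0r; exact: dP.
Qed.

Lemma cont_on_measurable a b f : cont_on a b f -> measurable_fun `[a, b] f.
Proof.
move=> /within_cont_on cf.
by apply: subspace_continuous_measurable_fun.
Qed.

Lemma cont_on_bounded a b f : cont_on a b f -> [bounded f x | x in `[a, b]].
Proof.
move=> /within_cont_on cf.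
have [M [Mr MP]] := compact_bounded (continuous_compact cf (@segment_compact _ a b)).
by exists M; split => // y My x xab; apply: MP => //; exists x.
Qed.

Lemma cont_on_integrable a b f : cont_on a b f ->
  mu.-integrable `[a, b] (EFin \o f).
Proof.
move=> /within_cont_on cf.
by apply: continuous_compact_integrable => //; exact: segment_compact.
Qed.

Lemma cont_integrableM a b g f : cont_on a b g ->
  mu.-integrable `[a, b] (EFin \o f) ->
  mu.-integrable `[a, b] (EFin \o (fun s => g s * f s)).
Proof.
move=> cg fi.
have h : mu.-integrable `[a, b] ((EFin \o g) \* (EFin \o f))%E.
  by apply: integrableMr => //; [exact: cont_on_measurable|exact: cont_on_bounded].
exact: h.
Qed.

End absolute_continuity.

(** * Calculus of absolutely continuous functions *)

Section ac_calculus.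
Context {R : realType}.
Notation mu := (@lebesgue_measure R).
Implicit Types (T a b c s : R) (f g h D m : R -> R).

Lemma Rint_xx f a : \int[mu]_(r in `[a, a]) f r = 0.
Proof. by rewrite set_itv1 Rintegral_set1. Qed.

Lemma Rint_eq a b f g : (forall s, a <= s <= b -> f s = g s) ->
  \int[mu]_(r in `[a, b]) f r = \int[mu]_(r in `[a, b]) g r.
Proof.
by move=> fg; apply: eq_Rintegral => s; rewrite inE /= in_itv; exact: fg.
Qed.

Lemma integrable_eq a b f g : (forall s, a <= s <= b -> f s = g s) ->
  mu.-integrable `[a, b] (EFin \o f) -> mu.-integrable `[a, b] (EFin \o g).
Proof.
move=> fg; apply: eq_integrable => // s; rewrite inE /= in_itv => /fg /= ->.
by [].
Qed.

Lemma ac_eq T f f' g g' : 0 <= T -> (forall s, 0 <= s <= T -> f s = g s) ->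
  (forall s, 0 <= s <= T -> f' s = g' s) -> ac T f f' -> ac T g g'.
Proof.
move=> T0 fg fg' [fi fE]; split; first exact: integrable_eq fi.
move=> s sT; rewrite -!fg ?lexx//; rewrite fE//; congr (_ + _).
by apply: Rint_eq => r rs; apply: fg'; lra.
Qed.

(** The two points are unordered because they will be values of one function at successive times. *)
Lemma MVT_between (P : set R) g g' x y : is_interval P ->
  (forall z, P z -> is_derive z 1 g (g' z)) -> P x -> P y ->
  exists z, [/\ P z, g y - g x = g' z * (y - x) &
    x <= z <= y \/ y <= z <= x].
Proof.
move=> Pi gd; wlog xy : x y / x <= y.
  move=> H Px Py; have [xy|/ltW yx] := leP x y; first exact: H.
  have [z [Pz E zyx]] := H _ _ yx Py Px.
  by exists z; split => //; [rewrite -opprB E; ring|case: zyx; [right|left]].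
move=> Px Py.
have Pz z : x <= z <= y -> P z by exact: Pi.
have [z||z zxy E] := @MVT_segment R g g' x y xy.
- by rewrite in_itv /= => zxy; apply/gd/Pz; lra.
- by apply: derivable_within_continuous => z; rewrite in_itv /= => /Pz /gd [].
by move: zxy; rewrite in_itv /= => zxy; exists z; split; [exact: Pz|exact: E|left].
Qed.

Lemma cont_at (g : R -> R) x : {for x, continuous g} -> forall e : R, 0 < e ->
  exists2 d : R, 0 < d & forall y, `|y - x| < d -> `|g y - g x| < e.
Proof.
move=> /cvgrPdist_lt gx e e0.
have /nbhs_ballP[d /= d0 dP] := gx e e0.
by exists d => // y yx; rewrite distrC; apply: dP; rewrite /ball /= distrC.
Qed.

Lemma cont_on_comp a b f g : cont_on a b f ->
  (forall s, a <= s <= b -> {for f s, continuous g}) ->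
  cont_on a b (fun s => g (f s)).
Proof.
move=> cf cg s sab e e0.
have [k k0 kP] := cont_at (cg s sab) e0.
have [d d0 dP] := cf s sab k k0.
by exists d => // r rab rs; apply/kP/dP.
Qed.

Lemma Rint_le a b f g : mu.-integrable `[a, b] (EFin \o f) ->
  mu.-integrable `[a, b] (EFin \o g) -> (forall s, a <= s <= b -> f s <= g s) ->
  \int[mu]_(r in `[a, b]) f r <= \int[mu]_(r in `[a, b]) g r.
Proof.
by move=> fi gi fg; apply: le_Rintegral => // s; rewrite /= in_itv; exact: fg.
Qed.

(** By the mean value theorem for [g], the defect [D] grows over a short interval by the integral of
    [(g' z - g' (f r)) * f' r] for a single [z], hence by at most [e] times the growth of the
    integral of |f'|; [increment_principle] makes [D] constant. *)
Lemma ac_comp T f f' (P : set R) g g' : 0 <= T -> is_interval P ->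
  (forall x, P x -> is_derive x 1 g (g' x)) ->
  (forall x, P x -> {for x, continuous g'}) ->
  (forall s, 0 <= s <= T -> P (f s)) ->
  ac T f f' -> ac T (fun s => g (f s)) (fun s => g' (f s) * f' s).
Proof.
move=> T0 Pi gd gc fP acf; have [fi fE] := acf.
have cf := ac_cont T0 acf.
have gi : mu.-integrable `[0, T] (EFin \o (fun s => g' (f s) * f' s)).
  apply: cont_integrableM => //; apply: cont_on_comp => // s sT.
  exact/gc/fP.
split=> // s sT.
pose D s := g (f s) - \int[mu]_(r in `[0, s]) (g' (f r) * f' r).
pose m s := \int[mu]_(r in `[0, s]) `|f' r|.
have ni : mu.-integrable `[0, T] (EFin \o (fun s => `|f' s|)).
  exact: integrable_norm.
have mE a b : 0 <= a -> a <= b -> b <= T ->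
    m b - m a = \int[mu]_(r in `[a, b]) `|f' r|.
  by move=> a0 ab bT; apply: Rint_sub => //; exact: integrable_sub ni.
suff : D s = D 0 by rewrite /D Rint_xx; lra.
apply: (@increment_principle _ T D m) => // [a b a0 ab bT|{}s {}sT e e0].
  by rewrite -subr_ge0 mE//; apply: Rintegral_ge0.
have [k k0 kP] := cont_at (gc (f s) (fP s sT)) (divr_gt0 e0 (ltr0Sn _ 1)).
have [d d0 dP] := cf s sT k k0.
have key a b : 0 <= a -> a <= b -> b <= T ->
    (forall q, a <= q <= b -> `|f q - f s| < k) ->
    `|D b - D a| <= e * (m b - m a).
  move=> a0 ab bT ck.
  have [z [Pz zE zab]] := MVT_between Pi gd (fP a ltac:(lra)) (fP b ltac:(lra)).
  have zk : `|z - f s| < k.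
    have := ck a ltac:(lra); have := ck b ltac:(lra).
    rewrite !ltr_norml; case: zab; lra.
  have fi' : mu.-integrable `[a, b] (EFin \o f') by exact: integrable_sub fi.
  have gi' : mu.-integrable `[a, b] (EFin \o (fun s => g' (f s) * f' s)).
    exact: integrable_sub gi.
  have ni' : mu.-integrable `[a, b] (EFin \o (fun s => `|f' s|)).
    exact: integrable_sub ni.
  have zi : mu.-integrable `[a, b] (EFin \o (fun s => g' z * f' s)).
    exact: (integrableZl _ _ fi').
  have -> : D b - D a = \int[mu]_(r in `[a, b]) (g' z * f' r - g' (f r) * f' r).
    rewrite RintegralB//= RintegralZl//.
    rewrite -(ac_sub acf)// -zE.
    rewrite -(@Rint_sub _ 0 a b)//; last exact: integrable_sub gi.
    rewrite /D; ring.
  have bi : mu.-integrable `[a, b] (EFin \o (fun r => g' z * f' r - g' (f r) * f' r)).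
    have := integrableB _ zi gi'; exact.
  apply: (le_trans (le_normr_Rintegral _ bi)) => //.
  rewrite mE// -RintegralZl//.
  apply: Rint_le => [||r rab].
  - exact: integrable_norm.
  - exact: (integrableZl _ _ ni').
  rewrite -mulrBl normrM ler_wpM2r//.
  have := kP z zk; have := kP (f r) (ck r rab).
  rewrite !ltr_norml ler_norml; lra.
exists d => // r rT rs.
case: (leP r s) => [rs'|/ltW sr].
  rewrite distrC (distrC (m r)).
  have ms : 0 <= m s - m r by rewrite mE ?Rintegral_ge0//; lra.
  rewrite (ger0_norm ms); apply: key; [lra..|move=> q qrs].
  apply: dP; first lra.
  move: rs; rewrite !ltr_norml; lra.
have ms : 0 <= m r - m s by rewrite mE ?Rintegral_ge0//; lra.
rewrite (ger0_norm ms); apply: key; [lra..|move=> q qrs].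
apply: dP; first lra.
move: rs; rewrite !ltr_norml; lra.
Qed.

Lemma ac_cst T c : 0 <= T -> ac T (fun=> c) (fun=> 0).
Proof.
move=> T0; split; first exact: integrable0.
move=> s sT; rewrite Rintegral_cst//; lra.
Qed.

Lemma ac_add T f f' g g' : ac T f f' -> ac T g g' ->
  ac T (fun s => f s + g s) (fun s => f' s + g' s).
Proof.
move=> [fi fE] [gi gE]; split.
  have := integrableD _ fi gi; exact.
move=> s sT; rewrite RintegralD//=.
- rewrite fE// gE//; ring.
- by apply: integrable_sub fi => //; lra.
- by apply: integrable_sub gi => //; lra.
Qed.

Lemma ac_scale T k f f' : ac T f f' ->
  ac T (fun s => k * f s) (fun s => k * f' s).
Proof.
move=> [fi fE]; split; first exact: (integrableZl _ _ fi).
move=> s sT; rewrite RintegralZl//; first by rewrite fE//; ring.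
by apply: integrable_sub fi => //; lra.
Qed.

Lemma ac_sub_fun T f f' g g' : ac T f f' -> ac T g g' ->
  ac T (fun s => f s - g s) (fun s => f' s - g' s).
Proof.
move=> fa ga; have [fgi fgE] := ac_add fa (ac_scale (-1) ga).
split=> [|s sT].
  by apply: integrable_eq fgi => r _; ring.
have := fgE s sT; rewrite !mulN1r => ->; congr (_ + _).
by apply: Rint_eq => r _; rewrite mulN1r.
Qed.

Lemma ac_sqr T f f' : 0 <= T -> ac T f f' ->
  ac T (fun s => f s ^+ 2) (fun s => (2 * f s) * f' s).
Proof.
move=> T0 fa.
apply: (@ac_comp T f f' setT (fun x => x ^+ 2) (fun x => 2 * x)) => //.
- move=> x _; apply: is_derive_eq; rewrite /GRing.scale /=; ring.
- by move=> x _; apply: mulrl_continuous.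
Qed.

(** Polarization reduces products to squares, a case of the chain rule. *)
Lemma ac_mul T f f' g g' : 0 <= T -> ac T f f' -> ac T g g' ->
  ac T (fun s => f s * g s) (fun s => f' s * g s + f s * g' s).
Proof.
move=> T0 fa ga.
have sa := ac_sqr T0 (ac_add fa ga).
have da := ac_sqr T0 (ac_sub_fun fa ga).
have := ac_scale (4^-1) (ac_sub_fun sa da).
by apply: ac_eq => // s _; field.
Qed.

Lemma ac_prim T f' : mu.-integrable `[0, T] (EFin \o f') ->
  ac T (fun s => \int[mu]_(r in `[0, s]) f' r) f'.
Proof. by move=> fi; split=> // s sT; rewrite Rint_xx add0r. Qed.

Lemma ac_le T f f' : 0 <= T -> ac T f f' ->
  (forall s, 0 <= s <= T -> f' s <= 0) -> f T <= f 0.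
Proof.
move=> T0 [fi fE] f0; rewrite fE ?lexx ?T0//.
rewrite gerDl.
have H0 : \int[mu]_(r in `[0, T]) (0 : R) = 0 by rewrite Rintegral_cst// mul0r.
rewrite -[leRHS]H0; apply: (@Rint_le 0 T f' (fun=> 0)) => //.
exact: integrable0.
Qed.

End ac_calculus.

(** * Sobolev functions on an interval *)

Section weak_derivative.
Context {R : realType}.
Notation mu := (@lebesgue_measure R).
Implicit Types (T a b c s : R) (f g h p q : R -> R).

Lemma cont_atP (g : R -> R) x : (forall e, 0 < e ->
  exists2 d, 0 < d & forall y, `|y - x| < d -> `|g y - g x| < e) ->
  {for x, continuous g}.
Proof.
move=> H; apply/cvgrPdist_lt => e e0; apply/nbhs_ballP.
have [d d0 dP] := H e e0.
by exists d => //= y; rewrite /ball /= => xy; rewrite distrC; apply: dP; rewrite distrC.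
Qed.

Lemma continuous_cont_on a b g : continuous g -> cont_on a b g.
Proof. by move=> cg; apply/within_cont_on; exact: continuous_subspaceT. Qed.

Lemma cont_on_cst a b (k : R) : cont_on a b (fun=> k).
Proof. by move=> s _ e e0; exists 1 => // r _ _; rewrite subrr normr0. Qed.

Lemma ac_C1 T f f' : 0 <= T -> (forall x, is_derive x (1 : R) f (f' x)) ->
  continuous f' -> ac T f f'.
Proof.
move=> T0 fd fc.
have acid : ac T id (fun=> 1).
  split; first by apply: cont_on_integrable; exact: cont_on_cst.
  move=> s sT; rewrite Rintegral_cst//= lebesgue_measure_itv/= lte_fin.
  case: ltP => /= s0; first by ring.
  have -> : s = 0 by lra.
  by ring.
have H : ac T f (fun s => f' s * 1).
  apply: (@ac_comp R T id (fun=> 1) setT f f') => // x _.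
  exact: fc.
by apply: ac_eq H => // s _; rewrite mulr1.
Qed.

Lemma Rint_ge0 a b g : (forall r, a <= r <= b -> 0 <= g r) ->
  0 <= \int[mu]_(r in `[a, b]) g r.
Proof.
by move=> g0; apply: Rintegral_ge0 => r /=; rewrite in_itv /=; exact: g0.
Qed.

(** Otherwise [g] would exceed [g s / 2] on an interval. Continuity is asked at [s] only, so that
    [g] may jump elsewhere, as the velocity of a curve with a corner does. *)
Lemma int0_at T g s : (forall r, 0 <= r <= T -> 0 <= g r) ->
  mu.-integrable `[0, T] (EFin \o g) ->
  \int[mu]_(r in `[0, T]) g r = 0 -> 0 < s < T ->
  {for s, continuous g} -> g s = 0.
Proof.
move=> g0 gi gI sT gc; apply/eqP; rewrite eq_le g0 ?andbT; last lra.
rewrite leNgt; apply/negP => gs.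
have [d d0 dP] := cont_at gc (divr_gt0 gs (ltr0Sn _ 1)).
pose k := Num.min d (T - s) / 2.
have k0 : 0 < k by rewrite /k divr_gt0// lt_min d0 subr_gt0; lra.
have kd : k < d.
  have : Num.min d (T - s) <= d by rewrite ge_min lexx.
  by rewrite /k in k0 *; lra.
have kT : s + k <= T.
  have : Num.min d (T - s) <= T - s by rewrite ge_min lexx orbT.
  by rewrite /k in k0 *; lra.
clearbody k.
have I1 : \int[mu]_(r in `[0, s]) g r <= \int[mu]_(r in `[0, s + k]) g r - g s / 2 * k.
  have -> : g s / 2 * k = \int[mu]_(r in `[s, s + k]) (g s / 2).
    rewrite Rintegral_cst//= lebesgue_measure_itv/= lte_fin ltrDl k0/=.
    by ring.
  rewrite lerBrDr -lerBrDl Rint_sub; [|lra|lra|by apply: integrable_sub gi => //; lra].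
  apply: Rint_le; last first.
    move=> r rs; have := dP r; rewrite !ltr_norml => H.
    by have := H ltac:(lra); lra.
  - by apply: integrable_sub gi => //; lra.
  - by apply: cont_on_integrable; exact: cont_on_cst.
have I0 : 0 <= \int[mu]_(r in `[0, s]) g r.
  by apply: Rint_ge0 => r rs; apply: g0; lra.
have I2 : 0 <= \int[mu]_(r in `[s + k, T]) g r.
  by apply: Rint_ge0 => r rs; apply: g0; lra.
have : 0 < g s / 2 * k by rewrite !mulr_gt0.
have := @Rint_sub R 0 (s + k) T g ltac:(lra) kT gi.
lra.
Qed.

Lemma Rint_oo a b f : mu.-integrable `[a, b] (EFin \o f) ->
  \int[mu]_(r in `]a, b[) f r = \int[mu]_(r in `[a, b]) f r.
Proof.
move=> fi; rewrite Rintegral_itv_bndo_bndc; last first.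
  by apply: integrableS fi => //; apply: subset_itv; rewrite bnd_simp.
rewrite Rintegral_itv_obnd_cbnd//.
by apply: integrableS fi => //; apply: subset_itv; rewrite bnd_simp.
Qed.

Lemma measurable_cc a b f : measurable_fun `]a, b[ f -> measurable_fun `[a, b] f.
Proof.
by move=> /measurable_fun_itv_bndo_bndcP /measurable_fun_itv_obnd_cbndP.
Qed.

Lemma L2_integrable T f : 0 <= T -> L2 T f -> mu.-integrable `[0, T] (EFin \o f).
Proof.
move=> T0 [fm fI].
have fm' := measurable_cc fm.
have m2 : measurable_fun `[0, T] (fun s => f s ^+ 2).
  exact: measurable_funX.
have i2 : mu.-integrable `[0, T] (EFin \o (fun s => f s ^+ 2)).
  apply/integrableP; split; first exact/measurable_EFinP.
  apply: le_lt_trans fI.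
  rewrite -(@integral_itv_bndoo _ 0 T _ true false); last first.
    apply/measurable_EFinP; exact: measurable_funX.
  by under eq_integral do rewrite /= ger0_norm ?sqr_ge0//.
have i1 : mu.-integrable `[0, T] (EFin \o (fun s => 1 + f s ^+ 2)).
  have h1 : mu.-integrable `[0, T] (EFin \o (fun=> 1)).
    by apply: cont_on_integrable; exact: cont_on_cst.
  have := integrableD _ h1 i2; exact.
(* The comparison is [|f| <= 1 + f ^+ 2]. *)
apply: le_integrable i1 => //; first exact/measurable_EFinP.
move=> s _ /=; rewrite lee_fin (ger0_norm (_ : 0 <= 1 + _)); last first.
  by rewrite addr_ge0// sqr_ge0.
rewrite -(real_normK (num_real (f s))).
have := sqr_ge0 (`|f s| - 1); have := sqr_ge0 `|f s|; rewrite sqrrB; lra.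
Qed.

Lemma bounded_L2 T f M : measurable_fun `[0, T] f ->
  (forall s, 0 <= s <= T -> `|f s| <= M) -> L2 T f.
Proof.
move=> fm fM; split.
  by apply: measurable_funS fm => //; apply: subset_itv; rewrite bnd_simp.
have m2 : measurable_fun `[0, T] (fun s => f s ^+ 2) by exact: measurable_funX.
have : mu.-integrable `[0, T] (EFin \o (fun s => f s ^+ 2)).
  apply: measurable_bounded_integrable => //.
    by apply: compact_finite_measure; exact: segment_compact.
  exists (M ^+ 2); split; first exact: num_real.
  move=> y My s /=; rewrite in_itv /= => sT; apply/ltW/(le_lt_trans _ My).
  by rewrite normrX lerXn2r ?nnegrE//; [exact: le_trans (fM s sT)|exact: fM].
move=> /integrableP[_]; apply: le_lt_trans.
have m3 : measurable_fun `]0, T[ (fun s => (f s ^+ 2)%:E).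
  by apply/measurable_EFinP; apply: measurable_funS m2 => //; apply: subset_itv;
     rewrite bnd_simp.
rewrite -(integral_itv_bndoo true false m3).
by under [leRHS]eq_integral do rewrite /= ger0_norm ?sqr_ge0//.
Qed.

End weak_derivative.

(** * Equivalence of the Sobolev and the absolutely continuous description *)

Section sobolev_absolutely_continuous.
Context {R : realType}.
Notation mu := (@lebesgue_measure R).
Implicit Types (T a b c s : R) (f g h p q : R -> R).

(** Values match at [T1] but derivatives may differ, which is what allows corners. The second piece
    is C^1 on the whole line, since it will be an explicit helix or an affine function. *)
Lemma ac_paste T1 T2 f f' g g' : 0 <= T1 -> T1 <= T2 -> ac T1 f f' ->
  (forall x, is_derive x (1 : R) g (g' x)) -> continuous g' -> f T1 = g T1 ->
  ac T2 (fun s => if s <= T1 then f s else g s)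
        (fun s => if s <= T1 then f' s else g' s).
Proof.
move=> T10 T12 fa gd gc fgT; have [fi fE] := fa.
have ga : ac T2 g g' by apply: ac_C1 => //; lra.
have [gi _] := ga.
have pi : mu.-integrable `[0, T2] (EFin \o (fun s => if s <= T1 then f' s else g' s)).
  pose A : set R := `[0, T1]%classic; pose B : set R := `]T1, T2]%classic.
  have i1 : mu.-integrable setT ((EFin \o f') \_ A).
    by apply: (iffLR (integrable_mkcond _ _) fi); rewrite /A.
  have i2 : mu.-integrable setT ((EFin \o g') \_ B).
    have gB : mu.-integrable B (EFin \o g').
      by rewrite /B; apply: integrableS gi => //; apply: subset_itv; rewrite bnd_simp.
    by apply: (iffLR (integrable_mkcond _ _) gB); rewrite /B.
  have : mu.-integrable `[0, T2] (((EFin \o f') \_ A) \+ ((EFin \o g') \_ B))%E.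
    by apply: (@integrableS _ _ _ mu setT) => //; exact: integrableD.
  apply: eq_integrable => // s; rewrite inE /= in_itv /= => sT.
  rewrite !patchE !mem_setE !in_itv /=; case: (leP s T1) => sT1.
    by rewrite ifT ?adde0//; lra.
  by rewrite ifF ?ifT ?add0e//; lra.
split=> // s sT; rewrite T10.
case: (leP s T1) => sT1.
  rewrite fE; last lra.
  by congr (_ + _); apply: Rint_eq => r rs; rewrite ifT//; lra.
have pis : mu.-integrable `[0, s] (EFin \o (fun s => if s <= T1 then f' s else g' s)).
  by apply: integrable_sub pi => //; lra.
have := @Rint_sub R 0 T1 s _ T10 (ltW sT1) pis.
rewrite (@Rint_eq _ 0 T1 _ f'); last by move=> r rs; rewrite ifT//; lra.
have -> : \int[mu]_(r in `[T1, s]) (if r <= T1 then f' r else g' r) =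
          \int[mu]_(r in `[T1, s]) g' r.
  rewrite -!Rintegral_itv_obnd_cbnd.
  - apply: eq_Rintegral => r; rewrite inE /= in_itv /= => rs.
    by rewrite ifF//; lra.
  - by apply: integrableS gi => //; apply: subset_itv; rewrite bnd_simp; lra.
  - by apply: integrableS pis => //; apply: subset_itv; rewrite bnd_simp; lra.
rewrite -(ac_sub ga)//; [|lra..].
have := fE T1; rewrite T10 lexx => /(_ isT); rewrite fgT; lra.
Qed.

(** Integration by parts: the product rule for [f] times a test function, which vanishes at both
    ends. *)
Lemma ac_W12 T f f' : 0 < T -> ac T f f' -> L2 T f' -> W12 T f f'.
Proof.
move=> T0 fa f2; have T0' := ltW T0; have cf := ac_cont T0' fa.
have [fi fE] := fa.
split=> //.
- exact/within_cont_on.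
- have [M [Mr MP]] := cont_on_bounded cf.
  apply: (@bounded_L2 _ _ _ (M + 1)); first exact: cont_on_measurable.
  by move=> s sT; apply: (MP (M + 1)); [rewrite ltrDl|rewrite /= in_itv].
move=> p [pd pc [c [d [c0 dT p0]]]].
have pa : ac T p (derive1 p).
  by apply: ac_C1 => // x; rewrite derive1E; exact: derivableP.
have fpi := cont_integrableM (ac_cont T0' pa) fi.
have pfi := cont_integrableM cf (proj1 pa).
have [_ /(_ T)] := ac_mul T0' fa pa.
rewrite lexx T0' => /(_ isT); rewrite p0; last by rewrite in_itv /=; lra.
rewrite p0; last by rewrite in_itv /=; lra.
have fpi' : mu.-integrable `[0, T] (EFin \o (fun s => f' s * p s)).
  by apply: integrable_eq fpi => s _; rewrite mulrC.
rewrite !mulr0 add0r RintegralD//= => H.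
rewrite !Rint_oo//; lra.
Qed.

(** Composing with this projection to [0, T] extends a function continuous on [0, T] to a continuous
    function on the line. *)
Definition clip T s : R := Num.max 0 (Num.min s T).

Lemma clip_in T s : 0 <= T -> 0 <= clip T s <= T.
Proof.
by move=> T0; rewrite /clip le_max lexx /= ge_max T0 /= ge_min lexx orbT.
Qed.

Lemma clip_id T s : 0 <= s <= T -> clip T s = s.
Proof. by move=> /andP[s0 sT]; rewrite /clip min_l// max_r. Qed.

Lemma clip_continuous T f : 0 <= T -> cont_on 0 T f ->
  continuous (fun s => f (clip T s)).
Proof.
move=> T0 cf s; apply: cont_atP => e e0.
have [d d0 dP] := cf _ (clip_in s T0) e e0.
exists d => // r rs; apply: dP; first exact: clip_in.
apply: le_lt_trans rs.
have clipE x : clip T x = if x < 0 then 0 else if x <= T then x else T.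
  rewrite /clip; case: (leP x T) => xT; case: (ltP x 0) => x0;
    by rewrite ?(max_r T0)//; lra.
have := ler_norm (r - s); have := ler_norm (s - r); rewrite (distrC s r) => h1 h2.
rewrite !clipE ler_norml; case: (ltP r 0) => r0; case: (ltP s 0) => s0;
  case: (leP r T) => rT; case: (leP s T) => sT; clear -r0 s0 rT sT h1 h2 T0; lra.
Qed.

(** Integrating from minus infinity gives a single formula that is differentiable at every point of
    the line, including 0. *)
Lemma ac_primitive_Ny T q : 0 <= T -> continuous q ->
  (forall s, ~~ (0 <= s <= T) -> q s = 0) ->
  exists2 p, forall s, is_derive s (1 : R) p (q s) &
     forall s, s <= 0 -> p s = 0.
Proof.
move=> T0 cq q0.
have qi : mu.-integrable setT (EFin \o q).
  have ci := cont_on_integrable (@continuous_cont_on _ 0 T _ cq).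
  have : mu.-integrable setT ((EFin \o q) \_ `[0, T]).
    by apply: (iffLR (integrable_mkcond _ _) ci).
  apply: eq_integrable => // s _.
  rewrite patchE mem_setE in_itv /=; case: ifP => // /negbT /q0 /= ->.
  by [].
exists (fun s => \int[mu]_(r in `]-oo, s]) q r) => s.
  have ss : s < s + 1 by rewrite ltrDl.
  have qi' : mu.-integrable `]-oo, (s + 1)] (EFin \o q) by exact: integrableS qi.
  have [|dp dE] := continuous_FTC1 ss qi' _ (cq s); first by rewrite ltNyr.
  by apply: DeriveDef; [exact: dp|rewrite -derive1E; exact: dE].
move=> s0; rewrite (@eq_Rintegral _ _ _ _ _ (fun=> 0)).
  by rewrite Rintegral_cst// mul0r.
move=> r; rewrite inE /= in_itv /= => rs; case: (ltP r 0) => r0.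
  by apply: q0; rewrite negb_and -ltNge r0.
have -> : r = 0 by lra.
suff : {for 0, continuous q} -> q 0 = 0 by apply; exact: cq.
move=> c0; apply/eqP; rewrite -normr_le0; apply/ler_addgt0Pr => e e0.
have [d d0 dP] := cont_at c0 e0.
have := dP (- (d / 2)); rewrite subr0 normrN ger0_norm; last lra.
move=> /(_ ltac:(lra)); rewrite (q0 (- (d / 2))); last by rewrite negb_and -ltNge; lra.
rewrite sub0r normrN add0r => /ltW; exact.
Qed.

(* The lemma of du Bois-Reymond: testing against a primitive of (F - k) w,
   where w is a bump and k the w-mean of F, gives int (F - k)^2 w = 0. *)
Lemma W12_ac T f f' : 0 < T -> W12 T f f' -> ac T f f'.
Proof.
move=> T0 [/within_cont_on cf _ f2 fw]; have T0' := ltW T0.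
have fi := L2_integrable T0' f2.
have ga := ac_prim fi; set g := (fun s => _) in ga.
pose F s := f s - g s.
have cF : cont_on 0 T F.
  by apply/within_cont_on => s; apply: cvgB;
    [move/within_cont_on: cf; exact|move/within_cont_on: (ac_cont T0' ga); exact].
pose G s := F (clip T s).
have cG : continuous G by exact: clip_continuous.
have GF s : 0 <= s <= T -> G s = F s by move=> sT; rewrite /G clip_id.
(* The bump [w] below is the positive part of a parabola, so the test function [p] is only C^1,
   which the definition of test functions allows. *)
have mid c d : 0 < c -> c < d -> d < T ->
    exists k, forall s, c < s < d -> F s = k.
  move=> c0 cd dT.
  pose w s := Num.max 0 ((s - c) * (d - s)).
  have cw : continuous w.
    move=> s; apply: (@continuous_max _ _ (fun=> 0) (fun s => (s - c) * (d - s))).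
      exact: cvg_cst.
    apply: cvgM; first by apply: cvgB => //; exact: cvg_cst.
    by apply: cvgB => //; exact: cvg_cst.
  have w0 s : 0 <= w s by rewrite le_max lexx.
  have wout s : ~~ (c <= s <= d) -> w s = 0.
    rewrite negb_and -!ltNge => h; apply/max_idPl.
    by case/orP: h => h; nra.
  have wpos s : c < s < d -> 0 < w s.
    by move=> h; rewrite lt_max; apply/orP; right; apply: mulr_gt0; lra.
  have wi : mu.-integrable `[0, T] (EFin \o w).
    by apply: cont_on_integrable; exact: continuous_cont_on.
  have wI : 0 < \int[mu]_(s in `[0, T]) w s.
    rewrite lt_neqAle Rint_ge0 ?andbT//; apply/eqP => wI.
    have := @int0_at _ T w ((c + d) / 2) (fun r _ => w0 r) wi (esym wI) ltac:(lra) (cw _).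
    by have := wpos ((c + d) / 2) ltac:(lra); lra.
  have Gwc : continuous (fun s => G s * w s).
    by move=> s; apply: cvgM; [exact: cG|exact: cw].
  have Gwi : mu.-integrable `[0, T] (EFin \o (fun s => G s * w s)).
    by apply: cont_on_integrable; exact: continuous_cont_on.
  pose k := (\int[mu]_(s in `[0, T]) (G s * w s)) / \int[mu]_(s in `[0, T]) w s.
  pose q s := (G s - k) * w s.
  have cq : continuous q.
    move=> s; apply: cvgM; last exact: cw.
    by apply: cvgB; [exact: cG|exact: cvg_cst].
  have kwi : mu.-integrable `[0, T] (EFin \o (fun s => k * w s)).
    exact: (integrableZl _ _ wi).
  have qI : \int[mu]_(s in `[0, T]) q s = 0.
    rewrite (@Rint_eq _ 0 T _ (fun s => G s * w s - k * w s)).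
      rewrite RintegralB//= RintegralZl// /k divfK ?subrr//.
      by rewrite gt_eqF.
    by move=> s _; rewrite /q; ring.
  have q0 s : ~~ (c <= s <= d) -> q s = 0.
    by move=> h; rewrite /q wout// mulr0.
  have q0T s : ~~ (0 <= s <= T) -> q s = 0.
    by move=> h; apply: q0; apply: contra h => h; lra.
  have [p pd p0] := ac_primitive_Ny T0' cq q0T.
  have pE : derive1 p = q.
    by apply/funext => s; rewrite derive1E; have [] := pd s.
  have pa t : 0 <= t -> ac t p q by move=> t0; exact: ac_C1.
  have pT t : T <= t -> p t = 0.
    move=> Tt; have ta := pa t ltac:(lra).
    have := ac_sub ta (lexx 0) T0' Tt; have := ac_sub ta T0' Tt (lexx t).
    rewrite qI (p0 0)// (@Rint_eq _ T t _ (fun=> 0)).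
      by rewrite Rintegral_cst// mul0r; lra.
    by move=> s sT; apply: q0; lra.
  have pc s : s < c -> p s = 0.
    case: (leP s 0) => [/p0//|s0 sc].
    have := ac_sub (pa s (ltW s0)) (lexx 0) (ltW s0) (lexx s).
    rewrite (p0 0)// (@Rint_eq _ 0 s _ (fun=> 0)).
      by rewrite Rintegral_cst// mul0r; lra.
    by move=> r rs; apply: q0; lra.
  have pd' s : d < s -> p s = 0.
    case: (leP T s) => [/pT//|sT ds].
    have := ac_sub (pa T T0') (ltac:(lra) : 0 <= s) (ltW sT) (lexx T).
    rewrite (pT T)// (@Rint_eq _ s T _ (fun=> 0)).
      by rewrite Rintegral_cst// mul0r; lra.
    by move=> r rs; apply: q0; lra.
  have tp : test_function T p.
    split; [by move=> s; have [] := pd s|by rewrite pE|].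
    exists c, d; split => // s; rewrite in_itv /= negb_and -!ltNge.
    by case/orP => [/pc|/pd'].
  have := fw p tp; rewrite pE.
  have cp : cont_on 0 T p by apply: (ac_cont T0'); exact: pa.
  have fqi : mu.-integrable `[0, T] (EFin \o (fun s => f s * q s)).
    apply: cont_integrableM => //; apply: cont_on_integrable.
    exact: continuous_cont_on.
  have pfi := cont_integrableM cp fi.
  have fpi : mu.-integrable `[0, T] (EFin \o (fun s => f' s * p s)).
    by apply: integrable_eq pfi => s _; rewrite mulrC.
  have gqi : mu.-integrable `[0, T] (EFin \o (fun s => g s * q s)).
    apply: cont_integrableM; first exact: ac_cont ga.
    by apply: cont_on_integrable; exact: continuous_cont_on.
  have := (ac_mul T0' ga (pa T T0')).2 T.
  rewrite T0' lexx => /(_ isT); rewrite (pT T)// (p0 0)// !mulr0 add0r.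
  rewrite RintegralD//= !Rint_oo// => I1 I2.
  (* The integrals of [f * q] and [g * q] both equal minus that of [f' * p], by the weak derivative
     and by the product rule, so they cancel; the term in [k] vanishes by the choice of [k]. *)
  have FqI : \int[mu]_(s in `[0, T]) ((F s - k) ^+ 2 * w s) = 0.
    transitivity (\int[mu]_(s in `[0, T]) (f s * q s - (g s * q s + k * q s))).
      by apply: Rint_eq => s sT; rewrite /q GF// /F; ring.
    have qi : mu.-integrable `[0, T] (EFin \o q).
      by apply: cont_on_integrable; exact: continuous_cont_on.
    have kqi : mu.-integrable `[0, T] (EFin \o (fun s => k * q s)).
      exact: (integrableZl _ _ qi).
    have si : mu.-integrable `[0, T] (EFin \o (fun s => g s * q s + k * q s)).
      have := integrableD _ gqi kqi; exact.
    by rewrite RintegralB//= RintegralD//= RintegralZl// qI; lra.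
  exists k => s scd.
  have Hc : continuous (fun s => ((G s - k) * (G s - k)) * w s).
    move=> r; apply: cvgM; last exact: cw.
    by apply: cvgM; apply: cvgB; (exact: cG || exact: cvg_cst).
  pose h r := (G r - k) * (G r - k) * w r.
  have h0 r : 0 <= r <= T -> 0 <= h r.
    by move=> _; rewrite /h -expr2 mulr_ge0// sqr_ge0.
  have hi : mu.-integrable `[0, T] (EFin \o h).
    by apply: cont_on_integrable; exact: continuous_cont_on.
  have hI : \int[mu]_(r in `[0, T]) h r = 0.
    by rewrite -[RHS]FqI; apply: Rint_eq => r rT; rewrite /h GF// -expr2.
  have sT : 0 < s < T.
    by case/andP: scd => cs sd; rewrite (lt_trans c0 cs) (lt_trans sd dT).
  have := int0_at h0 hi hI sT (Hc s).
  move/eqP; rewrite mulf_eq0 (gt_eqF (wpos s scd)) orbF -expr2 sqrf_eq0 subr_eq0.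
  by move/eqP; rewrite GF//; case/andP: sT => /ltW -> /ltW ->.
(* Any [s] shares an inner interval with the midpoint, which identifies the constants of all these
   intervals. *)
have FT2 s : 0 < s < T -> F s = F (T / 2).
  move=> sT.
  have [c [c0 cs cT]] : exists c, [/\ 0 < c, c < s & c < T / 2].
    by case: (ltP s (T / 2)) => h; [exists (s / 2)|exists (T / 4)]; split; lra.
  have [d [ds dT dT2]] : exists d, [/\ s < d, T / 2 < d & d < T].
    by case: (ltP s (T / 2)) => h; [exists (3 * T / 4)|exists ((s + T) / 2)];
      split; lra.
  have [k kP] := mid c d c0 ltac:(lra) dT2.
  by rewrite !kP//; lra.
have Fend s : 0 <= s <= T -> F s = F (T / 2).
  move=> sT; apply/eqP; rewrite -subr_eq0 -normr_le0; apply/ler_addgt0Pr => e e0.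
  have [d d0 dP] := cF s sT e e0.
  have [r [rT rs]] : exists r, 0 < r < T /\ `|r - s| < d.
    case: (ltP s (T / 2)) => sT2.
      exists (s + Num.min d (T / 2) / 2).
      have : 0 < Num.min d (T / 2) by rewrite lt_min d0; lra.
      have : Num.min d (T / 2) <= d by rewrite ge_min lexx.
      have : Num.min d (T / 2) <= T / 2 by rewrite ge_min lexx orbT.
      move: (Num.min d (T / 2)) => m m1 m2 m3.
      by split; [lra|rewrite ger0_norm; lra].
    exists (s - Num.min d (T / 2) / 2).
    have : 0 < Num.min d (T / 2) by rewrite lt_min d0; lra.
    have : Num.min d (T / 2) <= d by rewrite ge_min lexx.
    have : Num.min d (T / 2) <= T / 2 by rewrite ge_min lexx orbT.
    move: (Num.min d (T / 2)) => m m1 m2 m3.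
    by split; [lra|rewrite distrC ger0_norm; lra].
  have := dP r ltac:(lra) rs; rewrite (FT2 r rT) distrC => /ltW; lra.
split=> // s sT.
have := Fend s sT; rewrite -(Fend 0) ?lexx ?T0'//.
by rewrite /F /g Rint_xx; lra.
Qed.

End sobolev_absolutely_continuous.

(** * The planar isoperimetric problem with given barycentre *)

Section planar_bound.
Context {R : realType}.
Implicit Types (T x q th e : R).

Definition vnum x : R := sin x - x * cos x.

Lemma is_derive_vnum x : is_derive x (1 : R) vnum (x * sin x).
Proof. by apply: is_derive_eq; rewrite /GRing.scale /=; ring. Qed.

Lemma is_derive_mulM q x : is_derive x (1 : R) ( *%R q) q.
Proof. by apply: is_derive_eq; rewrite /GRing.scale /=; ring. Qed.

Lemma is_derive_sinM q x : is_derive x (1 : R) (fun t => sin (q * t)) (q * cos (q * x)).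
Proof.
apply: (is_derive_eq (is_derive1_comp (is_derive_sin _) (is_derive_mulM q x))).
by ring.
Qed.

Lemma is_derive_vnumM q x :
  is_derive x (1 : R) (fun t => vnum (q * t)) (q ^+ 2 * x * sin (q * x)).
Proof.
apply: (is_derive_eq (is_derive1_comp (is_derive_vnum _) (is_derive_mulM q x))).
by ring.
Qed.

(** This is [4 / x^2] times the logarithmic derivative of [vnum (q * x)], the substitution that
    linearizes the Riccati equation. It is the solution that behaves like [12 / x^3] at 0, where
    position and moment are prescribed, and it lives until [q * x] meets the first zero of
    [vnum]. *)
Definition riccati q x := 4 * q ^+ 2 * sin (q * x) / (x * vnum (q * x)).

Lemma is_derive_riccati q x : x != 0 -> vnum (q * x) != 0 ->
  is_derive x (1 : R) (riccati q)
    (- (riccati q x ^+ 2 * x ^+ 2 / 4 + 4 * q ^+ 2 / x ^+ 2)).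
Proof.
move=> x0 v0.
have ds := is_derive_sinM q x; have dv := is_derive_vnumM q x.
have xv0 : x * vnum (q * x) != 0 by rewrite mulf_neq0.
have dxv : is_derive x (1 : R) (fun t => t * vnum (q * t))
    (vnum (q * x) + q ^+ 2 * x ^+ 2 * sin (q * x)).
  by apply: is_derive_eq; rewrite /GRing.scale /=; ring.
have di := @is_deriveV R (fun t => t * vnum (q * t)) x _ 1 xv0 dxv.
have dn : is_derive x (1 : R) (fun t => 4 * q ^+ 2 * sin (q * t))
    (4 * q ^+ 3 * cos (q * x)).
  by apply: is_derive_eq; rewrite /GRing.scale /=; ring.
have dm := is_deriveM dn di.
apply: (is_derive_eq dm).
have E : q * x * cos (q * x) = sin (q * x) - vnum (q * x).
  by rewrite /vnum; ring.
rewrite /GRing.scale /= /riccati.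
set s := sin _ in E *; set c := cos _ in E *; set v := vnum _ in E xv0 v0 *.
have -> : 4 * q ^+ 3 * c = 4 * q ^+ 2 * (s - v) / x.
  by rewrite -E; field.
by rewrite expr2; field; apply/andP.
Qed.

Lemma cvg_vnum : continuous vnum.
Proof.
move=> x; apply/differentiable_continuous/derivable1_diffP.
by have [] := is_derive_vnum x.
Qed.

(* The quadratic form W = |y|^2 / t + k(t) |p - t y / 2|^2 - (4 q / t) p x y is
   the value function of the planar isoperimetric problem with prescribed
   barycentre; the Riccati equation for k makes
   dW + 2 q (y x dy) = 2 <dy, w> - |w|^2 dt with w the optimal velocity. *)
Lemma planar_cost_bound T th e (sg rh y1 v1 y2 v2 p1 p2 A C C' : R -> R) :
  0 <= T -> 0 < th -> 0 < e -> (forall x, 0 < x <= th -> 0 < vnum x) ->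
  ac T sg rh -> (forall s, 0 <= s <= T -> 0 <= rh s) -> sg 0 = 0 -> sg T = 1 ->
  ac T y1 v1 -> y1 0 = 0 -> y1 T = 0 ->
  ac T y2 v2 -> y2 0 = 0 -> y2 T = 0 ->
  ac T p1 (fun s => y1 s * rh s) -> p1 0 = 0 ->
  ac T p2 (fun s => y2 s * rh s) -> p2 0 = 0 ->
  ac T A (fun s => 2^-1 * (y1 s * v2 s - y2 s * v1 s)) -> A 0 = 0 ->
  ac T C C' -> C 0 = 0 ->
  (forall s, 0 <= s <= T -> forall w1 w2,
    2 * (v1 s * w1 + v2 s * w2) - (w1 ^+ 2 + w2 ^+ 2) * rh s <= C' s) ->
  4 * th * (1 + e) ^+ 2 * A T +
    4 * th ^+ 2 * sin th / vnum th * (p1 T ^+ 2 + p2 T ^+ 2)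
  <= (1 + e) ^+ 3 * C T.
Proof.
move=> T0 th0 e0 vpos sga rh0 sg0 sgT y1a y10 y1T y2a y20 y2T p1a p10 p2a p20.
move=> Aa A0 Ca C0 cost.
have e10 : 0 < 1 + e by lra.
(* Both [1 / t] and [riccati q t] are singular at 0, so the clock [t] runs from [e] to [1 + e]; this
   [q] makes it end with [q * t = th]. *)
pose q := th / (1 + e).
have q0 : 0 < q by exact: divr_gt0.
have qe : q * (1 + e) = th by rewrite /q divfK// gt_eqF.
have sg01 s : 0 <= s <= T -> 0 <= sg s <= 1.
  move=> sT.
  have := ac_sub sga (lexx 0) (_ : 0 <= s) (_ : s <= T).
  have := ac_sub sga (_ : 0 <= s) (_ : s <= T) (lexx T).
  have [s0 sT'] : 0 <= s /\ s <= T by apply/andP.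
  move=> /(_ s0 sT') h1 /(_ s0 sT') h2.
  have : 0 <= sg T - sg s by rewrite h1; apply: Rint_ge0 => r ?; apply: rh0; lra.
  have : 0 <= sg s - sg 0 by rewrite h2; apply: Rint_ge0 => r ?; apply: rh0; lra.
  by rewrite sg0 sgT; lra.
pose t s := sg s + e.
have ta : ac T t rh.
  have := ac_add sga (ac_cst e T0); apply: ac_eq => // s _.
  by rewrite addr0.
have [P [Pi PP]] : exists P : set R,
    is_interval P /\ forall x, P x <-> e <= x <= 1 + e.
  by exists [set x | e <= x <= 1 + e]; split=> // x y /= Px Py z zxy; lra.
have Pt s : 0 <= s <= T -> P (t s) by move=> /sg01 ?; apply/PP; rewrite /t; lra.
have P0 x : P x -> x != 0 by move=> /PP Px; rewrite gt_eqF//; lra.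
have Pv x : P x -> vnum (q * x) != 0.
  move=> /PP Px; rewrite gt_eqF//; apply: vpos.
  rewrite mulr_gt0//=; last lra.
  by rewrite -qe ler_wpM2l ?(ltW q0)//; lra.
have ia : ac T (fun s => (t s)^-1) (fun s => - (t s) ^- 2 * rh s).
  have gd x : P x -> is_derive x (1 : R) (fun x => x^-1) (- x ^- 2).
    move=> Px; apply: (is_derive_eq (@is_deriveV R id x _ 1 (P0 x Px) _)).
    by rewrite /GRing.scale /= mulr1.
  have gc x : P x -> {for x, continuous (fun x : R => - x ^- 2)}.
    move=> Px; apply: cvgN; apply: cvgV; first by rewrite expf_neq0// P0.
    exact: exprn_continuous.
  exact: (ac_comp T0 Pi gd gc Pt ta).
have ka : ac T (fun s => riccati q (t s)) (fun s => - (riccati q (t s) ^+ 2 *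
    t s ^+ 2 / 4 + 4 * q ^+ 2 / t s ^+ 2) * rh s).
  have gd x (Px : P x) := is_derive_riccati (P0 x Px) (Pv x Px).
  have gc x : P x -> {for x, continuous (fun x => - (riccati q x ^+ 2 *
    x ^+ 2 / 4 + 4 * q ^+ 2 / x ^+ 2))}.
    move=> Px.
    have kc : {for x, continuous (riccati q)}.
      by apply/differentiable_continuous/derivable1_diffP; have [] := gd x Px.
    have x2 : {for x, continuous (fun x : R => x ^+ 2)} by exact: exprn_continuous.
    apply: cvgN; apply: cvgD.
      apply: cvgM; last exact: cvg_cst.
      apply: cvgM; last exact: x2.
      apply: (@continuous_comp _ _ _ (riccati q) (fun x => x ^+ 2)); first exact: kc.
      exact: exprn_continuous.
    apply: cvgM; first exact: cvg_cst.
    by apply: cvgV; [rewrite expf_neq0// P0|exact: x2].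
  exact: (ac_comp T0 Pi gd gc Pt ta).
have ea (p y v : R -> R) : ac T y v -> ac T p (fun s => y s * rh s) ->
    ac T (fun s => p s - 2^-1 * (t s * y s))
         (fun s => y s * rh s - 2^-1 * (rh s * y s + t s * v s)).
  by move=> ya pa; apply: ac_sub_fun => //; apply: ac_scale; exact: ac_mul.
have Ya := ac_mul T0 ia (ac_add (ac_sqr T0 y1a) (ac_sqr T0 y2a)).
have Ea := ac_mul T0 ka (ac_add (ac_sqr T0 (ea _ _ _ y1a p1a))
                                (ac_sqr T0 (ea _ _ _ y2a p2a))).
have Xa := ac_scale (4 * q) (ac_mul T0 ia
  (ac_sub_fun (ac_mul T0 p1a y2a) (ac_mul T0 p2a y1a))).
have Fa := ac_sub_fun (ac_add (ac_sub_fun (ac_add Ya Ea) Xa)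
  (ac_scale (4 * q) Aa)) Ca.
have tT : t T = 1 + e by rewrite /t sgT.
have {Ya Ea Xa Fa} H : riccati q (1 + e) * (p1 T ^+ 2 + p2 T ^+ 2) + 4 * q * A T - C T <= 0.
  lapply (ac_le T0 Fa) => [|s sT].
    rewrite y10 y20 p10 p20 A0 C0 y1T y2T tT.
    congr (_ <= _); ring.
  have t0 : t s != 0 by apply: P0; exact: Pt.
  (* The cost inequality at the optimal velocity, which is half the coefficient of [(v1, v2)] in the
     derivative of the calibration. *)
  have := cost s sT
    (y1 s / t s - riccati q (t s) * t s / 2 * (p1 s - t s * y1 s / 2) +
      2 * q / t s * (p2 s - t s * y2 s / 2))
    (y2 s / t s - riccati q (t s) * t s / 2 * (p2 s - t s * y2 s / 2) -
      2 * q / t s * (p1 s - t s * y1 s / 2)).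
  rewrite -subr_ge0 -oppr_le0.
  congr (_ <= _); field.
  by [].
have kE : riccati q (1 + e) = 4 * th ^+ 2 * sin th / vnum th / (1 + e) ^+ 3.
  rewrite /riccati qe /q; field.
  by rewrite !gt_eqF//; apply: vpos; rewrite lexx th0.
rewrite kE /q in H.
set m := 4 * th ^+ 2 * sin th / vnum th in H *; set z := _ + _ ^+ 2 in H *.
have e3 : 0 < (1 + e) ^+ 3 by rewrite exprn_gt0.
have := ler_wpM2l (ltW e3) H; rewrite mulr0.
have -> : (1 + e) ^+ 3 * (m / (1 + e) ^+ 3 * z + 4 * (th / (1 + e)) * A T - C T) =
  m * z + 4 * th * (1 + e) ^+ 2 * A T - (1 + e) ^+ 3 * C T.
  by field; rewrite gt_eqF.
by lra.
Qed.

End planar_bound.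

(** * The functions S, U, V and Q *)

Section cut_functions.
Context {R : realType}.
Implicit Types (x y p : R).

Lemma sin_lt0 x : pi < x < pi + pi -> sin x < 0.
Proof.
move=> xp; have -> : x = (x - pi) + pi by ring.
by rewrite sinDpi oppr_lt0; apply: sin_gt0_pi; lra.
Qed.

Lemma vnum_MVT x y : exists z, [/\ vnum y - vnum x = z * sin z * (y - x) :> R &
  x <= z <= y \/ y <= z <= x].
Proof.
have [z [_ E H]] := @MVT_between R setT vnum _ x y (fun _ _ _ _ _ _ => I)
  (fun z _ => is_derive_vnum z) I I.
by exists z.
Qed.

Lemma vnum_pi : vnum pi = pi :> R.
Proof. by rewrite /vnum sinpi cospi; ring. Qed.

Lemma vnum_gt0_pi x : 0 < x <= pi -> 0 < vnum x.
Proof.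
move=> /andP[x0]; rewrite le_eqVlt => /predU1P[->|xp].
  by rewrite vnum_pi pi_gt0.
(* The interval is halved because the mean value theorem may return the endpoint 0, where the
   derivative [z * sin z] vanishes. *)
have [y [E xy]] := vnum_MVT 0 (x / 2).
have [z [E' xz]] := vnum_MVT (x / 2) x.
have v0 : vnum 0 = 0 :> R by rewrite /vnum sin0; ring.
have : 0 <= y * sin y * (x / 2 - 0).
  apply: mulr_ge0; last lra; apply: mulr_ge0; first lra.
  by apply: sin_ge0_pi; lra.
have : 0 < z * sin z * (x - x / 2).
  apply: mulr_gt0; last lra; apply: mulr_gt0; first lra.
  by apply: sin_gt0_pi; lra.
by rewrite -E -E' v0; lra.
Qed.

Lemma Vfun_vnum x : Vfun x = vnum x / (2 * x ^+ 2).
Proof. by []. Qed.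

Lemma Vfun_eq0 x : 0 < x -> Vfun x = 0 <-> vnum x = 0.
Proof.
move=> x0; have x2 : 2 * x ^+ 2 != 0 by rewrite gt_eqF// mulr_gt0// exprn_gt0.
rewrite Vfun_vnum; split=> [/eqP|->]; last by rewrite mul0r.
by rewrite mulf_eq0 invr_eq0 (negbTE x2) orbF => /eqP.
Qed.

(** Since [vnum] has derivative [x * sin x], it increases from 0 on [0, pi] and then decreases to -1
    at 3 pi / 2, with its first zero in between. *)
Lemma phi1P : [/\ pi < phi1 :> R, phi1 < pi + pi / 2 :> R, vnum phi1 = 0 :> R &
  forall x, 0 < x < phi1 -> 0 < vnum x].
Proof.
have p0 := @pi_gt0 R.
have v3 : vnum (pi + pi / 2) = -1 :> R.
  rewrite /vnum (addrC pi) sinDpi cosDpi sin_pihalf cos_pihalf; ring.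
have [z] : exists2 z, z \in `[pi, (pi + pi / 2)] & vnum z = 0 :> R.
  apply: IVT; first lra.
    by apply/within_cont_on/continuous_cont_on; exact: cvg_vnum.
  by rewrite vnum_pi v3 ge_min le_max (ltW p0) /= orbC /=; lra.
rewrite in_itv /= => zp vz.
have zp' : pi < z.
  by rewrite lt_neqAle (proj1 (andP zp)) andbT; apply/eqP => E;
     move: vz; rewrite -E vnum_pi; lra.
have zp2 : z < pi + pi / 2.
  by rewrite lt_neqAle (proj2 (andP zp)) andbT; apply/eqP => E;
     move: vz; rewrite E v3; lra.
have vpos x : 0 < x < z -> 0 < vnum x.
  move=> xz; case: (leP x pi) => xp; first by apply: vnum_gt0_pi; lra.
  have [y [E xy]] := vnum_MVT x z.
  have : 0 < - (y * sin y) * (z - x).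
    apply: mulr_gt0; last lra; rewrite -mulrN; apply: mulr_gt0; first lra.
    by rewrite oppr_gt0; apply: sin_lt0; lra.
  by rewrite mulNr -E vz; lra.
have -> : phi1 = z; last by [].
apply/eqP; rewrite eq_le; apply/andP; split.
  apply: ge_inf; last by split; [lra|apply/Vfun_eq0; lra].
  by exists 0 => x [/ltW].
apply: lb_le_inf; first by exists z; split; [lra|apply/Vfun_eq0; lra].
move=> x [x0 /(Vfun_eq0 x0) vx]; rewrite leNgt; apply/negP => xz.
by have := vpos x; rewrite x0 xz vx ltxx => /(_ isT).
Qed.

Lemma sin_lt0_phi1 x : pi < x <= phi1 -> sin x < 0.
Proof.
by have [_ p _ _] := phi1P; have p0 := @pi_gt0 R; move=> xp; apply: sin_lt0; lra.
Qed.

Lemma Sfun_le0 x : pi <= x <= phi1 -> Sfun x <= 0.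
Proof.
have p0 := @pi_gt0 R; move=> /andP[].
rewrite le_eqVlt => /predU1P[<- _|px xp]; first by rewrite /Sfun sinpi mul0r.
rewrite /Sfun nmulr_rle0 ?invr_ge0; first lra.
by apply: sin_lt0_phi1; rewrite px.
Qed.

Lemma Vfun_gt0 x : 0 < x < phi1 -> 0 < Vfun x.
Proof.
move=> xp; rewrite Vfun_vnum divr_gt0//; first by have [_ _ _] := phi1P; apply.
by rewrite mulr_gt0// exprn_gt0; lra.
Qed.

Lemma Vfun_phi1 : Vfun phi1 = 0 :> R.
Proof. by have [p _ v _] := phi1P; rewrite Vfun_vnum v mul0r. Qed.

Lemma Vfun_ge0 x : pi <= x <= phi1 -> 0 <= Vfun x.
Proof.
have p0 := @pi_gt0 R; move=> /andP[px].
rewrite le_eqVlt => /predU1P[->|xp]; first by rewrite Vfun_phi1.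
by apply/ltW/Vfun_gt0; lra.
Qed.

Lemma Vfun_Sfun x : x != 0 -> Vfun x = (Sfun x - cos x) / (2 * x).
Proof. by move=> x0; rewrite /Vfun /Sfun; field. Qed.

(** Pythagoras for [sin x = x * S] and [cos x = S - 2 * x * V]. *)
Lemma Sfun_Vfun_sqr x : x != 0 ->
  x ^+ 2 * (4 * Vfun x ^+ 2 + Sfun x ^+ 2) - 4 * x * Sfun x * Vfun x =
  1 - Sfun x ^+ 2.
Proof.
move=> x0; have cs := sin2cos2 x.
rewrite Vfun_Sfun//.
have -> : x ^+ 2 * (4 * ((Sfun x - cos x) / (2 * x)) ^+ 2 + Sfun x ^+ 2) -
   4 * x * Sfun x * ((Sfun x - cos x) / (2 * x)) =
  (Sfun x - cos x) ^+ 2 + (x * Sfun x) ^+ 2 - 2 * Sfun x * (Sfun x - cos x).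
  by field.
have -> : x * Sfun x = sin x by rewrite /Sfun; field.
by rewrite cs; ring.
Qed.

Lemma Ufun_Sfun x : x != 0 ->
  Ufun x = (1 - Sfun x ^+ 2) / (4 * x) + Sfun x * Vfun x / 2.
Proof. by move=> x0; rewrite /Ufun /Vfun /Sfun; field. Qed.

Lemma is_derive_Sfun x : x != 0 -> is_derive x (1 : R) Sfun (- 2 * Vfun x).
Proof.
move=> x0; have di := @is_deriveV R id x _ 1 x0 (is_derive_id _ _).
apply: (is_derive_eq (is_deriveM (is_derive_sin x) di)).
by rewrite /GRing.scale /= /Vfun; field.
Qed.

Lemma is_derive_Vfun x : x != 0 ->
  is_derive x (1 : R) Vfun (Sfun x / 2 - 2 * Vfun x / x).
Proof.
move=> x0; have x2 : 2 * x ^+ 2 != 0 by rewrite mulf_neq0 ?expf_neq0.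
have d2 : is_derive x (1 : R) (fun x => 2 * x ^+ 2) (4 * x).
  by apply: is_derive_eq; rewrite /GRing.scale /=; ring.
have di := @is_deriveV R (fun x => 2 * x ^+ 2) x _ 1 x2 d2.
apply: (is_derive_eq (is_deriveM (is_derive_vnum x) di)).
by rewrite /GRing.scale /= /Vfun /Sfun /vnum; field.
Qed.

Lemma Sfun_sqr_le x : pi <= x -> Sfun x ^+ 2 <= 4^-1.
Proof.
move=> px; have p2 := @pi_ge2 R.
rewrite /Sfun expr_div_n ler_pdivrMr ?exprn_gt0//; last lra.
have := sqr_ge0 (cos x); have := sin2cos2 x.
have : 2 * 2 <= x * x by apply: ler_pM; lra.
rewrite -[x * x]expr2; lra.
Qed.

Lemma Ufun_gt0 x : pi <= x -> 0 < Ufun x.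
Proof.
move=> px; have p2 := @pi_ge2 R; have x2 : 2 <= x by lra.
rewrite /Ufun divr_gt0// ?mulr_gt0 ?exprn_gt0//; [|lra..].
have := sin_le1 x; have := sin_geN1 x; have := cos_le1 x; have := cos_geN1 x.
by move=> *; nra.
Qed.

Lemma QinvP (k : R) : 0 <= k ->
  [/\ pi <= Qinv k, Qinv k < phi1 & Qfun (Qinv k) = k].
Proof.
move=> k0; have [p1 p2 v1 vpos] := phi1P; have p0 := @pi_gt0 R.
have contf (f : R -> R) (df : R -> R) : (forall x, pi <= x -> is_derive x (1 : R) f (df x)) ->
    {within `[pi, phi1], continuous f}.
  move=> fd; apply: derivable_within_continuous => x.
  by rewrite in_itv /= => /andP[/fd []].
have xn0 x : pi <= x -> x != 0 by move=> ?; rewrite gt_eqF//; lra.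
(* The equation [Qfun t = k] with denominators cleared stays continuous at [phi1], where [Vfun]
   vanishes; its left side is positive there, which excludes [t = phi1]. *)
have [t] : exists2 t, t \in `[pi, phi1] &
    (t - sin t * cos t) * sin t * -1 - k * (2 * t * vnum t) = 0 :> R.
  have dl x : pi <= x -> is_derive x (1 : R)
     (fun t => (t - sin t * cos t) * sin t * -1 - k * (2 * t * vnum t))
     ((1 - (cos x * cos x - sin x * sin x)) * sin x * -1 + (x - sin x * cos x) * cos x * -1
      - k * (2 * vnum x + 2 * x * (x * sin x))).
    move=> _; have dv := is_derive_vnum x.
    by apply: is_derive_eq; rewrite /GRing.scale /=; ring.
  apply: IVT; [exact: ltW|exact: contf dl|].
  rewrite sinpi vnum_pi v1 !mulr0 mul0r subr0 sub0r ge_min le_max.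
  have h1 : - (k * (2 * pi * pi)) <= 0 by rewrite oppr_le0 !mulr_ge0//; lra.
  have s1 : sin phi1 < 0 :> R by apply: sin_lt0_phi1; lra.
  have h2 : 0 <= (phi1 - sin phi1 * cos phi1) * sin phi1 * -1 :> R.
    rewrite mulrN1 oppr_ge0 mulr_ge0_le0//; last exact: ltW.
    have := sin_le1 (phi1 : R); have := sin_geN1 (phi1 : R).
    have := cos_le1 (phi1 : R); have := cos_geN1 (phi1 : R).
    have := @pi_ge2 R; nra.
  by rewrite h1 h2 orbT.
rewrite in_itv /= => /andP[tp]; rewrite le_eqVlt => /predU1P[->|t1] tE.
  have s1 : sin phi1 < 0 :> R by apply: sin_lt0_phi1; lra.
  move: tE; rewrite v1 !mulr0 subr0 => /eqP.
  rewrite mulrN1 oppr_eq0 mulf_eq0 (lt_eqF s1) orbF => /eqP.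
  have := sin_le1 (phi1 : R); have := sin_geN1 (phi1 : R).
  have := cos_le1 (phi1 : R); have := cos_geN1 (phi1 : R).
  have := @pi_ge2 R; nra.
have Qt : Qfun t = k.
  have vt : vnum t != 0 by rewrite gt_eqF//; apply: vpos; lra.
  have t0 := xn0 t tp.
  have -> : k = (t - sin t * cos t) * sin t * -1 / (2 * t * vnum t).
    apply: (@mulIf _ (2 * t * vnum t)); first by rewrite !mulf_neq0.
    by rewrite divfK ?mulf_neq0//; lra.
  rewrite /Qfun Vfun_vnum /Ufun /Sfun; field.
  by rewrite vt.
have kQ : k \in [set Qfun x | x in `[pi, phi1[%classic] .
  by rewrite inE; exists t => //=; rewrite in_itv /= tp.
have surj : set_surj `[pi, phi1[ (Qfun @` `[pi, phi1[%classic) (@Qfun R) by [].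
have : `[pi, phi1[%classic (Qinv k).
  by apply: (surjpinv_image_sub (dflt := fun=> 0) surj); exists k => //; exact/set_mem.
rewrite /= in_itv /= => /andP[q1 q2]; split => //.
exact: (pinvK (fun=> 0) kQ).
Qed.

End cut_functions.

(** * Optimizing the planar bounds over their parameter *)

Section planar_optimum.
Context {R : realType}.
Implicit Types (x y p : R).

(** For a circular arc of unit length and half-angle x, S is the signed chord, U the area between
    arc and chord, V the mean height over the chord. The loop left after subtracting the uniformly
    traversed chord has energy [1 - S^2], barycentre [V] and area [U - S * V]; [rfun] rescales its
    energy to 1. *)
Definition rfun x : R := (Num.sqrt (1 - Sfun x ^+ 2))^-1.

Lemma rfun_gt0 x : pi <= x -> 0 < rfun x.
Proof.
by move=> px; rewrite invr_gt0 sqrtr_gt0; have := Sfun_sqr_le px; lra.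
Qed.

Lemma rfun_sqr x : pi <= x -> (1 - Sfun x ^+ 2) * rfun x ^+ 2 = 1.
Proof.
move=> px; have h := Sfun_sqr_le px.
rewrite /rfun exprVn sqr_sqrtr; last lra.
by rewrite divff// gt_eqF//; lra.
Qed.

Lemma is_derive_rfun x : pi <= x ->
  is_derive x (1 : R) rfun (- 2 * Sfun x * Vfun x * rfun x ^+ 3).
Proof.
move=> px; have h := Sfun_sqr_le px; have p0 := @pi_gt0 R.
have x0 : x != 0 by rewrite gt_eqF//; lra.
have dS := is_derive_Sfun x0.
have N0 : 0 < 1 - Sfun x ^+ 2 by lra.
have dN : is_derive x (1 : R) (fun x => 1 - Sfun x ^+ 2) (4 * Sfun x * Vfun x).
  by apply: is_derive_eq; rewrite /GRing.scale /=; ring.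
have dq := @is_derive1_comp R Num.sqrt (fun x => 1 - Sfun x ^+ 2) x _ _ (is_derive1_sqrt N0) dN.
have q0 : Num.sqrt (1 - Sfun x ^+ 2) != 0 by rewrite gt_eqF// sqrtr_gt0.
apply: (is_derive_eq (@is_deriveV R (Num.sqrt \o (fun x => 1 - Sfun x ^+ 2)) x _ 1 q0 dq)).
by rewrite /GRing.scale /= /rfun; field.
Qed.

(* The best planar bounds, parametrized by x, have a concave graph; [envelope y]
   is, up to a constant, its height above its tangent at x = y. *)
Definition envelope y x := (4 * x)^-1 / rfun y
  - Sfun x * Vfun x * rfun x ^+ 2 / 2 / rfun y + Sfun y * (Vfun x * rfun x).

(** The first factor is the derivative of the rescaled barycentre [Vfun * rfun]. That the area
    varies proportionally to it rests on [Sfun_Vfun_sqr], which removes the derivative of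
    [1 / (4 x)]. *)
Lemma is_derive_envelope y x : pi <= y -> pi <= x ->
  is_derive x (1 : R) (envelope y)
    (((Sfun x / 2 - 2 * Vfun x / x) * rfun x - 2 * Sfun x * Vfun x ^+ 2 * rfun x ^+ 3)
     * (Sfun y - Sfun x * rfun x / rfun y)).
Proof.
move=> py px; have p0 := @pi_gt0 R.
have x0 : x != 0 by rewrite gt_eqF//; lra.
have dS := is_derive_Sfun x0; have dV := is_derive_Vfun x0.
have dr := is_derive_rfun px.
have d4 : is_derive x (1 : R) (fun x => (4 * x)^-1) (- (4 * x ^+ 2)^-1).
  have x40 : 4 * x != 0 by rewrite mulf_neq0.
  have d4 : is_derive x (1 : R) ( *%R 4) 4 by exact: is_derive_mulM.
  apply: (is_derive_eq (@is_deriveV R ( *%R 4) x _ 1 x40 d4)).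
  by rewrite /GRing.scale /=; field.
apply: is_derive_eq; rewrite /GRing.scale /=.
have E1 := rfun_sqr px; have E2 := Sfun_Vfun_sqr x0.
have E3 : (4 * x ^+ 2)^-1 = (Vfun x ^+ 2 + Sfun x ^+ 2 / 4 -
     Sfun x * Vfun x / x) * rfun x ^+ 2.
  apply: (@mulfI _ (4 * x ^+ 2)); first by rewrite mulf_neq0 ?expf_neq0.
  rewrite mulfV ?mulf_neq0 ?expf_neq0//.
  transitivity ((1 - Sfun x ^+ 2) * rfun x ^+ 2); first by rewrite E1.
  by rewrite -E2; field.
rewrite E3; have ry : rfun y != 0 by rewrite gt_eqF// rfun_gt0.
by field; rewrite ry.
Qed.

Lemma Sfun_nincr x y : pi <= x -> x <= y -> y <= phi1 -> Sfun y <= Sfun x.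
Proof.
move=> px xy yp; have p0 := @pi_gt0 R.
have [z [/= zP E H]] := @MVT_between R [set x | pi <= x <= phi1] Sfun
  (fun x => - 2 * Vfun x) x y
  (fun _ _ a b _ c => ltac:(move: a b c; rewrite /=; lra))
  (fun z Pz => is_derive_Sfun (lt0r_neq0 (lt_le_trans (@pi_gt0 R) (proj1 (andP Pz)))))
  ltac:(rewrite /=; lra) ltac:(rewrite /=; lra).
have V0 := Vfun_ge0 zP.
have : 0 <= Vfun z * (y - x) by apply: mulr_ge0 => //; lra.
lra.
Qed.

Lemma rfun_ge x y : pi <= x -> x <= y -> y <= phi1 -> rfun x <= rfun y.
Proof.
move=> px xy yp; rewrite lef_pV2.
- rewrite ler_wsqrtr// lerD2l lerN2 -(sqrrN (Sfun x)) -(sqrrN (Sfun y)).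
  have := Sfun_nincr px xy yp; have := @Sfun_le0 R x.
  by rewrite px (le_trans xy yp) => /(_ isT) *; apply: lerXn2r; rewrite ?nnegrE; lra.
- by rewrite posrE sqrtr_gt0; have := Sfun_sqr_le px; lra.
- by rewrite posrE sqrtr_gt0; have := Sfun_sqr_le (le_trans px xy); lra.
Qed.

Lemma Sfun_rfun_nincr x y : pi <= x -> x <= y -> y <= phi1 ->
  Sfun y * rfun y <= Sfun x * rfun x.
Proof.
move=> px xy yp; have py := le_trans px xy.
apply: (@le_trans _ _ (Sfun x * rfun y)).
  by rewrite ler_wpM2r ?(ltW (rfun_gt0 py))//; exact: Sfun_nincr.
rewrite ler_wnM2l ?rfun_ge// Sfun_le0//; lra.
Qed.

(** Both [Vfun * rfun] and [Sfun * rfun] are nonincreasing, so the factored derivative passes from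
    nonnegative to nonpositive at [y]. *)
Lemma envelope_max y x : pi <= y <= phi1 -> pi <= x <= phi1 ->
  envelope y x <= envelope y y.
Proof.
move=> yp xp; have p0 := @pi_gt0 R; have p2 := @pi_ge2 R.
have py : pi <= y by lra.
have [z [/= zP E H]] := @MVT_between R [set x | pi <= x <= phi1] (envelope y) _ y x
  (fun _ _ a b _ c => ltac:(move: a b c; rewrite /=; lra))
  (fun z Pz => is_derive_envelope py (proj1 (andP Pz))) yp xp.
have pz : pi <= z by lra.
rewrite -subr_le0 E.
set m := (X in X * _ * _).
have r0 := rfun_gt0 pz; have ry0 := rfun_gt0 py.
have m0 : m <= 0.
  have z0 : z != 0 by rewrite gt_eqF//; lra.
  have -> : m = (Sfun z / 2 * (1 - Sfun z ^+ 2 - 4 * Vfun z ^+ 2) -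
      2 * Vfun z * (1 - Sfun z ^+ 2) / z) * rfun z ^+ 3.
    transitivity ((Sfun z / 2 - 2 * Vfun z / z) *
      ((1 - Sfun z ^+ 2) * rfun z ^+ 2 * rfun z) -
      2 * Sfun z * Vfun z ^+ 2 * rfun z ^+ 3); first by rewrite rfun_sqr// mul1r.
    by field.
  rewrite pmulr_lle0 ?exprn_gt0//.
  have S2 := Sfun_sqr_le pz.
  (* From [|S| <= 1 / 2], [|cos| <= 1] and [z >= 2]. Together with [S ^+ 2 <= 1 / 4] this leaves
     [1 - S ^+ 2 - 4 * V ^+ 2] positive. *)
  have V2 : 4 * Vfun z ^+ 2 <= 9 / 16.
    have -> : 4 * Vfun z ^+ 2 = (Sfun z - cos z) ^+ 2 / z ^+ 2.
      by rewrite Vfun_Sfun//; field.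
    rewrite ler_pdivrMr ?exprn_gt0//; last lra.
    have S1 := Sfun_le0 zP.
    have S1' : - (1 / 2) <= Sfun z.
      rewrite leNgt; apply/negP => h.
      have : (1 / 2) ^+ 2 < (- Sfun z) ^+ 2.
        by rewrite ltr_pXn2r ?nnegrE//; lra.
      rewrite sqrrN; lra.
    have := cos_le1 z; have := cos_geN1 z => c1 c2.
    have zz : 2 * 2 <= z * z by apply: ler_pM; lra.
    have : (Sfun z - cos z) ^+ 2 <= 9 / 4.
      by have := sqr_ge0 (Sfun z); rewrite expr2; nra.
    by rewrite -[z ^+ 2]/(z * z); lra.
  have : 0 <= - Sfun z / 2 * (1 - Sfun z ^+ 2 - 4 * Vfun z ^+ 2).
    by have := Sfun_le0 zP => ?; apply: mulr_ge0; lra.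
  have : 0 <= 2 * Vfun z * (1 - Sfun z ^+ 2) / z.
    apply: divr_ge0; last lra.
    by apply: mulr_ge0; [have := Vfun_ge0 zP|]; lra.
  lra.
have fE : Sfun y - Sfun z * rfun z / rfun y = (Sfun y * rfun y - Sfun z * rfun z) / rfun y.
  by field; rewrite gt_eqF.
rewrite fE; case: H => H.
  have h : Sfun z * rfun z <= Sfun y * rfun y by apply: Sfun_rfun_nincr; lra.
  apply: mulr_le0_ge0; last lra.
  by apply: mulr_le0_ge0 => //; apply: divr_ge0; lra.
have h : Sfun y * rfun y <= Sfun z * rfun z by apply: Sfun_rfun_nincr; lra.
apply: mulr_ge0_le0; last lra.
by apply: mulr_le0 => //; apply: mulr_le0_ge0; [lra|rewrite invr_ge0; exact: ltW].
Qed.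

Lemma envelope_diag y : pi <= y -> envelope y y / rfun y = Ufun y.
Proof.
move=> py; have p0 := @pi_gt0 R.
have y0 : y != 0 by rewrite gt_eqF//; lra.
have ry : rfun y != 0 by rewrite gt_eqF// rfun_gt0.
rewrite (Ufun_Sfun y0) /envelope.
have E : 1 - Sfun y ^+ 2 = (rfun y ^+ 2)^-1.
  by apply: (@mulIf _ (rfun y ^+ 2)); rewrite ?expf_neq0// mulVf ?expf_neq0// rfun_sqr.
rewrite E; field.
by rewrite ?y0 ?ry.
Qed.

(** Here [n * envelope y x] is the area plus [Sfun y] times the barycentre of the circular loop of
    parameter [x], rescaled to energy [1 - S(y)^2]. The right [x] is the one whose rescaled loop has
    barycentre [P]: for it the hypothesis and [envelope_max] combine to the claim. *)
Lemma planar_optimum y P L : pi <= y < phi1 -> 0 <= P ->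
  (forall x, pi <= x < phi1 ->
     4 * x * (Ufun y - Sfun y * P) + 2 * x * Sfun x / Vfun x * P ^+ 2 <= L) ->
  1 - Sfun y ^+ 2 <= L.
Proof.
move=> yp P0 H; have p0 := @pi_gt0 R; have [pf _ _ _] := @phi1P R.
have py : pi <= y by lra.
set n := (rfun y)^-1.
have r0 := rfun_gt0 py; have n0 : 0 < n by rewrite invr_gt0.
have N : 1 - Sfun y ^+ 2 = n ^+ 2.
  apply: (@mulIf _ (rfun y ^+ 2)); first by rewrite expf_neq0// gt_eqF.
  by rewrite rfun_sqr// /n; field; rewrite gt_eqF.
have max x : pi <= x <= phi1 -> n * envelope y x <= Ufun y.
  move=> xp; rewrite -envelope_diag// mulrC ler_pM2r//.
  by apply: envelope_max => //; lra.
have pn0 : pi != 0 :> R by rewrite gt_eqF.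
have Vpi : Vfun pi = (2 * pi)^-1 :> R.
  have aux (p : R) : p != 0 -> p / (2 * p ^+ 2) = (2 * p)^-1.
    by move=> ?; field.
  by rewrite Vfun_vnum vnum_pi aux.
have Spi : Sfun pi = 0 :> R by rewrite /Sfun sinpi mul0r.
have rpi : rfun pi = 1 :> R by rewrite /rfun Spi expr0n subr0 sqrtr1 invr1.
have Sy : Sfun y <= 0 by apply: Sfun_le0; lra.
(* A [P] beyond the value at pi needs no matching loop: at [x = pi] the term in [P ^+ 2] disappears
   because [Sfun pi = 0], and the remaining bound grows with [P]. *)
rewrite N; case: (leP P (n * (Vfun pi * rfun pi))) => HP; last first.
  have := H pi; rewrite lexx pf Spi mulr0 !mul0r addr0 => /(_ isT); apply: le_trans.
  have := max pi; rewrite lexx (ltW pf) => /(_ isT).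
  rewrite /envelope Spi rpi mulr1 !mul0r subr0 -/n => h.
  rewrite rpi mulr1 in HP.
  have h2 : - Sfun y * (n * Vfun pi) <= - Sfun y * P.
    by rewrite ler_wpM2l ?oppr_ge0// ltW.
  have : 4 * pi * (n * ((4 * pi)^-1 * n + Sfun y * Vfun pi)) <= 4 * pi * (Ufun y).
    by rewrite ler_wpM2l//; lra.
  have -> : 4 * pi * (n * ((4 * pi)^-1 * n + Sfun y * Vfun pi)) =
     n ^+ 2 + 4 * pi * (Sfun y * (n * Vfun pi)).
    by move: pn0; generalize (pi : R) => p pn0; field.
  have : 4 * pi * (- Sfun y * (n * Vfun pi)) <= 4 * pi * (- Sfun y * P).
    by rewrite ler_wpM2l//; lra.
  lra.
have [x] : exists2 x, x \in `[pi, phi1] & n * (Vfun x * rfun x) = P.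
  apply: IVT; first exact: ltW.
    apply: derivable_within_continuous => x; rewrite in_itv /= => /andP[px xf].
    have x0 : x != 0 by rewrite gt_eqF//; lra.
    have dV := is_derive_Vfun x0; have dr := is_derive_rfun px.
    have dm := is_deriveM dV dr.
    have dn := is_deriveM (is_derive_cst n x (1 : R)) dm.
    by have [] := dn.
  by rewrite Vfun_phi1 mul0r mulr0 ge_min le_max P0 HP /= orbT.
rewrite in_itv /= => /andP[px]; rewrite le_eqVlt => /predU1P[->|xf] PE.
  (* The loop with barycentre 0 has parameter [phi1], which the hypothesis excludes; a value [x']
     between [L / (4 * Ufun y)] and [phi1] contradicts [L < n ^+ 2] instead. *)
  have {}PE : P = 0 by rewrite -PE Vfun_phi1 mul0r mulr0.
  have := max phi1; rewrite (ltW pf) lexx => /(_ isT).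
  rewrite /envelope Vfun_phi1 mulr0 !mul0r mulr0 subr0 addr0 -/n => h.
  have f0 : 0 < (phi1 : R) by lra.
  have h4 : n ^+ 2 <= 4 * phi1 * Ufun y.
    have : 4 * phi1 * (n * ((4 * phi1)^-1 * n)) <= 4 * phi1 * Ufun y.
      by rewrite ler_wpM2l//; lra.
    have -> // : 4 * phi1 * (n * ((4 * phi1)^-1 * n)) = n ^+ 2 :> R.
    by field; rewrite gt_eqF.
  have U0 : 0 < Ufun y.
    rewrite -(pmulr_rgt0 _ (_ : 0 < 4 * phi1)); last lra.
    by apply: lt_le_trans h4; rewrite exprn_gt0.
  rewrite leNgt; apply/negP => Ln.
  have L4 : L / (4 * Ufun y) < phi1.
    by rewrite ltr_pdivrMr; lra.
  pose x' := Num.max pi ((L / (4 * Ufun y) + phi1) / 2).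
  have x'p : pi <= x' by rewrite le_max lexx.
  have x'f : x' < phi1 by rewrite gt_max pf /=; lra.
  have x'L : L / (4 * Ufun y) < x' by rewrite lt_max; apply/orP; right; lra.
  have := H x'; rewrite x'p x'f PE mulr0 subr0 expr0n mulr0 addr0 => /(_ isT).
  move: x'L; rewrite ltr_pdivrMr; last lra.
  lra.
have := H x; rewrite px xf => /(_ isT); apply: le_trans.
have xp : pi <= x <= phi1 by lra.
have := max x xp => h.
have V0 : Vfun x != 0 by rewrite gt_eqF// Vfun_gt0//; lra.
have x0 : x != 0 by rewrite gt_eqF//; lra.
have : 0 <= 4 * x * (Ufun y - n * envelope y x) by apply: mulr_ge0; lra.
rewrite -PE /envelope -/n.
have -> : 2 * x * Sfun x / Vfun x * (n * (Vfun x * rfun x)) ^+ 2 =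
  2 * x * Sfun x * Vfun x * rfun x ^+ 2 * n ^+ 2 by field.
have -> : 4 * x * (Ufun y - n * ((4 * x)^-1 * n - Sfun x * Vfun x * rfun x ^+ 2 / 2 * n +
     Sfun y * (Vfun x * rfun x))) =
  4 * x * (Ufun y - Sfun y * (n * (Vfun x * rfun x))) +
     2 * x * Sfun x * Vfun x * rfun x ^+ 2 * n ^+ 2 - n ^+ 2.
  by field.
lra.
Qed.

End planar_optimum.

(** * The lower bound at the cut point *)

Section axis_bound.
Context {R : realType}.
Notation mu := (@lebesgue_measure R).
Implicit Types (a b c T : R).

Lemma cubic_limit a b c : (forall e, 0 < e -> a * (1 + e) ^+ 2 + b <= (1 + e) ^+ 3 * c) ->
  a + b <= c.
Proof.
move=> H; rewrite leNgt; apply/negP => abc.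
set g := a + b - c; have g0 : 0 < g by rewrite /g; lra.
(* [K] dominates the coefficients of [e], [e^2], [e^3] in the expansion; the [e] below is at most 1
   and keeps [e * K] within half the gap [g]. *)
set K := `|3 * c - 2 * a| + `|3 * c - a| + `|c| + 1.
have K0 : 0 < K by rewrite /K; have := normr_ge0 (3 * c - 2 * a);
  have := normr_ge0 (3 * c - a); have := normr_ge0 c; lra.
have gK : 0 < g + 2 * K by lra.
pose e := g / (g + 2 * K).
have e0 : 0 < e by exact: divr_gt0.
have eE : e * (g + 2 * K) = g by rewrite /e divfK// gt_eqF.
have e1 : e <= 1 by rewrite /e ler_pdivrMr//; lra.
have eK : e * K <= g / 2.
  by have : 0 <= e * g by [apply: mulr_ge0; exact: ltW]; lra.
have := H e e0; move: eE => _; clearbody e.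
have h1 : e * (3 * c - 2 * a) <= e * `|3 * c - 2 * a|.
  by rewrite ler_wpM2l ?ler_norm// ltW.
have h2 : e ^+ 2 * (3 * c - a) <= e * `|3 * c - a|.
  apply: (@le_trans _ _ (e ^+ 2 * `|3 * c - a|)).
    by rewrite ler_wpM2l ?ler_norm// sqr_ge0.
  by rewrite ler_wpM2r// expr2 ger_pMr.
have h3 : e ^+ 3 * c <= e * `|c|.
  apply: (@le_trans _ _ (e ^+ 3 * `|c|)).
    by rewrite ler_wpM2l ?ler_norm// exprn_ge0// ltW.
  by rewrite ler_wpM2r// exprS ger_pMr// expr_le1// ltW.
rewrite -subr_ge0.
have -> : (1 + e) ^+ 3 * c - (a * (1 + e) ^+ 2 + b) =
  - g + e * (3 * c - 2 * a) + e ^+ 2 * (3 * c - a) + e ^+ 3 * c.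
  by rewrite /g; ring.
move: eK; rewrite /K !mulrDr mulr1 => eK; clearbody g; lra.
Qed.

Lemma rotate_to (M1 M2 P g : R) : P ^+ 2 + g ^+ 2 = M1 ^+ 2 + M2 ^+ 2 ->
  exists ce se, [/\ ce ^+ 2 + se ^+ 2 = 1, ce * M1 + se * M2 = P &
    ce * M2 - se * M1 = g].
Proof.
move=> H; set c := M1 ^+ 2 + M2 ^+ 2 in H.
have [c0|c0] := eqVneq c 0.
  exists 1, 0; move: H; rewrite c0 => /eqP.
  rewrite paddr_eq0 ?sqr_ge0// !sqrf_eq0 => /andP[/eqP -> /eqP ->].
  move/eqP: c0; rewrite /c paddr_eq0 ?sqr_ge0// !sqrf_eq0 => /andP[/eqP -> /eqP ->].
  by split; ring.
(* The real and imaginary parts of the quotient of [M1 + i M2] by [P + i g]. *)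
exists ((P * M1 + g * M2) / c), ((P * M2 - g * M1) / c); split.
- have -> : ((P * M1 + g * M2) / c) ^+ 2 + ((P * M2 - g * M1) / c) ^+ 2 =
    (P ^+ 2 + g ^+ 2) * (M1 ^+ 2 + M2 ^+ 2) / c ^+ 2 by field.
  by rewrite H -/c -expr2 divff// expf_neq0.
- have -> : (P * M1 + g * M2) / c * M1 + (P * M2 - g * M1) / c * M2 =
    P * (M1 ^+ 2 + M2 ^+ 2) / c by field.
  by rewrite -/c mulfK.
- have -> : (P * M1 + g * M2) / c * M2 - (P * M2 - g * M1) / c * M1 =
    g * (M1 ^+ 2 + M2 ^+ 2) / c by field.
  by rewrite -/c mulfK.
Qed.

(* The horizontal rotation is chosen so that the barycentre M is orthogonal to
   the second axis of a plane tilted by the optimal angle; if M is too high for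
   this, a smaller tilt works and is even better. *)
Lemma tilted_frame (M1 M2 M3 cb sb : R) : 0 < cb -> 0 <= sb ->
  cb ^+ 2 + sb ^+ 2 = 1 ->
  exists ce se c' s' P, [/\ ce ^+ 2 + se ^+ 2 = 1, c' ^+ 2 + s' ^+ 2 = 1,
    0 <= P, cb <= c' & [/\ ce * M1 + se * M2 = P,
    c' * (ce * M2 - se * M1) - s' * M3 = 0 & (c' = cb /\ s' = sb) \/ P = 0]].
Proof.
move=> cb0 sb0 csb; set k := M1 ^+ 2 + M2 ^+ 2.
have k0 : 0 <= k by rewrite addr_ge0// sqr_ge0.
have [h|h] := leP ((sb * M3) ^+ 2) (k * cb ^+ 2).
  pose g := sb * M3 / cb.
  have gk : 0 <= k - g ^+ 2.
    by rewrite subr_ge0 /g expr_div_n ler_pdivrMr// exprn_gt0.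
  have [|ce [se [cs cP cg]]] := @rotate_to M1 M2 (Num.sqrt (k - g ^+ 2)) g.
    by rewrite sqr_sqrtr// subrK.
  exists ce, se, cb, sb, (Num.sqrt (k - g ^+ 2)); split=> //.
  split=> //; last by left.
  by rewrite cg /g; field; rewrite gt_eqF.
have M30 : 0 < M3 ^+ 2.
  rewrite exprn_even_gt0//=; apply/eqP => M30; move: h.
  by rewrite M30 mulr0 expr0n /= ltNge mulr_ge0// sqr_ge0.
set q := Num.sqrt (M3 ^+ 2 + k).
have q0 : 0 < q by rewrite sqrtr_gt0; lra.
have q2 : q ^+ 2 = M3 ^+ 2 + k by rewrite sqr_sqrtr//; lra.
have n2 : `|M3| ^+ 2 = M3 ^+ 2 by rewrite real_normK// num_real.
have nM0 : `|M3| != 0 by rewrite -sqrf_eq0 n2 gt_eqF.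
have sk : Num.sqrt k ^+ 2 = k by rewrite sqr_sqrtr.
pose g := Num.sqrt k * M3 / `|M3|.
have [|ce [se [cs cP cg]]] := @rotate_to M1 M2 0 g.
  by rewrite expr0n add0r /g expr_div_n exprMn n2 sk mulfK// gt_eqF.
exists ce, se, (`|M3| / q), (Num.sqrt k / q), 0; split=> //.
- by rewrite !expr_div_n n2 sk -mulrDl -q2 divff// expf_neq0// gt_eqF.
- rewrite ler_pdivlMr//.
  rewrite -(@ler_pXn2r _ 2)// ?nnegrE ?mulr_ge0 ?(ltW cb0) ?(ltW q0)//.
  rewrite exprMn q2 n2; move: h; rewrite exprMn.
  have -> : sb ^+ 2 = 1 - cb ^+ 2 by lra.
  by rewrite mulrDr mulrBl; lra.
split=> //; last by right.
rewrite cg /g; field.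
by rewrite nM0 gt_eqF.
Qed.

(** The relations tying [h] and [r] to [y] are those of the helix at its cut point, with [al] the
    length of its circular part; the curve itself is an arbitrary competitor ending there. *)
Lemma axis_lower_bound T (x1 x2 x3 u1 u2 u3 t12 t23 t31 : R -> R)
    (y al r h cb sb : R) : 0 < T ->
  ac T x1 u1 -> ac T x2 u2 -> ac T x3 u3 ->
  ac T t12 (fun s => 2^-1 * (x1 s * u2 s - x2 s * u1 s)) ->
  ac T t23 (fun s => 2^-1 * (x2 s * u3 s - x3 s * u2 s)) ->
  ac T t31 (fun s => 2^-1 * (x3 s * u1 s - x1 s * u3 s)) ->
  [/\ x1 0 = 0, x2 0 = 0, x3 0 = 0, t12 0 = 0 & t23 0 = 0 /\ t31 0 = 0] ->
  [/\ x1 T = 0, x2 T = 0, x3 T = r, t12 T = h & t23 T = 0 /\ t31 T = 0] ->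
  pi <= y < phi1 -> 0 < al -> 0 < cb -> 0 <= sb -> cb ^+ 2 + sb ^+ 2 = 1 ->
  h * cb = al ^+ 2 * Ufun y -> r * sb = - (al * Sfun y) ->
  mu.-integrable `[0, T] (EFin \o (fun s => Num.sqrt (u1 s ^+ 2 + u2 s ^+ 2 + u3 s ^+ 2))) ->
  Num.sqrt (r ^+ 2 + al ^+ 2 * (1 - Sfun y ^+ 2)) <=
    \int[mu]_(s in `[0, T]) Num.sqrt (u1 s ^+ 2 + u2 s ^+ 2 + u3 s ^+ 2).
Proof.
move=> T0 x1a x2a x3a t12a t23a t31a [x10 x20 x30 t120 [t230 t310]].
move=> [x1T x2T x3T t12T [t23T t31T]] yp al0 cb0 sb0 csb hU rS ni.
have T0' := ltW T0.
set nu := fun s => Num.sqrt (u1 s ^+ 2 + u2 s ^+ 2 + u3 s ^+ 2).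
set Len := \int[mu]_(s in `[0, T]) _.
have Len0 : 0 <= Len by apply: Rint_ge0 => s _; exact: sqrtr_ge0.
apply/ler_addgt0Pr => d' d'0.
(* The slack [d'] keeps the clock speed [rh] positive where the competitor stands still; the clock
   [sg] is then a normalized arclength, up to this slack. *)
pose d := d' / T; have d0 : 0 < d by exact: divr_gt0.
have dT : d * T = d' by rewrite /d divfK// gt_eqF.
pose L := Len + d'.
have L0 : 0 < L by rewrite /L; lra.
pose rh s := L^-1 * (nu s + d).
have rhi : mu.-integrable `[0, T] (EFin \o rh).
  have di : mu.-integrable `[0, T] (EFin \o (fun=> d)).
    by apply: cont_on_integrable; exact: cont_on_cst.
  have h1 : mu.-integrable `[0, T] (EFin \o (fun s => nu s + d)).
    have := integrableD _ ni di; exact.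
  exact: (integrableZl _ _ h1).
have rh0 s : 0 < rh s.
  by rewrite mulr_gt0 ?invr_gt0// ltr_wpDl// sqrtr_ge0.
have rhL s : u1 s ^+ 2 + u2 s ^+ 2 + u3 s ^+ 2 <= L ^+ 2 * rh s ^+ 2.
  rewrite -exprMn /rh mulVKf ?gt_eqF//.
  have n0 : 0 <= nu s by exact: sqrtr_ge0.
  have -> : u1 s ^+ 2 + u2 s ^+ 2 + u3 s ^+ 2 = nu s ^+ 2.
    by rewrite /nu sqr_sqrtr// !addr_ge0// sqr_ge0.
  rewrite ler_pXn2r ?nnegrE//; lra.
have sga := ac_prim rhi; set sg := (fun s => _) in sga.
have sg0 : sg 0 = 0 by rewrite /sg Rint_xx.
have sgT : sg T = 1.
  rewrite /sg /rh RintegralZl//; last first.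
    have di : mu.-integrable `[0, T] (EFin \o (fun=> d)).
      by apply: cont_on_integrable; exact: cont_on_cst.
    have := integrableD _ ni di; exact.
  rewrite RintegralD//; last by apply: cont_on_integrable; exact: cont_on_cst.
  rewrite Rintegral_cst//= lebesgue_measure_itv/= lte_fin T0 /= subr0 dT.
  by rewrite mulVf// gt_eqF.
have mom (x u : R -> R) : ac T x u -> mu.-integrable `[0, T] (EFin \o (fun s => x s * rh s)).
  by move=> xa; apply: cont_integrableM => //; exact: ac_cont xa.
have m1a := ac_prim (mom _ _ x1a); have m2a := ac_prim (mom _ _ x2a).
have z3a := ac_sub_fun x3a (ac_scale r sga).
have m3a := ac_prim (mom _ _ z3a).
set m1 := (fun s => _) in m1a; set m2 := (fun s => _) in m2a.
set m3 := (fun s => _) in m3a.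
have [m10 m20 m30] : [/\ m1 0 = 0, m2 0 = 0 & m3 0 = 0].
  by rewrite /m1 /m2 /m3 !Rint_xx.
have [ce [se [c' [s' [P [cs cs' P0 cc [MP Mq PC]]]]]]] :=
  tilted_frame (m1 T) (m2 T) (m3 T) cb0 sb0 csb.
have bound x : pi <= x < phi1 ->
    4 * x * (h * c' + r * s' * P) + 4 * x ^+ 2 * sin x / vnum x * P ^+ 2 <=
    L ^+ 2 - r ^+ 2.
  move=> xp; have p0 := @pi_gt0 R; have [_ _ _ vp] := @phi1P R.
  apply: cubic_limit => e e0.
  have lc (k1 k2 : R) (f f' g g' : R -> R) (fa : ac T f f') (ga : ac T g g') :=
    ac_add (ac_scale k1 fa) (ac_scale k2 ga).
  have xfa := lc ce se _ _ _ _ x1a x2a.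
  have xga := lc ce (- se) _ _ _ _ x2a x1a.
  have xqa := lc c' (- s') _ _ _ _ xga x3a.
  have y2a := ac_add xqa (ac_scale (r * s') sga).
  have p1a := lc ce se _ _ _ _ m1a m2a.
  have p2a := lc c' (- s') _ _ _ _ (lc ce (- se) _ _ _ _ m2a m1a) m3a.
  (* Removing the chord [r * sg] from the third coordinate changes the projected area by [r * s']
     times the first moment minus a boundary term; at [T] the boundary term vanishes and
     [r * s' * P] is left. This is how the area is expressed by the barycentre. *)
  have Aa := ac_add (ac_add (ac_scale c' t12a)
      (ac_scale s' (lc ce (- se) _ _ _ _ t31a t23a)))
    (ac_scale (r * s') (ac_sub_fun p1a (ac_scale 2^-1 (ac_mul T0' sga xfa)))).
  (* An upper bound for the energy without the chord, equal to [L ^+ 2 - r ^+ 2] at [T]. *)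
  have Ca := ac_add (ac_scale (L ^+ 2 + r ^+ 2) sga) (ac_scale (- 2 * r) x3a).
  have := @planar_cost_bound R T x e sg rh _ _ _ _ _ _ _ _ _ T0' _ e0 _ sga
    (fun s _ => ltW (rh0 s)) sg0 sgT xfa _ _ y2a _ _
    (ac_eq T0' (fun _ _ => erefl) _ p1a) _
    (ac_eq T0' (fun _ _ => erefl) _ p2a) _
    (ac_eq T0' (fun _ _ => erefl) _ Aa) _ Ca _ _.
  rewrite x1T x2T x3T t12T t23T t31T sgT MP.
  have -> : c' * (ce * m2 T + - se * m1 T) + - s' * m3 T = 0.
    by rewrite -[RHS]Mq; ring.
  have -> : 4 * x * (h * c' + r * s' * P) * (1 + e) ^+ 2 +
    4 * x ^+ 2 * sin x / vnum x * P ^+ 2 = 4 * x * (1 + e) ^+ 2 *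
    (c' * h + s' * (ce * 0 + - se * 0) + r * s' * (P - 2^-1 * (1 * (ce * 0 + se * 0))))
    + 4 * x ^+ 2 * sin x / vnum x * (P ^+ 2 + 0 ^+ 2) by ring.
  have -> : L ^+ 2 - r ^+ 2 = (L ^+ 2 + r ^+ 2) * 1 + -2 * r * r by ring.
  apply.
  - lra.
  - by move=> z zx; apply: vp; lra.
  - by rewrite x10 x20; ring.
  - by ring.
  - by rewrite x10 x20 x30 sg0; ring.
  - by ring.
  - by move=> s _; ring.
  - by rewrite m10 m20; ring.
  - by move=> s _; ring.
  - by rewrite m10 m20 m30; ring.
  - move=> s _.
    have -> : x1 s * u2 s - x2 s * u1 s = (ce ^+ 2 + se ^+ 2) * (x1 s * u2 s - x2 s * u1 s).
      by rewrite cs mul1r.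
    by field.
  - by rewrite t120 t230 t310 m10 m20 sg0; ring.
  - by rewrite sg0 x30; ring.
  (* The cost inequality is a sum of squares over the three rotated components; the component normal
     to the plane of projection only adds to the cost. *)
  move=> s _ w1 w2.
  pose g := ce * u2 s - se * u1 s.
  pose uf := ce * u1 s + se * u2 s.
  pose uq := c' * g - s' * u3 s; pose un := s' * g + c' * u3 s.
  have n2 : uf ^+ 2 + uq ^+ 2 + un ^+ 2 = u1 s ^+ 2 + u2 s ^+ 2 + u3 s ^+ 2.
    transitivity (uf ^+ 2 + (c' ^+ 2 + s' ^+ 2) * (g ^+ 2 + u3 s ^+ 2)).
      by rewrite /uq /un; ring.
    rewrite cs' mul1r.
    transitivity ((ce ^+ 2 + se ^+ 2) * (u1 s ^+ 2 + u2 s ^+ 2) + u3 s ^+ 2).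
      by rewrite /uf /g; ring.
    by rewrite cs mul1r.
  have u3E : u3 s = c' * un - s' * uq.
    transitivity ((c' ^+ 2 + s' ^+ 2) * u3 s); first by rewrite cs' mul1r.
    by rewrite /un /uq; ring.
  have uqE : c' * (ce * u2 s + - se * u1 s) + - s' * u3 s = uq.
    by rewrite /uq /g; ring.
  rewrite uqE -/uf u3E.
  have := rhL s; rewrite -n2; clearbody uf uq un; move=> Lu.
  rewrite -subr_ge0 -(pmulr_rge0 _ (rh0 s)).
  have -> : r ^+ 2 = (c' ^+ 2 + s' ^+ 2) * r ^+ 2 by rewrite cs' mul1r.
  have -> : rh s * ((L ^+ 2 + (c' ^+ 2 + s' ^+ 2) * r ^+ 2) * rh s + -2 * r * (c' * un - s' * uq)
    - (2 * (uf * w1 + (uq + r * s' * rh s) * w2) - (w1 ^+ 2 + w2 ^+ 2) * rh s)) =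
    (L ^+ 2 * rh s ^+ 2 - (uf ^+ 2 + uq ^+ 2 + un ^+ 2)) +
    ((uf - rh s * w1) ^+ 2 + (uq - rh s * (w2 - r * s')) ^+ 2 +
     (un - rh s * (r * c')) ^+ 2) by ring.
  by rewrite addr_ge0 ?subr_ge0// !addr_ge0// sqr_ge0.
have U0 : 0 < Ufun y by apply: Ufun_gt0; lra.
have h0 : 0 < h by rewrite -(pmulr_lgt0 _ cb0) hU mulr_gt0// exprn_gt0.
have bound2 x : pi <= x < phi1 ->
    4 * x * (Ufun y - Sfun y * (P / al)) + 2 * x * Sfun x / Vfun x * (P / al) ^+ 2
    <= (L ^+ 2 - r ^+ 2) / al ^+ 2.
  move=> xp; have p0 := @pi_gt0 R; have [_ _ _ vp] := @phi1P R.
  rewrite ler_pdivlMr ?exprn_gt0//; apply: le_trans (bound x xp).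
  have x0 : x != 0 by rewrite gt_eqF//; lra.
  have v0 : vnum x != 0 by rewrite gt_eqF//; apply: vp; lra.
  have -> : (4 * x * (Ufun y - Sfun y * (P / al)) +
      2 * x * Sfun x / Vfun x * (P / al) ^+ 2) * al ^+ 2 =
    4 * x * (al ^+ 2 * Ufun y + - (al * Sfun y) * P) +
    4 * x ^+ 2 * sin x / vnum x * P ^+ 2.
    have a0 : al != 0 by rewrite gt_eqF.
    have y0 : y != 0 by rewrite gt_eqF//; lra.
    by rewrite Vfun_vnum /Sfun; field; rewrite ?v0 ?x0 ?a0 ?y0.
  rewrite -hU -rS lerD2r ler_pM2l; last lra.
  (* Either the tilt is that of the helix, or [P = 0] and the smaller tilt enlarges the projected
     area, since [h > 0]. *)
  case: PC => [[-> ->]//|->]; rewrite !mulr0 !addr0.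
  by rewrite ler_pM2l.
have := planar_optimum yp (divr_ge0 P0 (ltW al0)) bound2.
rewrite ler_pdivlMr ?exprn_gt0// => fin.
rewrite -/L -(ger0_norm (ltW L0)) -sqrtr_sqr ler_wsqrtr//.
by move: fin; clear; lra.
Qed.

End axis_bound.

(** * Coordinates in V and in its exterior square *)

Section euclidean_frame.
Context {R : realType} {V : vectType R} (dot : {dot V for idfun}).
Implicit Types (x y e : V).

Lemma dotC x y : dot x y = dot y x.
Proof. by rewrite hermC expr0 mul1r. Qed.

Lemma dotDl x y e : dot (x + y) e = dot x e + dot y e.
Proof. exact: linearDl. Qed.

Lemma dotZl k x e : dot (k *: x) e = k * dot x e.
Proof. exact: linearZl_LR. Qed.

Lemma dotDr e x y : dot e (x + y) = dot e x + dot e y.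
Proof. by rewrite !(dotC e) dotDl. Qed.

Lemma dotZr k e x : dot e (k *: x) = k * dot e x.
Proof. by rewrite !(dotC e) dotZl. Qed.

Lemma dot0l e : dot 0 e = 0.
Proof. by rewrite -(scale0r 0) dotZl mul0r. Qed.

Lemma dotNl x e : dot (- x) e = - dot x e.
Proof. by rewrite -scaleN1r dotZl mulN1r. Qed.

Lemma dot_gt0 x : x != 0 -> 0 < dot x x.
Proof. exact: neq0_dnorm_gt0. Qed.

Lemma dot_ge0 x : 0 <= dot x x.
Proof.
have [->|x0] := eqVneq x 0; first by rewrite dot0l.
exact/ltW/dot_gt0.
Qed.

Definition orthonormal3 e1 e2 e3 :=
  [/\ dot e1 e1 = 1, dot e2 e2 = 1, dot e3 e3 = 1 &
  [/\ dot e1 e2 = 0, dot e1 e3 = 0 & dot e2 e3 = 0]].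

(** A nonzero remainder would be a fourth vector independent of the frame. *)
Lemma orthonormal3_expand e1 e2 e3 x : \dim {:V} = 3%N ->
  orthonormal3 e1 e2 e3 ->
  x = dot x e1 *: e1 + dot x e2 *: e2 + dot x e3 *: e3.
Proof.
move=> dV [h1 h2 h3 [h12 h13 h23]].
set y := dot x e1 *: e1 + dot x e2 *: e2 + dot x e3 *: e3.
apply/eqP; rewrite -subr_eq0; apply: contraT => z0.
set z := x - y in z0.
have [z1 z2 z3] : [/\ dot z e1 = 0, dot z e2 = 0 & dot z e3 = 0].
  rewrite /z /y !dotDl !dotNl !dotDl !dotZl h1 h2 h3 (dotC e2 e1) (dotC e3 e1).
  by rewrite (dotC e3 e2) h12 h13 h23; split; ring.
have zz := dot_gt0 z0.
have : free [tuple z; e1; e2; e3].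
  apply/freeP => k; rewrite !big_ord_recl big_ord0 /= addr0 => S0.
  have D e : dot (k ord0 *: z + (k (lift ord0 ord0) *: e1 +
     (k (lift ord0 (lift ord0 ord0)) *: e2 +
      k (lift ord0 (lift ord0 (lift ord0 ord0))) *: e3))) e = 0.
    by rewrite S0 dot0l.
  have := D z; rewrite !dotDl !dotZl !(dotC _ z) z1 z2 z3 !mulr0 !addr0 => /eqP.
  rewrite mulf_eq0 (gt_eqF zz) orbF => /eqP k0.
  have := D e1; rewrite !dotDl !dotZl z1 h1 (dotC e2 e1) (dotC e3 e1) h12 h13.
  rewrite !mulr0 !addr0 add0r mulr1 => k1.
  have := D e2; rewrite !dotDl !dotZl z2 h2 h12 (dotC e3 e2) h23.
  rewrite !mulr0 !addr0 !add0r mulr1 => k2.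
  have := D e3; rewrite !dotDl !dotZl z3 h3 h13 h23.
  rewrite !mulr0 !add0r mulr1 => k3 i.
  case: i => [] [|[|[|[|//]]]] lti.
  - by rewrite -[RHS]k0; congr k; apply: val_inj.
  - by rewrite -[RHS]k1; congr k; apply: val_inj.
  - by rewrite -[RHS]k2; congr k; apply: val_inj.
  - by rewrite -[RHS]k3; congr k; apply: val_inj.
rewrite /free => /eqP dX.
have := dimvS (subvf <<[tuple z; e1; e2; e3]>>).
by rewrite dX dV.
Qed.

Lemma orthonormal3_complete e1 e2 : \dim {:V} = 3%N ->
  dot e1 e1 = 1 -> dot e2 e2 = 1 -> dot e1 e2 = 0 ->
  exists e3, orthonormal3 e1 e2 e3.
Proof.
move=> dV h1 h2 h12.
suff [n [n0 n1 n2]] : exists n, [/\ n != 0, dot e1 n = 0 & dot e2 n = 0].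
  have nn := dot_gt0 n0.
  have q0 : Num.sqrt (dot n n) != 0 by rewrite gt_eqF// sqrtr_gt0.
  exists ((Num.sqrt (dot n n))^-1 *: n); split=> //; last first.
    by split=> //; rewrite dotZr ?n1 ?n2 mulr0.
  rewrite dotZr dotZl -[X in _ * (_ * X)](sqr_sqrtr (ltW nn)).
  by field.
apply: contrapT => H.
have : (fullv <= <<[:: e1; e2]>>)%VS.
  apply/subvP => x _.
  have -> : x = dot x e1 *: e1 + dot x e2 *: e2.
    apply/eqP; rewrite -subr_eq0; apply: contraT => z0; exfalso.
    apply: H; exists (x - (dot x e1 *: e1 + dot x e2 *: e2)); split=> //.
      by rewrite dotC !dotDl !dotNl !dotDl !dotZl h1 (dotC e2 e1) h12; ring.
    by rewrite dotC !dotDl !dotNl !dotDl !dotZl h2 h12; ring.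
  by apply: rpredD; apply: rpredZ; apply: memv_span; rewrite !inE eqxx ?orbT.
move=> /dimvS; rewrite dV => h.
by have := leq_trans h (dim_span _).
Qed.

Definition dot_form e x : R := dot x e.

Lemma dot_form_is_scalar e : scalar (dot_form e).
Proof. by move=> k x y; rewrite /dot_form dotDl dotZl. Qed.

HB.instance Definition _ e :=
  GRing.isLinear.Build R V R *%R (dot_form e) (dot_form_is_scalar e).

Definition minor e e' x y : R^o := dot x e * dot y e' - dot x e' * dot y e.

Lemma minor_is_bilinear e e' : bilinear_for
  ( *:%R : R -> R^o -> R^o) ( *:%R : R -> R^o -> R^o) (minor e e').
Proof.
have l u k x y : minor e e' (k *: x + y) u =
    k * minor e e' x u + minor e e' y u :> R.
  by rewrite /minor !dotDl !dotZl; ring.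
have r u k x y : minor e e' u (k *: x + y) =
    k * minor e e' u x + minor e e' u y :> R.
  by rewrite /minor !dotDl !dotZl; ring.
by split=> u k x y; [exact: l|exact: r].
Qed.

HB.instance Definition _ e e' := bilinear_isBilinear.Build R V V R^o
  *:%R *:%R (minor e e') (minor_is_bilinear e e').

End euclidean_frame.

(** * Coordinates in the exterior square *)

Section exterior_coordinates.
Context {R : realType} {V : vectType R} {W : lmodType R}.
Variables (dot : {dot V for idfun}) (wedge : {bilinear V -> V -> W}).
Hypothesis dimV : \dim {:V} = 3%N.
Hypothesis wedgeP : exterior_square wedge.

(** The universal property turns the alternating form [minor] into a linear form on [W], a Pluecker
    coordinate. *)
Lemma wedge_coord (e e' : V) :
  exists g : {scalar W}, forall x y, g (wedge x y) = minor dot e e' x y.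
Proof.
have alt (x : V) : minor dot e e' x x = 0 by rewrite /minor; ring.
have [g gE _] := wedgeP.2 R^o (minor dot e e') alt.
have gs : scalar (g : W -> R) by move=> k x y; exact: linearP.
pose g' := HB.pack_for {scalar W} (g : W -> R) (GRing.isLinear.Build R W R *%R _ gs).
by exists g' => x y; exact: gE.
Qed.

Lemma wedge_anti x y : wedge x y = - wedge y x.
Proof.
apply/eqP; rewrite -addr_eq0; apply/eqP.
have := wedgeP.1 (x + y).
by rewrite linearDl !linearDr !wedgeP.1 add0r addr0.
Qed.

Lemma wedge_expand (e1 e2 e3 : V) x y : orthonormal3 dot e1 e2 e3 ->
  wedge x y = minor dot e1 e2 x y *: wedge e1 e2 +
    minor dot e2 e3 x y *: wedge e2 e3 + minor dot e3 e1 x y *: wedge e3 e1.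
Proof.
move=> on.
rewrite [in LHS](orthonormal3_expand x dimV on) [in LHS](orthonormal3_expand y dimV on).
rewrite /minor.
move: (dot x e1) (dot x e2) (dot x e3) (dot y e1) (dot y e2) (dot y e3).
move=> x1 x2 x3 y1 y2 y3.
have Dl := @linearDl _ _ _ _ _ _ wedge; have Dr := @linearDr _ _ _ _ _ _ wedge.
have Zl k u v : wedge (k *: u) v = k *: wedge u v by exact: linearZl_LR.
have Zr k u v : wedge u (k *: v) = k *: wedge u v by exact: linearZr_LR.
rewrite !Dl !Dr !Zl !Zr !wedgeP.1 !scaler0 addr0 add0r.
rewrite (wedge_anti e2 e1) (wedge_anti e3 e2) (wedge_anti e1 e3) !scalerN !scalerA.
by rewrite addr0 !scalerBl [LHS](AC (2*2*2) ((1*3)*(4*6)*(5*2))).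
Qed.

(** As a function of [w], the right side agrees with the identity on all products [wedge x y];
    uniqueness in the universal property makes it the identity of [W]. *)
Lemma exterior_expand (e1 e2 e3 : V) (g12 g23 g31 : {scalar W}) w :
  orthonormal3 dot e1 e2 e3 ->
  (forall x y, g12 (wedge x y) = minor dot e1 e2 x y) ->
  (forall x y, g23 (wedge x y) = minor dot e2 e3 x y) ->
  (forall x y, g31 (wedge x y) = minor dot e3 e1 x y) ->
  w = g12 w *: wedge e1 e2 + g23 w *: wedge e2 e3 + g31 w *: wedge e3 e1.
Proof.
move=> on h12 h23 h31.
pose k w := g12 w *: wedge e1 e2 + g23 w *: wedge e2 e3 + g31 w *: wedge e3 e1.
have kl : linear k.
  move=> c u v; rewrite /k !linearP /= !scalerDl !scalerDr !scalerA.
  by rewrite [LHS](AC (2*2*2) (1*3*5*(2*4*6))).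
pose k' := HB.pack_for {linear W -> W} k (GRing.isLinear.Build R W W *:%R _ kl).
have [g _ gu] := wedgeP.2 W wedge wedgeP.1.
have ik := gu (idfun : {linear W -> W}) (fun _ _ => erefl) w.
have kk : k' w = g w.
  by apply: gu => x y /=; rewrite /k h12 h23 h31 -wedge_expand.
by rewrite -[LHS]/(idfun w) ik -kk.
Qed.

End exterior_coordinates.

(** * Explicit form of the helix *)

Section helix.
Context {R : realType}.
Notation mu := (@lebesgue_measure R).
Variables (w th al ze cb sb : R).
Implicit Types s : R.

(** Coordinates of the control in a frame whose third vector spans the rotation axis. [cb] and [sb]
    give the tilt of the circle's plane; the phase [th] centres the arc, whose angle runs from
    [- th] to [th] up to the cut, so that its chord lies along the first direction of that plane. *)
Definition hu1 s := cb * (al * cos (w * s - th)) + sb * ze.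
Definition hu2 s := al * sin (w * s - th).
Definition hu3 s := - sb * (al * cos (w * s - th)) + cb * ze.
Definition hx1 s := cb * (al / w * (sin (w * s - th) + sin th)) + sb * (ze * s).
Definition hx2 s := al / w * (cos th - cos (w * s - th)).
Definition hx3 s := - sb * (al / w * (sin (w * s - th) + sin th)) + cb * (ze * s).
(** With [hbn] and [hna], the components of t before tilting. The unsimplified [w * s - th + th]
    becomes [th + th] when [w * s - th] is replaced by [th] at the cut. *)
Definition hab s := al ^+ 2 / (2 * w) * (s - sin (w * s - th + th) / w).
Definition hbn s := al * ze / 2 * (s * (cos th + cos (w * s - th)) / w
  - 2 / w ^+ 2 * (sin (w * s - th) + sin th)).
Definition hna s := al * ze / 2 * (s * (sin (w * s - th) - sin th) / w
  + 2 / w ^+ 2 * (cos (w * s - th) - cos th)).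
Definition ht12 s := cb * hab s - sb * hbn s.
Definition ht23 s := sb * hab s + cb * hbn s.
Definition ht31 s := hna s.

Hypothesis w0 : w != 0.

Lemma is_derive_sin_aff c d s :
  is_derive s (1 : R) (fun t => sin (c * t - d)) (c * cos (c * s - d)).
Proof.
have d1 : is_derive s (1 : R) (fun t => c * t - d) c.
  by apply: is_derive_eq; rewrite /GRing.scale /=; ring.
apply: (is_derive_eq (@is_derive1_comp R sin (fun t => c * t - d) s _ _ (is_derive_sin _) d1)).
by ring.
Qed.

Lemma is_derive_cos_aff c d s :
  is_derive s (1 : R) (fun t => cos (c * t - d)) (- c * sin (c * s - d)).
Proof.
have d1 : is_derive s (1 : R) (fun t => c * t - d) c.
  by apply: is_derive_eq; rewrite /GRing.scale /=; ring.
apply: (is_derive_eq (@is_derive1_comp R cos (fun t => c * t - d) s _ _ (is_derive_cos _) d1)).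
by ring.
Qed.

Lemma is_derive_hx1 s : is_derive s (1 : R) hx1 (hu1 s).
Proof.
have ds := is_derive_sin_aff w th s.
by apply: is_derive_eq; rewrite /GRing.scale /= /hu1; field.
Qed.

Lemma is_derive_hx2 s : is_derive s (1 : R) hx2 (hu2 s).
Proof.
have dc := is_derive_cos_aff w th s.
by apply: is_derive_eq; rewrite /GRing.scale /= /hu2; field.
Qed.

Lemma is_derive_hx3 s : is_derive s (1 : R) hx3 (hu3 s).
Proof.
have ds := is_derive_sin_aff w th s.
by apply: is_derive_eq; rewrite /GRing.scale /= /hu3; field.
Qed.

(** [cos ^+ 2 + sin ^+ 2] and the expanded cosine of a sum are left as they are, so that the
    derivatives of [ht12] and [ht23] become rational identities in sines and cosines. *)
Lemma is_derive_hab s : is_derive s (1 : R) hab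
  (al ^+ 2 / (2 * w) * (cos (w * s - th) ^+ 2 + sin (w * s - th) ^+ 2 -
     (cos (w * s - th) * cos th - sin (w * s - th) * sin th))).
Proof.
have ds : is_derive s (1 : R) (fun t => sin (w * t - th + th)) (w * cos (w * s - th + th)).
  have -> : (fun t => sin (w * t - th + th)) = (fun t => sin (w * t - 0)).
    by apply/funext => t; congr sin; ring.
  have -> : w * s - th + th = w * s - 0 by ring.
  exact: is_derive_sin_aff.
apply: is_derive_eq; rewrite /GRing.scale /= cos2Dsin2 -cosD; field.
by [].
Qed.

Lemma is_derive_hbn s : is_derive s (1 : R) hbn
  (al * ze / 2 * ((cos th - cos (w * s - th)) / w - s * sin (w * s - th))).
Proof.
have ds := is_derive_sin_aff w th s; have dc := is_derive_cos_aff w th s.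
by apply: is_derive_eq; rewrite /GRing.scale /=; field.
Qed.

Lemma is_derive_hna s : is_derive s (1 : R) hna
  (al * ze / 2 * (s * cos (w * s - th) - (sin (w * s - th) + sin th) / w)).
Proof.
have ds := is_derive_sin_aff w th s; have dc := is_derive_cos_aff w th s.
by apply: is_derive_eq; rewrite /GRing.scale /=; field.
Qed.

Lemma is_derive_ht12 s : is_derive s (1 : R) ht12 (2^-1 * (hx1 s * hu2 s - hx2 s * hu1 s)).
Proof.
have d1 := is_derive_hab s; have d2 := is_derive_hbn s.
by apply: is_derive_eq; rewrite /GRing.scale /= /hx1 /hx2 /hu1 /hu2; field.
Qed.

Lemma is_derive_ht23 s : is_derive s (1 : R) ht23 (2^-1 * (hx2 s * hu3 s - hx3 s * hu2 s)).
Proof.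
have d1 := is_derive_hab s; have d2 := is_derive_hbn s.
by apply: is_derive_eq; rewrite /GRing.scale /= /hx2 /hx3 /hu2 /hu3; field.
Qed.

Hypothesis csb : cb ^+ 2 + sb ^+ 2 = 1.

Lemma is_derive_ht31 s : is_derive s (1 : R) ht31 (2^-1 * (hx3 s * hu1 s - hx1 s * hu3 s)).
Proof.
have d1 := is_derive_hna s.
apply: is_derive_eq.
transitivity ((cb ^+ 2 + sb ^+ 2) *
  (al * ze / 2 * (s * cos (w * s - th) - (sin (w * s - th) + sin th) / w))).
  by rewrite csb mul1r.
by rewrite /hx1 /hx3 /hu1 /hu3; field.
Qed.

Lemma helix0 : [/\ hx1 0 = 0, hx2 0 = 0, hx3 0 = 0, ht12 0 = 0 &
  ht23 0 = 0 /\ ht31 0 = 0].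
Proof.
have wt : w * 0 - th = - th by ring.
rewrite /ht12 /ht23 /ht31 /hx1 /hx2 /hx3 /hab /hbn /hna wt !sinN !cosN !addNr ?sin0.
by split=> //; try split; field.
Qed.

Lemma hu_continuous : [/\ continuous hu1, continuous hu2 & continuous hu3].
Proof.
have cs c d : continuous (fun t : R => sin (c * t - d)).
  move=> x; apply/differentiable_continuous/derivable1_diffP.
  by have [] := is_derive_sin_aff c d x.
have cc c d : continuous (fun t : R => cos (c * t - d)).
  move=> x; apply/differentiable_continuous/derivable1_diffP.
  by have [] := is_derive_cos_aff c d x.
split=> x.
- apply: cvgD; last exact: cvg_cst.
  by apply: cvgM; [exact: cvg_cst|apply: cvgM; [exact: cvg_cst|exact: cc]].
- by apply: cvgM; [exact: cvg_cst|exact: cs].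
- apply: cvgD; last exact: cvg_cst.
  by apply: cvgM; [exact: cvg_cst|apply: cvgM; [exact: cvg_cst|exact: cc]].
Qed.

Lemma hu_norm s : hu1 s ^+ 2 + hu2 s ^+ 2 + hu3 s ^+ 2 = al ^+ 2 + ze ^+ 2.
Proof.
transitivity ((cb ^+ 2 + sb ^+ 2) * (al ^+ 2 * cos (w * s - th) ^+ 2 + ze ^+ 2) +
   al ^+ 2 * sin (w * s - th) ^+ 2); first by rewrite /hu1 /hu2 /hu3; ring.
rewrite csb mul1r -[in RHS](mulr1 (al ^+ 2)) -(cos2Dsin2 (w * s - th)); ring.
Qed.

(** [hx2] and [ht31] vanish by the symmetry of the arc, for every tilt, while [hx1] and [ht23] are
    multiples of the two balanced expressions in [cb] and [sb]. The last three equations feed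
    [axis_lower_bound]. *)
Lemma helix_cut t : th != 0 -> w * t = 2 * th ->
  al * Sfun th * cb + ze * sb = 0 -> al * Ufun th * sb = ze * Vfun th * cb ->
  [/\ hx1 t = 0, hx2 t = 0, ht23 t = 0, ht31 t = 0 &
  [/\ ht12 t * cb = (t * al) ^+ 2 * Ufun th,
      hx3 t * sb = - (t * al * Sfun th) &
      hx3 t ^+ 2 + (t * al) ^+ 2 * (1 - Sfun th ^+ 2) =
      t ^+ 2 * (al ^+ 2 + ze ^+ 2)]].
Proof.
move=> th0 wt E1 E2.
have tE : t = 2 * th / w by rewrite -wt; field.
have wt' : w * t - th = th by rewrite wt; ring.
have x1E : hx1 t = t * (al * Sfun th * cb + ze * sb).
  by rewrite /hx1 wt' /Sfun tE; field; rewrite ?w0 ?th0.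
have x3E : hx3 t = t * (ze * cb - al * Sfun th * sb).
  by rewrite /hx3 wt' /Sfun tE; field; rewrite ?w0 ?th0.
have abE : hab t = t ^+ 2 * al ^+ 2 * Ufun th.
  by rewrite /hab wt' sinD /Ufun tE; field; rewrite ?w0 ?th0.
have bnE : hbn t = - (t ^+ 2 * al * ze * Vfun th).
  by rewrite /hbn wt' /Vfun tE; field; rewrite ?w0 ?th0.
split.
- by rewrite x1E E1 mulr0.
- by rewrite /hx2 wt' subrr mulr0.
- rewrite /ht23 abE bnE.
  transitivity (t ^+ 2 * al * (al * Ufun th * sb - ze * Vfun th * cb)); first by ring.
  by rewrite E2 subrr mulr0.
- by rewrite /ht31 /hna wt' !subrr; ring.
split.
- rewrite /ht12 abE bnE.
  transitivity (t ^+ 2 * al * (al * Ufun th * cb ^+ 2 + sb * (ze * Vfun th * cb))).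
    by ring.
  rewrite -E2.
  transitivity (t ^+ 2 * al * (al * Ufun th * (cb ^+ 2 + sb ^+ 2))); first by ring.
  by rewrite csb; ring.
- rewrite x3E.
  transitivity (t * ((al * Sfun th * cb + ze * sb) * cb - al * Sfun th * (cb ^+ 2 + sb ^+ 2))).
    by ring.
  by rewrite csb E1; ring.
rewrite x3E.
transitivity (t ^+ 2 * ((cb ^+ 2 + sb ^+ 2) * (al ^+ 2 * Sfun th ^+ 2 + ze ^+ 2)
  - (al * Sfun th * cb + ze * sb) ^+ 2 + al ^+ 2 * (1 - Sfun th ^+ 2))); first by ring.
by rewrite csb E1; ring.
Qed.

End helix.

(** * Corners are not minimizing *)

Section corner.
Context {R : realType}.
Notation mu := (@lebesgue_measure R).
Implicit Types (T c s : R) (f g h e : R -> R).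

(** A class stable under sums and products, on which all pairings [ip] are integrals of integrable
    functions. *)
Definition bounded_measurable T f := measurable_fun `[0, T] f /\
  exists M, forall s, 0 <= s <= T -> `|f s| <= M.

Lemma bmD T f g : bounded_measurable T f -> bounded_measurable T g ->
  bounded_measurable T (fun s => f s + g s).
Proof.
move=> [fm [M fM]] [gm [N gN]]; split; first exact: measurable_funD.
exists (M + N) => s sT; apply: (le_trans (ler_normD _ _)).
by rewrite lerD ?fM ?gN.
Qed.

Lemma bmM T f g : bounded_measurable T f -> bounded_measurable T g ->
  bounded_measurable T (fun s => f s * g s).
Proof.
move=> [fm [M fM]] [gm [N gN]]; split; first exact: measurable_funM.
by exists (M * N) => s sT; rewrite normrM ler_pM ?fM ?gN.
Qed.

Lemma bm_cont T f : cont_on 0 T f -> bounded_measurable T f.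
Proof.
move=> cf; split; first exact: cont_on_measurable.
have [M [Mr MP]] := cont_on_bounded cf; exists (M + 1) => s sT.
by apply: (MP (M + 1)); [rewrite ltrDl|rewrite /= in_itv].
Qed.

Lemma bm_cst T c : bounded_measurable T (fun=> c).
Proof. by apply: bm_cont; exact: cont_on_cst. Qed.

Lemma bmZ T c f : bounded_measurable T f -> bounded_measurable T (fun s => c * f s).
Proof. by apply: bmM; exact: bm_cst. Qed.

Lemma bmB T f g : bounded_measurable T f -> bounded_measurable T g ->
  bounded_measurable T (fun s => f s - g s).
Proof.
move=> fb gb; have := bmD fb (bmZ (-1) gb).
by congr bounded_measurable; apply/funext => s; rewrite mulN1r.
Qed.

Lemma bm_paste T t f g : continuous f -> continuous g ->
  bounded_measurable T (fun s => if s <= t then f s else g s).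
Proof.
move=> cf cg.
have [_ [M fM]] := bm_cont (@continuous_cont_on _ 0 T _ cf).
have [_ [N gN]] := bm_cont (@continuous_cont_on _ 0 T _ cg).
split; last first.
  exists (`|M| + `|N|) => s sT; case: ifP => _.
    by apply: (le_trans (fM s sT)); apply: (le_trans (ler_norm M)); rewrite lerDl.
  by apply: (le_trans (gN s sT)); apply: (le_trans (ler_norm N)); rewrite lerDr.
apply: measurable_funS (@measurableT _ _) (@subsetT _ _) _.
apply: measurable_fun_ifT; first exact: measurable_fun_ler.
  exact: continuous_measurable_fun.
exact: continuous_measurable_fun.
Qed.

Lemma bm_integrable T f : bounded_measurable T f -> mu.-integrable `[0, T] (EFin \o f).
Proof.
move=> [fm [M fM]]; apply: measurable_bounded_integrable => //.
  by apply: compact_finite_measure; exact: segment_compact.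
exists M; split; first exact: num_real.
by move=> y My s /=; rewrite in_itv /= => sT; apply/ltW/(le_lt_trans _ My)/fM.
Qed.

Lemma bm_L2 T f : bounded_measurable T f -> L2 T f.
Proof. by move=> [fm [M fM]]; exact: bounded_L2 fM. Qed.

Definition ip T f g : R := \int[mu]_(s in `[0, T]) (f s * g s).

Lemma ipBZ T c f g h : bounded_measurable T f -> bounded_measurable T g ->
  bounded_measurable T h -> ip T (fun s => f s - c * g s) h = ip T f h - c * ip T g h.
Proof.
move=> fb gb hb; rewrite /ip.
have i1 := bm_integrable (bmM fb hb); have i2 := bm_integrable (bmM gb hb).
rewrite -RintegralZl// -RintegralB//; first by apply: Rint_eq => s _; ring.
exact: (integrableZl _ _ i2).
Qed.

Lemma ipC T f g : ip T f g = ip T g f.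
Proof. by apply: Rint_eq => s _; rewrite mulrC. Qed.

Lemma ip_ge0 T f : 0 <= ip T f f.
Proof. by apply: Rint_ge0 => s _; rewrite -expr2 sqr_ge0. Qed.

(** When [e] has norm 0, Cauchy-Schwarz gives [ip T g e = 0] and any coefficient works. *)
Lemma ip_residual T e g : bounded_measurable T e -> bounded_measurable T g ->
  exists c, ip T (fun s => g s - c * e s) e = 0.
Proof.
move=> eb gb; have [e0|e0] := eqVneq (ip T e e) 0; last first.
  by exists (ip T g e / ip T e e); rewrite ipBZ// divfK// subrr.
exists 0; rewrite ipBZ// mul0r subr0; apply/eqP; apply: contraT => ge.
(* With this [t] the squared norm of [g - t * e] would be -1. *)
pose t := (ip T g g + 1) / (2 * ip T g e).
have rb : bounded_measurable T (fun s => g s - t * e s) by apply: bmB => //; exact: bmZ.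
have := ip_ge0 T (fun s => g s - t * e s).
rewrite ipBZ// (ipC _ g) (ipC _ e) !ipBZ// e0 mulr0 subr0 (ipC _ e g).
have -> : ip T g g - t * ip T g e - t * ip T g e = -1 by rewrite /t; field.
by rewrite oppr_ge0 ler10.
Qed.

(** Gram-Schmidt, valid also for dependent functions. *)
Lemma ip_projection3 T e1 e2 e3 h : bounded_measurable T e1 ->
  bounded_measurable T e2 -> bounded_measurable T e3 -> bounded_measurable T h ->
  exists k1 k2 k3, let f s := h s - (k1 * e1 s + k2 * e2 s + k3 * e3 s) in
    [/\ ip T f e1 = 0, ip T f e2 = 0 & ip T f e3 = 0].
Proof.
move=> b1 b2 b3 bh.
have bs c f g : bounded_measurable T f -> bounded_measurable T g ->
    bounded_measurable T (fun s => f s - c * g s).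
  by move=> fb gb; apply: bmB => //; exact: bmZ.
have [c cE] := ip_residual b1 b2; set e2' := fun s => _ in cE.
have b2' : bounded_measurable T e2' by exact: bs.
have proj2 g : bounded_measurable T g -> exists p q,
    bounded_measurable T (fun s => g s - p * e1 s - q * e2' s) /\
    ip T (fun s => g s - p * e1 s - q * e2' s) e1 = 0 /\
    ip T (fun s => g s - p * e1 s - q * e2' s) e2' = 0.
  move=> gb; have [p pE] := ip_residual b1 gb.
  have pb := bs p _ _ gb b1.
  have [q qE] := ip_residual b2' pb.
  exists p, q; split; first exact: bs.
  by split=> //; rewrite ipBZ// pE cE mulr0 subr0.
have [p [q [b3' [E31 E32]]]] := proj2 _ b3; set e3' := fun s => _ in b3' E31 E32.
have [u [v [bh' [h1 h2]]]] := proj2 _ bh; set h' := fun s => _ in bh' h1 h2.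
have [d dE] := ip_residual b3' bh'.
exists (u - v * c - d * (p - q * c)), (v - d * q), d => f.
have fE : f = fun s => h' s - d * e3' s.
  by apply/funext => s; rewrite /f /h' /e3' /e2'; ring.
have fb : bounded_measurable T f by rewrite fE; exact: bs.
have f1 : ip T f e1 = 0 by rewrite fE ipBZ// h1 E31 mulr0 subr0.
have f2 : ip T f e2' = 0 by rewrite fE ipBZ// h2 E32 mulr0 subr0.
have f3 : ip T f e3' = 0 by rewrite fE.
have f2' : ip T f e2 = 0.
  move: f2; rewrite ipC ipBZ// !(ipC _ _ f) f1; lra.
split=> //.
have pb := bs p _ _ b3 b1.
move: f3; rewrite ipC (ipBZ q pb b2' fb) (ipBZ p b3 b1 fb) !(ipC _ _ f) f1 f2.
by lra.
Qed.

End corner.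

(** * Shortening a curve with a corner *)

Section corner_cutting.
Context {R : realType}.
Notation mu := (@lebesgue_measure R).
Implicit Types (T t c s : R).

Lemma continuous_eq0_left t (f : R -> R) : 0 < t -> {for t, continuous f} ->
  (forall s, 0 < s < t -> f s = 0) -> f t = 0.
Proof.
move=> t0 fc f0; apply/eqP; rewrite -normr_le0; apply/ler_addgt0Pr => e e0.
have [d d0 dP] := cont_at fc e0.
have m0 : 0 < Num.min d t by rewrite lt_min d0.
have md : Num.min d t <= d by rewrite ge_min lexx.
have mt : Num.min d t <= t by rewrite ge_min lexx orbT.
move: (Num.min d t) m0 md mt => m m0 md mt.
have := dP (t - m / 2); rewrite f0; last lra.
rewrite sub0r normrN add0r distrC ger0_norm; last lra.
by move=> /(_ ltac:(lra)) /ltW.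
Qed.

Lemma continuous_eq0_right t T (f : R -> R) : t < T -> {for t, continuous f} ->
  (forall s, t < s < T -> f s = 0) -> f t = 0.
Proof.
move=> t0 fc f0; apply/eqP; rewrite -normr_le0; apply/ler_addgt0Pr => e e0.
have [d d0 dP] := cont_at fc e0.
have m0 : 0 < Num.min d (T - t) by rewrite lt_min d0 subr_gt0.
have md : Num.min d (T - t) <= d by rewrite ge_min lexx.
have mt : Num.min d (T - t) <= T - t by rewrite ge_min lexx orbT.
move: (Num.min d (T - t)) m0 md mt => m m0 md mt.
have := dP (t + m / 2); rewrite f0; last lra.
rewrite sub0r normrN add0r ger0_norm; last lra.
by move=> /(_ ltac:(lra)) /ltW.
Qed.

(* Adding to the control a multiple of a fixed vector changes the endpoint
   linearly.  Hence a minimizer of the energy has every component in the span of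
   1 and of the coordinates of the curve: it is continuous. *)
Lemma corner_cutting T t c (p1 p2 p3 q1 q2 q3 x1 x2 x3 t12 t31 : R -> R)
    (pc := fun (p q : R -> R) s => if s <= t then p s else q s) :
  0 < t -> t < T -> 0 < c ->
  [/\ continuous p1, continuous p2 & continuous p3] ->
  [/\ continuous q1, continuous q2 & continuous q3] ->
  (forall s, pc p1 q1 s ^+ 2 + pc p2 q2 s ^+ 2 + pc p3 q3 s ^+ 2 = c ^+ 2) ->
  ac T x1 (pc p1 q1) -> ac T x2 (pc p2 q2) -> ac T x3 (pc p3 q3) ->
  ac T t12 (fun s => 2^-1 * (x1 s * pc p2 q2 s - x2 s * pc p1 q1 s)) ->
  ac T t31 (fun s => 2^-1 * (x3 s * pc p1 q1 s - x1 s * pc p3 q3 s)) ->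
  p1 t != q1 t ->
  exists y1 v1 r12 r31,
    [/\ bounded_measurable T v1, ac T y1 v1,
     ac T r12 (fun s => 2^-1 * (y1 s * pc p2 q2 s - x2 s * v1 s)),
     ac T r31 (fun s => 2^-1 * (x3 s * v1 s - y1 s * pc p3 q3 s)) &
    [/\ [/\ y1 0 = x1 0, r12 0 = t12 0 & r31 0 = t31 0],
        [/\ y1 T = x1 T, r12 T = t12 T & r31 T = t31 T] &
     \int[mu]_(s in `[0, T]) Num.sqrt (v1 s ^+ 2 + pc p2 q2 s ^+ 2 + pc p3 q3 s ^+ 2)
       < c * T]].
Proof.
move=> t0 tT c0 [cp1 cp2 cp3] [cq1 cq2 cq3] nrm x1a x2a x3a t12a t31a jump.
have T0 : 0 <= T by lra.
have ub1 : bounded_measurable T (pc p1 q1) by exact: bm_paste.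
have ub2 : bounded_measurable T (pc p2 q2) by exact: bm_paste.
have ub3 : bounded_measurable T (pc p3 q3) by exact: bm_paste.
have xb2 : bounded_measurable T x2 by apply: bm_cont; exact: ac_cont x2a.
have xb3 : bounded_measurable T x3 by apply: bm_cont; exact: ac_cont x3a.
(* Only the first component of the control is varied; the endpoint is affine in it and is unchanged
   when a function orthogonal to 1, [x2] and [x3] is subtracted. *)
have [k1 [k2 [k3 ]]] := ip_projection3 (bm_cst T 1) xb2 xb3 ub1.
set f := fun s => pc p1 q1 s - _ => /= -[f1 f2 f3].
have fb : bounded_measurable T f.
  apply: bmB => //; apply: bmD; last exact: bmZ.
  by apply: bmD; [apply: bmZ; exact: bm_cst|exact: bmZ].
have I0 : 0 < ip T f f.
  (* If the residual were null, the first component would agree on both sides of [t] with one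
     continuous combination of 1, [x2] and [x3], contradicting [jump]. *)
  rewrite lt_neqAle ip_ge0 andbT; apply/eqP => /esym I0.
  have f2i := bm_integrable (bmM fb fb).
  have f2p r : 0 <= r <= T -> 0 <= f r * f r by move=> _; rewrite -expr2 sqr_ge0.
  pose X2 s := x2 (clip T s); pose X3 s := x3 (clip T s).
  have cX2 : continuous X2 by apply: clip_continuous => //; exact: ac_cont x2a.
  have cX3 : continuous X3 by apply: clip_continuous => //; exact: ac_cont x3a.
  pose fl (p : R -> R) s := p s - (k1 * 1 + k2 * X2 s + k3 * X3 s).
  have cfl p : continuous p -> continuous (fl p).
    move=> cp s; apply: cvgB; first exact: cp.
    apply: cvgD; last by apply: cvgM; [exact: cvg_cst|exact: cX3].
    by apply: cvgD; [exact: cvg_cst|apply: cvgM; [exact: cvg_cst|exact: cX2]].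
  have fE (p : R -> R) s : 0 <= s <= T -> pc p1 q1 s = p s -> f s = fl p s.
    by move=> sT h; rewrite /f /fl /X2 /X3 clip_id// h.
  have pt0 (p : R -> R) a b s : continuous p -> 0 <= a -> b <= T -> a < s < b ->
      (forall r, a < r < b -> pc p1 q1 r = p r) -> fl p s = 0.
    move=> cp a0 bT sab h.
    have fs : f s = fl p s by apply: fE; [lra|exact: h].
    have : f s * f s = 0.
      apply: (@int0_at R T (fun s => f s * f s) s f2p f2i I0); first lra.
      have g s' : {for s', continuous (fun s => fl p s * fl p s)}.
        by apply: cvgM; exact: cfl.
      apply: cont_atP => e e0; have [d d0 dP] := cont_at (g s) e0.
      have m0 : 0 < Num.min d (Num.min (s - a) (b - s)).
        by rewrite !lt_min d0 !subr_gt0; lra.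
      have m1 : Num.min d (Num.min (s - a) (b - s)) <= d by rewrite ge_min lexx.
      have m2 : Num.min d (Num.min (s - a) (b - s)) <= s - a.
        by rewrite !ge_min lexx !orbT.
      have m3 : Num.min d (Num.min (s - a) (b - s)) <= b - s.
        by rewrite !ge_min lexx !orbT.
      move: (Num.min d _) m0 m1 m2 m3 => m m0 m1 m2 m3.
      exists m => // r; rewrite ltr_norml => rs.
      have rab : a < r < b by lra.
      rewrite fs (fE p r); [|lra|exact: h].
      by apply: dP; rewrite ltr_norml; lra.
    by move/eqP; rewrite mulf_eq0 orbb fs => /eqP.
  have e1 : fl p1 t = 0.
    apply: (@continuous_eq0_left t) => // [|s st]; first exact: cfl.
    by apply: (pt0 p1 0 t) => //; [lra|move=> r rt; rewrite /pc ifT//; lra].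
  have e2 : fl q1 t = 0.
    apply: (@continuous_eq0_right t T) => // [|s st]; first exact: cfl.
    by apply: (pt0 q1 t T) => //; [lra|move=> r rt; rewrite /pc ifF//; lra].
  by move/eqP: jump; apply; move: e1 e2; rewrite /fl; lra.
have Fa := ac_prim (bm_integrable fb); set F := fun s => _ in Fa.
have H2a := ac_prim (bm_integrable (bmM fb xb2)); set H2 := fun s => _ in H2a.
have H3a := ac_prim (bm_integrable (bmM fb xb3)); set H3 := fun s => _ in H3a.
have [F0 H20 H30] : [/\ F 0 = 0, H2 0 = 0 & H3 0 = 0].
  by rewrite /F /H2 /H3 !Rint_xx.
have FT : F T = 0 by rewrite -[RHS]f1; apply: Rint_eq => s _; rewrite mulr1.
have H2T : H2 T = 0 by [].
have H3T : H3 T = 0 by [].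
have y1a := ac_sub_fun x1a Fa.
have r12a := ac_add (ac_sub_fun t12a (ac_scale 2^-1 (ac_mul T0 Fa x2a))) H2a.
have r31a := ac_sub_fun (ac_add t31a (ac_scale 2^-1 (ac_mul T0 Fa x3a))) H3a.
eexists; exists (fun s => pc p1 q1 s - f s); eexists; eexists; split.
- by apply: bmB.
- exact: y1a.
- by apply: ac_eq r12a => // s _ /=; field.
- by apply: ac_eq r31a => // s _ /=; field.
split.
- by rewrite F0 H20 H30; split; ring.
- by rewrite FT H2T H3T; split; ring.
have vb : bounded_measurable T (fun s => pc p1 q1 s - f s) by exact: bmB.
have ei : mu.-integrable `[0, T] (EFin \o (fun s => c + (2 * c)^-1 *
    (f s * f s - 2 * (f s * pc p1 q1 s)))).
  apply: bm_integrable; apply: bmD; first exact: bm_cst.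
  by apply: bmZ; apply: bmB; [exact: bmM|apply: bmZ; exact: bmM].
(* From energy to length by [sqrt N <= (c ^+ 2 + N) / (2 * c)], an equality at the speed [c] of the
   original curve. *)
have le s : Num.sqrt ((pc p1 q1 s - f s) ^+ 2 + pc p2 q2 s ^+ 2 + pc p3 q3 s ^+ 2) <=
    c + (2 * c)^-1 * (f s * f s - 2 * (f s * pc p1 q1 s)).
  set N := (X in Num.sqrt X).
  have N0 : 0 <= N by rewrite !addr_ge0// sqr_ge0.
  have NE : N = c ^+ 2 + (f s * f s - 2 * (f s * pc p1 q1 s)).
    by rewrite -(nrm s) /N; ring.
  have -> : c + (2 * c)^-1 * (f s * f s - 2 * (f s * pc p1 q1 s)) =
    (c ^+ 2 + N) / (2 * c) by rewrite NE; field; rewrite gt_eqF.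
  rewrite ler_pdivlMr; last by rewrite mulr_gt0.
  have := sqr_ge0 (Num.sqrt N - c); rewrite sqrrB sqr_sqrtr//; lra.
have ni : mu.-integrable `[0, T] (EFin \o (fun s =>
    Num.sqrt ((pc p1 q1 s - f s) ^+ 2 + pc p2 q2 s ^+ 2 + pc p3 q3 s ^+ 2))).
  apply: le_integrable ei => //.
    apply/measurable_EFinP.
    apply: (measurableT_comp (continuous_measurable_fun (@sqrt_continuous R))).
    by apply: measurable_funD; [apply: measurable_funD|];
      apply: measurable_funX; [case: vb|case: ub2|case: ub3].
  move=> s _ /=; rewrite lee_fin ger0_norm ?sqrtr_ge0//.
  by apply: (le_trans (le s)); exact: ler_norm.
apply: (le_lt_trans (Rint_le ni ei (fun s _ => le s))).
have i1 := bm_integrable (bmM fb fb); have i2 := bm_integrable (bmM fb ub1).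
have i3 := bm_integrable (bmZ 2 (bmM fb ub1)).
have i4 := bm_integrable (bmB (bmM fb fb) (bmZ 2 (bmM fb ub1))).
have i5 := bm_integrable (bmZ (2 * c)^-1 (bmB (bmM fb fb) (bmZ 2 (bmM fb ub1)))).
rewrite RintegralD//; last exact: (bm_integrable (bm_cst T c)).
rewrite Rintegral_cst// RintegralZl// RintegralB// RintegralZl//.
rewrite /= lebesgue_measure_itv/= lte_fin (lt_trans t0 tT) /= subr0.
(* The removed combination is orthogonal to [f], so the gain in length is at least
   [ip T f f / (2 * c)]. *)
have fu : ip T f (pc p1 q1) = ip T f f.
  have uE : pc p1 q1 = fun s => f s - (-1) * (k1 * 1 + k2 * x2 s + k3 * x3 s).
    by apply/funext => s; rewrite /f; ring.
  have -> : ip T f f = ip T f (pc p1 q1) - k1 * ip T f (fun=> 1) - k2 * ip T f x2 - k3 * ip T f x3.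
    have b1 : bounded_measurable T (fun s => pc p1 q1 s - k1 * 1).
      by apply: bmB => //; apply: bmZ; exact: bm_cst.
    have b2 : bounded_measurable T (fun s => pc p1 q1 s - k1 * 1 - k2 * x2 s).
      by apply: bmB => //; exact: bmZ.
    rewrite -!(ipC _ _ f) -(@ipBZ R T k1 (pc p1 q1) (fun=> 1) f)//; last exact: bm_cst.
    rewrite -(@ipBZ R T k2 (fun s => pc p1 q1 s - k1 * 1) x2 f)//.
    rewrite -(@ipBZ R T k3 (fun s => pc p1 q1 s - k1 * 1 - k2 * x2 s) x3 f)//.
    by apply: Rint_eq => s _; rewrite /f; ring.
  by rewrite f1 f2 f3; ring.
rewrite -/(ip T f f) -/(ip T f (pc p1 q1)) fu.
have : 0 < (2 * c)^-1 * ip T f f by rewrite mulr_gt0// invr_gt0 mulr_gt0.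
lra.
Qed.

End corner_cutting.

(** * The cut time *)

Section assembly.
Context {R : realType}.
Notation mu := (@lebesgue_measure R).

(** The last hypothesis is the vanishing of the determinant of the two linear equations for
    [(cb, sb)]; a solution is [(ze, - (al * Sfun y))], normalized. *)
Lemma axis_tilt (y al ze : R) : pi <= y < phi1 -> 0 < al -> 0 <= ze ->
  ze ^+ 2 * Vfun y = - (Ufun y * Sfun y * al ^+ 2) ->
  exists cb sb, [/\ 0 < cb, 0 <= sb, cb ^+ 2 + sb ^+ 2 = 1,
    al * Sfun y * cb + ze * sb = 0 & al * Ufun y * sb = ze * Vfun y * cb].
Proof.
move=> yp al0 ze0 E; have p0 := @pi_gt0 R.
have V0 : 0 < Vfun y by apply: Vfun_gt0; lra.
have U0 : 0 < Ufun y by apply: Ufun_gt0; lra.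
have S0 : Sfun y <= 0 by apply: Sfun_le0; lra.
have [Sy|Sy] := eqVneq (Sfun y) 0.
  (* The planar case, in which that vector is 0 and no tilt is made. *)
  exists 1, 0; have -> : ze = 0.
    move/eqP: E; rewrite Sy mulr0 mul0r oppr0 mulf_eq0 (gt_eqF V0) orbF sqrf_eq0.
    by move/eqP.
  by rewrite Sy; split=> //; ring.
have {}S0 : Sfun y < 0 by rewrite lt_neqAle Sy.
have ze1 : 0 < ze.
  have : 0 < ze ^+ 2 * Vfun y.
    have -> : ze ^+ 2 * Vfun y = Ufun y * - Sfun y * al ^+ 2 by rewrite E; ring.
    by apply: mulr_gt0; [apply: mulr_gt0; rewrite ?oppr_gt0|rewrite exprn_gt0].
  by rewrite pmulr_lgt0// exprn_even_gt0//= lt_neqAle ze0 andbT eq_sym.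
pose q := Num.sqrt (ze ^+ 2 + (al * Sfun y) ^+ 2).
have N0 : 0 < ze ^+ 2 + (al * Sfun y) ^+ 2.
  by rewrite ltr_wpDr ?sqr_ge0// exprn_gt0.
have q0 : 0 < q by rewrite sqrtr_gt0.
have q2 : q ^+ 2 = ze ^+ 2 + (al * Sfun y) ^+ 2 by rewrite sqr_sqrtr// ltW.
have qn : q != 0 by rewrite gt_eqF.
exists (ze / q), (- (al * Sfun y) / q); split.
- exact: divr_gt0.
- by rewrite divr_ge0 ?ltW// oppr_gt0 pmulr_rlt0.
- by rewrite !expr_div_n -mulrDl sqrrN -q2 divff// expf_neq0.
- by field.
transitivity (- (Ufun y * Sfun y * al ^+ 2) / q); first by field.
by rewrite -E; field.
Qed.

Section frame.
Context {V : vectType R} {W : lmodType R}.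
Variables (dot : {dot V for idfun}) (wedge : {bilinear V -> V -> W}).
Hypothesis dimV : \dim {:V} = 3%N.
Hypothesis wedgeP : exterior_square wedge.

Lemma vnorm_sqr (x : V) : vnorm dot x ^+ 2 = dot x x.
Proof. by rewrite sqr_sqrtr// dot_ge0. Qed.

Lemma vnorm_coords (e1 e2 e3 x : V) : orthonormal3 dot e1 e2 e3 ->
  vnorm dot x = Num.sqrt (dot x e1 ^+ 2 + dot x e2 ^+ 2 + dot x e3 ^+ 2).
Proof.
move=> on; rewrite /vnorm; congr Num.sqrt.
rewrite [X in dot X _](orthonormal3_expand x dimV on) !dotDl !dotZl.
by rewrite !(dotC _ _ x); ring.
Qed.

Lemma control_frame (a b z : V) (w th cb sb : R) : dot a b = 0 -> dot a z = 0 ->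
  dot b z = 0 -> vnorm dot a = vnorm dot b -> 0 < vnorm dot a ->
  cb ^+ 2 + sb ^+ 2 = 1 ->
  exists e1 e2 e3, orthonormal3 dot e1 e2 e3 /\ forall s,
   [/\ dot (control a b z w s) e1 = hu1 w th (vnorm dot a) (vnorm dot z) cb sb s,
       dot (control a b z w s) e2 = hu2 w th (vnorm dot a) s &
       dot (control a b z w s) e3 = hu3 w th (vnorm dot a) (vnorm dot z) cb sb s].
Proof.
move=> ab az bz nab a0 csb; set al := vnorm dot a in nab a0 *.
have al0 : al != 0 by rewrite gt_eqF.
pose ea := al^-1 *: a; pose eb := al^-1 *: b.
have aE : a = al *: ea by rewrite scalerA divff// scale1r.
have bE : b = al *: eb by rewrite scalerA divff// scale1r.
have haa : dot ea ea = 1 by rewrite dotZl dotZr -vnorm_sqr -/al; field.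
have hbb : dot eb eb = 1 by rewrite dotZl dotZr -vnorm_sqr -nab; field.
have hab : dot ea eb = 0 by rewrite dotZl dotZr ab !mulr0.
have [n [_ _ nn [_ an bn]]] := orthonormal3_complete dimV haa hbb hab.
have on0 : orthonormal3 dot ea eb n by [].
have zE0 : z = dot z n *: n.
  rewrite [LHS](orthonormal3_expand z dimV on0) (dotC dot z ea) (dotC dot z eb).
  by rewrite !dotZl az bz !mulr0 !scale0r !add0r.
(* The unit normal is taken on the side of [z], so that the coordinate of [z] is its norm, including
   [z = 0]. *)
have [m [nm am bm zE]] : exists m, [/\ dot m m = 1, dot ea m = 0, dot eb m = 0 &
    z = vnorm dot z *: m].
  have zz : vnorm dot z = `|dot z n|.
    by rewrite /vnorm [in LHS]zE0 dotZl dotZr nn mulr1 -expr2 sqrtr_sqr.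
  have [h|h] := leP 0 (dot z n).
    by exists n; split=> //; rewrite zz ger0_norm.
  exists (- n); rewrite zz ltr0_norm// scalerN scaleNr opprK -zE0.
  by rewrite -scaleN1r !dotZr dotZl nn an bn !mulr0; split=> //; ring.
set ze := vnorm dot z in zE *.
have ba : dot eb ea = 0 by rewrite dotC.
have ma : dot m ea = 0 by rewrite dotC.
have mb : dot m eb = 0 by rewrite dotC.
clear zE0 on0; clearbody ea eb.
have cs := cos2Dsin2 th.
set c := cos th in cs; set s0 := sin th in cs.
pose e1 := cb *: (c *: ea + s0 *: eb) + sb *: m.
pose e2 := - s0 *: ea + c *: eb.
pose e3 := - sb *: (c *: ea + s0 *: eb) + cb *: m.
have dots := (dotDl dot, dotDr dot, dotZl dot, dotZr dot, haa, hbb, hab, ba, nm, am, bm, ma, mb).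
exists e1, e2, e3; split.
  split; last split.
  - transitivity (cb ^+ 2 * (c ^+ 2 + s0 ^+ 2) + sb ^+ 2); last by rewrite cs mulr1.
    by rewrite /e1 !dots; ring.
  - by rewrite /e2 !dots -[RHS]cs; ring.
  - transitivity (sb ^+ 2 * (c ^+ 2 + s0 ^+ 2) + cb ^+ 2); last by rewrite cs mulr1 addrC.
    by rewrite /e3 !dots; ring.
  - by rewrite /e1 /e2 !dots; ring.
  - transitivity (cb * sb * (1 - (c ^+ 2 + s0 ^+ 2))); last by rewrite cs subrr mulr0.
    by rewrite /e1 /e3 !dots; ring.
  - by rewrite /e2 /e3 !dots; ring.
move=> s.
have -> : control a b z w s =
    cos (w * s) *: (al *: ea) + sin (w * s) *: (al *: eb) + ze *: m.
  by rewrite /control -aE -bE -zE.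
rewrite /hu1 /hu2 /hu3 cosB sinB -/c -/s0.
by split; rewrite ?/e1 ?/e2 ?/e3 !dots; ring.
Qed.

End frame.
End assembly.

(** * The helix against its competitors *)

Section helix_bounds.
Context {R : realType}.
Notation mu := (@lebesgue_measure R).

Lemma ac_unique T (f f' g g' : R -> R) : 0 <= T -> ac T f f' -> ac T g g' ->
  f 0 = g 0 -> (forall s, 0 <= s <= T -> f' s = g' s) -> f T = g T.
Proof.
move=> T0 [_ fE] [_ gE] fg0 fg.
have TT : 0 <= T <= T by rewrite T0 lexx.
by rewrite (fE T TT) (gE T TT) fg0; congr (_ + _); exact: Rint_eq.
Qed.

Lemma is_derive_shift (f f' : R -> R) d :
  (forall x, is_derive x (1 : R) f (f' x)) ->
  forall x, is_derive x (1 : R) (fun r => f (r + d)) (f' (x + d)).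
Proof.
move=> fd x.
have d1 : is_derive x (1 : R) (fun r => r + d) 1.
  by apply: is_derive_eq; rewrite addr0.
apply: (is_derive_eq (@is_derive1_comp R f (fun r => r + d) x _ _ (fd _) d1)).
by rewrite mulr1.
Qed.

Lemma continuous_shift (f : R -> R) d : continuous f -> continuous (fun r => f (r + d)).
Proof.
move=> cf x; apply: (@continuous_comp _ _ _ (fun r => r + d) f); last exact: cf.
by apply: cvgD => //; exact: cvg_cst.
Qed.

Lemma derive_continuous (f f' : R -> R) :
  (forall x, is_derive x (1 : R) f (f' x)) -> continuous f.
Proof.
by move=> fd x; apply/differentiable_continuous/derivable1_diffP; have [] := fd x.
Qed.

Lemma integrable_norm3 T (u1 u2 u3 : R -> R) :
  mu.-integrable `[0, T] (EFin \o u1) -> mu.-integrable `[0, T] (EFin \o u2) ->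
  mu.-integrable `[0, T] (EFin \o u3) ->
  mu.-integrable `[0, T] (EFin \o (fun s => Num.sqrt (u1 s ^+ 2 + u2 s ^+ 2 + u3 s ^+ 2))).
Proof.
move=> i1 i2 i3.
have n f : mu.-integrable `[0, T] (EFin \o f) ->
    mu.-integrable `[0, T] (EFin \o (fun s => `|f s|)) by exact: integrable_norm.
have i12 : mu.-integrable `[0, T] (EFin \o (fun s => `|u1 s| + `|u2 s|)).
  have := integrableD _ (n _ i1) (n _ i2); exact.
have i123 : mu.-integrable `[0, T] (EFin \o (fun s => `|u1 s| + `|u2 s| + `|u3 s|)).
  have := integrableD _ i12 (n _ i3); exact.
have m f : mu.-integrable `[0, T] (EFin \o f) -> measurable_fun `[0, T] f.
  by move=> /integrableP[/measurable_EFinP].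
apply: le_integrable i123 => //.
  apply/measurable_EFinP.
  apply: (measurableT_comp (continuous_measurable_fun (@sqrt_continuous R))).
  by apply: measurable_funD; [apply: measurable_funD|];
    apply: measurable_funX; exact: m.
move=> s _ /=; rewrite lee_fin ger0_norm ?sqrtr_ge0//.
have a1 := normr_ge0 (u1 s); have a2 := normr_ge0 (u2 s); have a3 := normr_ge0 (u3 s).
rewrite ger0_norm ?addr_ge0//.
rewrite -[leRHS]ger0_norm ?addr_ge0// -sqrtr_sqr ler_wsqrtr//.
rewrite -(real_normK (num_real (u1 s))) -(real_normK (num_real (u2 s))).
rewrite -(real_normK (num_real (u3 s))).
move: a1 a2 a3; move: `|u1 s| `|u2 s| `|u3 s| => p q r p0 q0 r0.
have := mulr_ge0 p0 q0; have := mulr_ge0 p0 r0; have := mulr_ge0 q0 r0.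
rewrite !expr2; lra.
Qed.

Section cut_helix.
Context (y al ze cb sb phi : R).
Hypotheses (yp : pi <= y < phi1) (al0 : 0 < al) (cb0 : 0 < cb) (sb0 : 0 <= sb).
Hypotheses (csb : cb ^+ 2 + sb ^+ 2 = 1) (phi0 : 0 < phi).
Hypotheses (E1 : al * Sfun y * cb + ze * sb = 0).
Hypotheses (E2 : al * Ufun y * sb = ze * Vfun y * cb).
Notation w := (2 * phi).
Notation tc := (y / phi).
Notation c0 := (Num.sqrt (al ^+ 2 + ze ^+ 2)).
Notation u1 := (hu1 w y al ze cb sb).
Notation u2 := (hu2 w y al).
Notation u3 := (hu3 w y al ze cb sb).
Notation x1 := (hx1 w y al ze cb sb).
Notation x2 := (hx2 w y al).
Notation x3 := (hx3 w y al ze cb sb).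
Notation t12 := (ht12 w y al ze cb sb).
Notation t23 := (ht23 w y al ze cb sb).
Notation t31 := (ht31 w y al ze).

Let w0 : w != 0. Proof. by rewrite gt_eqF// mulr_gt0. Qed.
Let y0 : 0 < y.
Proof. by case/andP: yp => h _; exact: lt_le_trans (pi_gt0 R) h. Qed.
Let tc0 : 0 < tc. Proof. exact: divr_gt0. Qed.

Let dx1 := is_derive_hx1 y al ze cb sb w0.
Let dx2 := is_derive_hx2 y al w0.
Let dx3 := is_derive_hx3 y al ze cb sb w0.
Let dt12 := is_derive_ht12 y al ze cb sb w0.
Let dt23 := is_derive_ht23 y al ze cb sb w0.
Let dt31 := is_derive_ht31 y al ze w0 csb.

Lemma helix_cut_tc :
  [/\ x1 tc = 0, x2 tc = 0, t23 tc = 0, t31 tc = 0 &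
  [/\ t12 tc * cb = (tc * al) ^+ 2 * Ufun y, x3 tc * sb = - (tc * al * Sfun y) &
      x3 tc ^+ 2 + (tc * al) ^+ 2 * (1 - Sfun y ^+ 2) = tc ^+ 2 * (al ^+ 2 + ze ^+ 2)]].
Proof.
apply: helix_cut => //; first by rewrite gt_eqF.
by field; rewrite gt_eqF.
Qed.

Let cu1 : continuous u1. Proof. by case: (hu_continuous w y al ze cb sb). Qed.
Let cu2 : continuous u2. Proof. by case: (hu_continuous w y al ze cb sb). Qed.
Let cu3 : continuous u3. Proof. by case: (hu_continuous w y al ze cb sb). Qed.

Lemma continuous_area (f g f' g' : R -> R) : continuous f -> continuous g ->
  continuous f' -> continuous g' ->
  continuous (fun s => 2^-1 * (f s * g' s - g s * f' s)).
Proof.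
move=> cf cg cf' cg' s; apply: cvgM; first exact: cvg_cst.
by apply: cvgB; apply: cvgM; [exact: cf|exact: cg'|exact: cg|exact: cf'].
Qed.

(** A competitor meeting the helix at time [s] is continued along the helix to the cut point, where
    [axis_lower_bound] applies; the length [(tc - s) * c0] of the added arc is then subtracted. *)
Lemma competitor_bound T s (f1 f2 f3 v1 v2 v3 r12 r23 r31 : R -> R) :
  0 < T -> 0 < s <= tc -> ac T f1 v1 -> ac T f2 v2 -> ac T f3 v3 ->
  ac T r12 (fun s => 2^-1 * (f1 s * v2 s - f2 s * v1 s)) ->
  ac T r23 (fun s => 2^-1 * (f2 s * v3 s - f3 s * v2 s)) ->
  ac T r31 (fun s => 2^-1 * (f3 s * v1 s - f1 s * v3 s)) ->
  [/\ f1 0 = 0, f2 0 = 0, f3 0 = 0, r12 0 = 0 & r23 0 = 0 /\ r31 0 = 0] ->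
  [/\ f1 T = x1 s, f2 T = x2 s, f3 T = x3 s, r12 T = t12 s &
      r23 T = t23 s /\ r31 T = t31 s] ->
  s * c0 <= \int[mu]_(r in `[0, T]) Num.sqrt (v1 r ^+ 2 + v2 r ^+ 2 + v3 r ^+ 2).
Proof.
move=> T0 sp a1 a2 a3 a12 a23 a31 [b1 b2 b3 b12 [b23 b31]] [e1 e2 e3 e12 [e23 e31]].
pose d := s - T; pose T2 := T + (tc - s).
have TT2 : T <= T2 by rewrite /T2 lerDl; lra.
have T20 : 0 < T2 by exact: lt_le_trans TT2.
have Td : T + d = s by rewrite /d; ring.
have T2d : T2 + d = tc by rewrite /T2 /d; ring.
have pst (f v h h' : R -> R) : ac T f v -> (forall x, is_derive x (1 : R) h (h' x)) ->
    continuous h' -> f T = h s ->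
    ac T2 (fun r => if r <= T then f r else h (r + d))
          (fun r => if r <= T then v r else h' (r + d)).
  move=> fa hd hc fT; apply: (ac_paste (ltW T0) TT2 fa).
  - exact: is_derive_shift hd.
  - exact: continuous_shift.
  - by rewrite Td.
(* When [s = tc] nothing is added, and the conditional at [T2 = T] takes its first branch. *)
have end2 (f h : R -> R) : f T = h s -> (if T2 <= T then f T2 else h (T2 + d)) = h tc.
  move=> fT; rewrite T2d; case: ifP => // T2T.
  have E : T2 = T by apply/le_anti; rewrite T2T TT2.
  by rewrite E fT; congr h; rewrite -Td -T2d E.
have cx1 := derive_continuous dx1; have cx2 := derive_continuous dx2.
have cx3 := derive_continuous dx3.
have p1 := pst _ _ _ _ a1 dx1 cu1 e1.
have p2 := pst _ _ _ _ a2 dx2 cu2 e2.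
have p3 := pst _ _ _ _ a3 dx3 cu3 e3.
have p12 := pst _ _ _ _ a12 dt12 (continuous_area cx1 cx2 cu1 cu2) e12.
have p23 := pst _ _ _ _ a23 dt23 (continuous_area cx2 cx3 cu2 cu3) e23.
have p31 := pst _ _ _ _ a31 dt31 (continuous_area cx3 cx1 cu3 cu1) e31.
have [h1 h2 h3 h4 [h5 h6 h7]] := helix_cut_tc.
have ni := integrable_norm3 (proj1 p1) (proj1 p2) (proj1 p3).
have ni0 := integrable_norm3 (proj1 a1) (proj1 a2) (proj1 a3).
have areaE (f g f' g' F G F' G' : R -> R) r : 0 <= r <= T2 ->
    (if r <= T then 2^-1 * (f r * g' r - g r * f' r)
      else 2^-1 * (F (r + d) * G' (r + d) - G (r + d) * F' (r + d))) =
    2^-1 * ((if r <= T then f r else F (r + d)) * (if r <= T then g' r else G' (r + d))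
      - (if r <= T then g r else G (r + d)) * (if r <= T then f' r else F' (r + d))).
  by move=> _; case: ifP.
have p12' := ac_eq (ltW T20) (fun _ _ => erefl) (areaE _ _ _ _ _ _ _ _) p12.
have p23' := ac_eq (ltW T20) (fun _ _ => erefl) (areaE _ _ _ _ _ _ _ _) p23.
have p31' := ac_eq (ltW T20) (fun _ _ => erefl) (areaE _ _ _ _ _ _ _ _) p31.
have ini : [/\ (if 0 <= T then f1 0 else x1 (0 + d)) = 0,
    (if 0 <= T then f2 0 else x2 (0 + d)) = 0,
    (if 0 <= T then f3 0 else x3 (0 + d)) = 0,
    (if 0 <= T then r12 0 else t12 (0 + d)) = 0 &
    (if 0 <= T then r23 0 else t23 (0 + d)) = 0 /\
    (if 0 <= T then r31 0 else t31 (0 + d)) = 0] by rewrite (ltW T0).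
have fin : [/\ (if T2 <= T then f1 T2 else x1 (T2 + d)) = 0,
    (if T2 <= T then f2 T2 else x2 (T2 + d)) = 0,
    (if T2 <= T then f3 T2 else x3 (T2 + d)) = x3 tc,
    (if T2 <= T then r12 T2 else t12 (T2 + d)) = t12 tc &
    (if T2 <= T then r23 T2 else t23 (T2 + d)) = 0 /\
    (if T2 <= T then r31 T2 else t31 (T2 + d)) = 0].
  by rewrite (end2 _ _ e1) (end2 _ _ e2) (end2 _ _ e3) (end2 _ _ e12)
    (end2 _ _ e23) (end2 _ _ e31) h1 h2 h3 h4.
have H := axis_lower_bound T20 p1 p2 p3 p12' p23' p31' ini fin yp
  (mulr_gt0 tc0 al0) cb0 sb0 csb h5 h6 ni.
have cc : 0 <= c0 by exact: sqrtr_ge0.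
have tcc : Num.sqrt (tc ^+ 2 * (al ^+ 2 + ze ^+ 2)) = tc * c0.
  by rewrite sqrtrM ?sqr_ge0// sqrtr_sqr ger0_norm// ltW.
rewrite h7 tcc in H.
have g1 x : is_derive x (1 : R) (fun r => c0 * (r - T) +
    \int[mu]_(r in `[0, T]) Num.sqrt (v1 r ^+ 2 + v2 r ^+ 2 + v3 r ^+ 2)) c0.
  by apply: is_derive_eq; rewrite /GRing.scale /=; ring.
have g2 : continuous (fun _ : R => c0) by move=> ?; exact: cvg_cst.
have TE : \int[mu]_(r in `[0, T]) Num.sqrt (v1 r ^+ 2 + v2 r ^+ 2 + v3 r ^+ 2) =
  c0 * (T - T) + \int[mu]_(r in `[0, T]) Num.sqrt (v1 r ^+ 2 + v2 r ^+ 2 + v3 r ^+ 2).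
  by rewrite subrr mulr0 add0r.
(* The length of the continued competitor is a pasted primitive, to which the helix contributes an
   affine piece of slope [c0]. *)
have La := ac_paste (ltW T0) TT2 (ac_prim ni0) g1 g2 TE.
have := ac_sub La (lexx 0) (ltW T20) (lexx T2).
rewrite (ltW T0) Rint_xx subr0.
move: H; rewrite (@Rint_eq _ 0 T2 _ (fun r => if r <= T then
   Num.sqrt (v1 r ^+ 2 + v2 r ^+ 2 + v3 r ^+ 2) else c0)); last first.
  by move=> r _; case: ifP => // _; rewrite hu_norm.
move=> H LE; rewrite -LE in H; move: H.
case: ifP => [T2T|_].
  have E : T2 = T by apply/le_anti; rewrite T2T TT2.
  have -> : s = tc by rewrite -Td -T2d E.
  by rewrite E.
move=> H; rewrite -subr_ge0; move: H; rewrite -subr_ge0.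
by congr (_ <= _); rewrite /T2; ring.
Qed.

(* Rotating the first part of the helix by pi around the third axis gives a
   curve with the same endpoint and length, but with a corner. *)
Lemma helix_shortcut T : tc < T ->
  exists f1 f2 f3 v1 v2 v3 r12 r23 r31,
  [/\ [/\ bounded_measurable T v1, bounded_measurable T v2 & bounded_measurable T v3],
    [/\ ac T f1 v1, ac T f2 v2 & ac T f3 v3],
    [/\ ac T r12 (fun s => 2^-1 * (f1 s * v2 s - f2 s * v1 s)),
        ac T r23 (fun s => 2^-1 * (f2 s * v3 s - f3 s * v2 s)) &
        ac T r31 (fun s => 2^-1 * (f3 s * v1 s - f1 s * v3 s))],
    [/\ f1 0 = 0, f2 0 = 0, f3 0 = 0, r12 0 = 0 & r23 0 = 0 /\ r31 0 = 0] &
    [/\ f1 T = x1 T, f2 T = x2 T, f3 T = x3 T, r12 T = t12 T &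
      r23 T = t23 T /\ r31 T = t31 T] /\
    \int[mu]_(r in `[0, T]) Num.sqrt (v1 r ^+ 2 + v2 r ^+ 2 + v3 r ^+ 2) < c0 * T].
Proof.
move=> tT; have T0 : 0 < T by exact: lt_trans tT.
have [h1 h2 h4 h5 _] := helix_cut_tc.
have [b1 b2 b3 b12 [b23 b31]] := helix0 y al ze cb sb w0.
have cN (f : R -> R) : continuous f -> continuous (fun s => - f s).
  by move=> cf s; apply: cvgN; exact: cf.
have pst (f f' h h' : R -> R) : (forall x, is_derive x (1 : R) f (f' x)) ->
    continuous f' -> (forall x, is_derive x (1 : R) h (h' x)) ->
    continuous h' -> f tc = h tc ->
    ac T (fun r => if r <= tc then f r else h r)
         (fun r => if r <= tc then f' r else h' r).
  move=> fd cf' hd ch' fh; apply: ac_paste => //; try exact: ltW.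
  by apply: ac_C1 => //; exact: ltW.
have dN (f f' : R -> R) : (forall x, is_derive x (1 : R) f (f' x)) ->
    forall x, is_derive x (1 : R) (fun r => - f r) (- f' x).
  by move=> fd x; apply: is_deriveN.
have cx1 := derive_continuous dx1; have cx2 := derive_continuous dx2.
have cx3 := derive_continuous dx3.
have a12 := continuous_area cx1 cx2 cu1 cu2.
have a23 := continuous_area cx2 cx3 cu2 cu3.
have a31 := continuous_area cx3 cx1 cu3 cu1.
(* The rotation by pi reverses [x1], [x2], [t23] and [t31], all zero at [tc], so the rotated arc
   joins the helix there. *)
have n1 : - x1 tc = x1 tc by rewrite h1 oppr0.
have n2 : - x2 tc = x2 tc by rewrite h2 oppr0.
have n4 : - t23 tc = t23 tc by rewrite h4 oppr0.
have n5 : - t31 tc = t31 tc by rewrite h5 oppr0.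
have p1 := pst _ _ _ _ (dN _ _ dx1) (cN _ cu1) dx1 cu1 n1.
have p2 := pst _ _ _ _ (dN _ _ dx2) (cN _ cu2) dx2 cu2 n2.
(* The third coordinate is unchanged; its trivial conditional keeps the shape required by
   [corner_cutting]. *)
have p3 := pst _ _ _ _ dx3 cu3 dx3 cu3 (erefl _).
have p12 := pst _ _ _ _ dt12 a12 dt12 a12 (erefl _).
have p23 := pst _ _ _ _ (dN _ _ dt23) (cN _ a23) dt23 a23 n4.
have p31 := pst _ _ _ _ (dN _ _ dt31) (cN _ a31) dt31 a31 n5.
have c00 : 0 < c0 by rewrite sqrtr_gt0 ltr_pwDl ?sqr_ge0// exprn_gt0.
have [y1 [v1 [r12 [r31 [vb y1a r12a r31a [[z1 z12 z31] [e1 e12 e31] lt]]]]]] :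
  exists y1 v1 r12 r31,
    [/\ bounded_measurable T v1, ac T y1 v1,
     ac T r12 (fun s => 2^-1 * (y1 s * (if s <= tc then - u2 s else u2 s) -
       (if s <= tc then - x2 s else x2 s) * v1 s)),
     ac T r31 (fun s => 2^-1 * ((if s <= tc then x3 s else x3 s) * v1 s
       - y1 s * (if s <= tc then u3 s else u3 s))) &
    [/\ [/\ y1 0 = (if 0 <= tc then - x1 0 else x1 0),
         r12 0 = (if 0 <= tc then t12 0 else t12 0) &
         r31 0 = (if 0 <= tc then - t31 0 else t31 0)],
        [/\ y1 T = (if T <= tc then - x1 T else x1 T),
         r12 T = (if T <= tc then t12 T else t12 T) &
         r31 T = (if T <= tc then - t31 T else t31 T)] &
     \int[mu]_(s in `[0, T]) Num.sqrt (v1 s ^+ 2 +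
       (if s <= tc then - u2 s else u2 s) ^+ 2 +
       (if s <= tc then u3 s else u3 s) ^+ 2) < c0 * T]].
  have nrm s : (if s <= tc then - u1 s else u1 s) ^+ 2 +
      (if s <= tc then - u2 s else u2 s) ^+ 2 +
      (if s <= tc then u3 s else u3 s) ^+ 2 = c0 ^+ 2.
    have -> : c0 ^+ 2 = al ^+ 2 + ze ^+ 2.
      by rewrite sqr_sqrtr// addr_ge0// sqr_ge0.
    by rewrite -(hu_norm w y al ze csb s); case: ifP => _; rewrite ?sqrrN.
  have q12 : ac T (fun s => if s <= tc then t12 s else t12 s) (fun s => 2^-1 *
      ((if s <= tc then - x1 s else x1 s) * (if s <= tc then - u2 s else u2 s) -
       (if s <= tc then - x2 s else x2 s) * (if s <= tc then - u1 s else u1 s))).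
    apply: (ac_eq (ltW T0) _ _ p12) => // s _; case: ifP => _ //.
    by rewrite mulrNN mulrNN.
  have q31 : ac T (fun s => if s <= tc then - t31 s else t31 s) (fun s => 2^-1 *
      ((if s <= tc then x3 s else x3 s) * (if s <= tc then - u1 s else u1 s) -
       (if s <= tc then - x1 s else x1 s) * (if s <= tc then u3 s else u3 s))).
    apply: (ac_eq (ltW T0) _ _ p31) => // s _; case: ifP => _ //.
    by ring.
  (* Eliminating [ze] by [E1] gives [u1 tc = - (2 * y * Vfun y * al * cb)], nonzero because [y] lies
     below the zero of [Vfun]. *)
  have jump : - u1 tc != u1 tc.
    have y0' : y != 0 by rewrite gt_eqF.
    have V0 : 0 < Vfun y by apply: Vfun_gt0; rewrite y0; case/andP: yp.
    have u1E : u1 tc = - (2 * y * Vfun y * al * cb).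
      have wt : w * tc - y = y by field; rewrite gt_eqF.
      rewrite /hu1 wt; have -> : sb * ze = - (al * Sfun y * cb).
        by move: E1 => /eqP; rewrite addrC addr_eq0 => /eqP <-; rewrite mulrC.
      by rewrite (Vfun_Sfun y0'); field.
    rewrite u1E opprK -subr_eq0 opprK gt_eqF// -mulr2n pmulrn_rgt0//.
    by do 3! [apply: mulr_gt0 => //]; apply: mulr_gt0.
  exact: (@corner_cutting R T tc c0 (fun s => - u1 s) (fun s => - u2 s) u3 u1 u2 u3
    _ _ _ _ _ tc0 tT c00 (And3 (cN _ cu1) (cN _ cu2) cu3) (And3 cu1 cu2 cu3)
    nrm p1 p2 p3 q12 q31 jump).
rewrite (ltW tc0) in z1 z12 z31; rewrite leNgt tT /= in e1 e12 e31.
exists y1, (fun r => if r <= tc then - x2 r else x2 r),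
  (fun r => if r <= tc then x3 r else x3 r), v1,
  (fun r => if r <= tc then - u2 r else u2 r),
  (fun r => if r <= tc then u3 r else u3 r), r12,
  (fun r => if r <= tc then - t23 r else t23 r), r31.
have Ttc : (T <= tc) = false by rewrite leNgt tT.
split=> //.
- split=> //; last exact: bm_paste.
  by apply: bm_paste => //; exact: cN.
- split=> //; apply: (ac_eq (ltW T0) _ _ p23) => // s _; case: ifP => _ //.
  by ring.
- rewrite (ltW tc0); rewrite z1 z12 z31 b1 b2 b3 b12 b23 b31 oppr0.
  by split.
by rewrite Ttc.
Qed.

End cut_helix.
End helix_bounds.

(** * Horizontal curves in coordinates *)

Section horizontal_curves.
Context {R : realType} {V : vectType R} {W : lmodType R}.
Notation mu := (@lebesgue_measure R).
Context (dot : {dot V for idfun}) (wedge : {bilinear V -> V -> W}).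
Context (dimV : \dim {:V} = 3%N) (wedgeP : exterior_square wedge).
Context (e1 e2 e3 : V) (on : orthonormal3 dot e1 e2 e3).

Lemma horizontal_coord T g u e : 0 < T -> horizontal wedge T g u ->
  ac T (fun s => dot (g s).1 e) (fun s => dot (u s) e).
Proof. by move=> T0 [_ hx _]; exact: (W12_ac T0 (hx (dot_form dot e))). Qed.

Lemma horizontal_area T g u e e' (G : {scalar W}) : 0 < T ->
  horizontal wedge T g u -> (forall x y, G (wedge x y) = minor dot e e' x y) ->
  ac T (fun s => G (g s).2) (fun s => 2^-1 *
    (dot (g s).1 e * dot (u s) e' - dot (g s).1 e' * dot (u s) e)).
Proof.
move=> T0 [_ _ ht] GE; have := W12_ac T0 (ht G).
apply: ac_eq; [exact: ltW|by []|move=> s _].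
by rewrite linearZ /= GE.
Qed.

Lemma length_coords T u : 0 <= T ->
  (forall e, mu.-integrable `[0, T] (EFin \o (fun s => dot (u s) e))) ->
  length dot T u = (\int[mu]_(s in `[0, T])
    Num.sqrt (dot (u s) e1 ^+ 2 + dot (u s) e2 ^+ 2 + dot (u s) e3 ^+ 2))%:E.
Proof.
move=> T0 ui; have ni := integrable_norm3 (ui e1) (ui e2) (ui e3).
have nE : (fun s => (vnorm dot (u s))%:E) = EFin \o (fun s =>
    Num.sqrt (dot (u s) e1 ^+ 2 + dot (u s) e2 ^+ 2 + dot (u s) e3 ^+ 2)).
  by apply/funext => s; rewrite (vnorm_coords dimV _ on).
rewrite /length nE -(@integral_itv_bndoo _ 0 T _ true false); last first.
  by apply: measurable_funS (measurable_int _ ni) => //; apply: subset_itv; rewrite bnd_simp.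
by rewrite /Rintegral fineK// integrable_fin_num.
Qed.

(** This returns from the scalar functions of the shortcut to a curve in V x W. Every linear form of
    the curve is a fixed combination of these functions, and boundedness of the controls gives
    L^2. *)
Lemma horizontal_of_coords T (f1 f2 f3 v1 v2 v3 r12 r23 r31 : R -> R) : 0 < T ->
  bounded_measurable T v1 -> bounded_measurable T v2 -> bounded_measurable T v3 ->
  ac T f1 v1 -> ac T f2 v2 -> ac T f3 v3 ->
  ac T r12 (fun s => 2^-1 * (f1 s * v2 s - f2 s * v1 s)) ->
  ac T r23 (fun s => 2^-1 * (f2 s * v3 s - f3 s * v2 s)) ->
  ac T r31 (fun s => 2^-1 * (f3 s * v1 s - f1 s * v3 s)) ->
  horizontal wedge T
    (fun s => (f1 s *: e1 + f2 s *: e2 + f3 s *: e3,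
      r12 s *: wedge e1 e2 + r23 s *: wedge e2 e3 + r31 s *: wedge e3 e1))
    (fun s => v1 s *: e1 + v2 s *: e2 + v3 s *: e3).
Proof.
move=> T0 b1 b2 b3 a1 a2 a3 a12 a23 a31; have T0' := ltW T0.
have bmc f g : ac T f g -> bounded_measurable T f.
  by move=> fa; apply: bm_cont; exact: ac_cont fa.
have lin (X : lmodType R) (l : {scalar X}) (x y z : X) (p q r : R) :
    l (p *: x + q *: y + r *: z) = l x * p + l y * q + l z * r.
  by rewrite !linearD !linearZ /=; ring.
have bm3 (k1 k2 k3 : R) (p q r : R -> R) : bounded_measurable T p ->
    bounded_measurable T q -> bounded_measurable T r ->
    bounded_measurable T (fun s => k1 * p s + k2 * q s + k3 * r s).
  by move=> pb qb rb; apply: bmD; [apply: bmD|]; exact: bmZ.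
have ac3 (k1 k2 k3 : R) (p q r p' q' r' : R -> R) : ac T p p' -> ac T q q' ->
    ac T r r' -> ac T (fun s => k1 * p s + k2 * q s + k3 * r s)
                      (fun s => k1 * p' s + k2 * q' s + k3 * r' s).
  by move=> pa qa ra; apply: ac_add; [apply: ac_add|]; exact: ac_scale.
have barea (p q p' q' : R -> R) : bounded_measurable T p -> bounded_measurable T q ->
    bounded_measurable T p' -> bounded_measurable T q' ->
    bounded_measurable T (fun s => 2^-1 * (p s * q' s - q s * p' s)).
  by move=> ? ? ? ?; apply: bmZ; apply: bmB; exact: bmM.
have lu (l : {scalar V}) : bounded_measurable T
    (fun s => l (v1 s *: e1 + v2 s *: e2 + v3 s *: e3)).
  have := bm3 (l e1) (l e2) (l e3) _ _ _ b1 b2 b3.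
  by congr bounded_measurable; apply/funext => s; rewrite lin.
split=> l; first exact/bm_L2/lu.
  apply: ac_W12 => //; last exact/bm_L2/lu.
  by apply: ac_eq (ac3 (l e1) (l e2) (l e3) _ _ _ _ _ _ a1 a2 a3) => // s _ /=;
    rewrite lin.
have E s : l (2^-1 *: wedge (f1 s *: e1 + f2 s *: e2 + f3 s *: e3)
      (v1 s *: e1 + v2 s *: e2 + v3 s *: e3)) =
    l (wedge e1 e2) * (2^-1 * (f1 s * v2 s - f2 s * v1 s)) +
    l (wedge e2 e3) * (2^-1 * (f2 s * v3 s - f3 s * v2 s)) +
    l (wedge e3 e1) * (2^-1 * (f3 s * v1 s - f1 s * v3 s)).
  have [n1 n2 n3 [n12 n13 n23]] := on.
  have n21 : dot e2 e1 = 0 by rewrite dotC.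
  have n31 : dot e3 e1 = 0 by rewrite dotC.
  have n32 : dot e3 e2 = 0 by rewrite dotC.
  have co p q r : [/\ dot (p *: e1 + q *: e2 + r *: e3) e1 = p,
      dot (p *: e1 + q *: e2 + r *: e3) e2 = q &
      dot (p *: e1 + q *: e2 + r *: e3) e3 = r].
    by rewrite !dotDl !dotZl n1 n2 n3 n12 n13 n23 n21 n31 n32; split; ring.
  rewrite linearZ /= (wedge_expand dimV wedgeP _ _ on) lin /minor.
  have [-> -> ->] := co (f1 s) (f2 s) (f3 s); have [-> -> ->] := co (v1 s) (v2 s) (v3 s).
  by ring.
apply: ac_W12 => //.
  apply: ac_eq (ac3 (l (wedge e1 e2)) (l (wedge e2 e3)) (l (wedge e3 e1)) _ _ _ _ _ _
    a12 a23 a31) => // s _ /=; first by rewrite lin.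
  by rewrite E.
have := bm3 (l (wedge e1 e2)) (l (wedge e2 e3)) (l (wedge e3 e1)) _ _ _
  (barea _ _ _ _ (bmc _ _ a1) (bmc _ _ a2) b1 b2)
  (barea _ _ _ _ (bmc _ _ a2) (bmc _ _ a3) b2 b3)
  (barea _ _ _ _ (bmc _ _ a3) (bmc _ _ a1) b3 b1).
by move/bm_L2; congr L2; apply/funext => s; rewrite /= E.
Qed.

End horizontal_curves.

Theorem theorem1p3 (R : realType) (V : vectType R) (dot : {dot V for idfun})
    (W : lmodType R) (wedge : {bilinear V -> V -> W})
    (dimV : \dim {:V} = 3%N) (wedgeP : exterior_square wedge)
    (a b z : V) (phi : R)
    (ab : dot a b = 0) (az : dot a z = 0) (bz : dot b z = 0)
    (norm_ab : vnorm dot a = vnorm dot b) (norm_a : 0 < vnorm dot a)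
    (phi_gt0 : 0 < phi)
    (gamma : R -> V * W)
    (gammaP : forall T : R, 0 < T ->
      horizontal wedge T gamma (control a b z (2 * phi)))
    (gamma0 : gamma 0 = (0, 0)) :
  let u := control a b z (2 * phi) in
  let tc := Qinv (vnorm dot z ^+ 2 / vnorm dot a ^+ 2) / phi in
  (forall s : R, 0 < s <= tc -> length_minimizer dot wedge gamma u s) /\
  t_cut dot wedge gamma u = tc%:E.
Proof.
move=> u tc; rewrite /tc.
set al := vnorm dot a in norm_ab norm_a tc *; set ze := vnorm dot z in tc *.
have ze0 : 0 <= ze by exact: sqrtr_ge0.
have [y1 y2 yQ] := QinvP (divr_ge0 (sqr_ge0 ze) (sqr_ge0 al)).
set y := Qinv _ in y1 y2 yQ tc *.
have yp : pi <= y < phi1 by rewrite y1.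
have p0 := @pi_gt0 R.
have V0 : 0 < Vfun y by apply: Vfun_gt0; rewrite y2 (lt_le_trans p0 y1).
have zeE : ze ^+ 2 * Vfun y = - (Ufun y * Sfun y * al ^+ 2).
  have : ze ^+ 2 = Qfun y * al ^+ 2 by rewrite yQ divfK// expf_neq0// gt_eqF.
  have aux (p q r v : R) : v != 0 -> - (p * q / v) * r * v = - (p * q * r).
    by move=> v0; field.
  by move=> ->; rewrite /Qfun aux// gt_eqF.
have [cb [sb [cb0 sb0 csb E1 E2]]] := axis_tilt yp norm_a ze0 zeE.
have [e1 [e2 [e3 [on uE]]]] :=
  control_frame dimV (2 * phi) y ab az bz norm_ab norm_a csb.
have [g12 g12E] := wedge_coord dot wedgeP e1 e2.
have [g23 g23E] := wedge_coord dot wedgeP e2 e3.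
have [g31 g31E] := wedge_coord dot wedgeP e3 e1.
have y0 : 0 < y by exact: lt_le_trans y1.
have tc0 : 0 < y / phi by exact: divr_gt0.
have w0 : 2 * phi != 0 by rewrite gt_eqF// mulr_gt0.
pose w : R := 2 * phi.
pose c0 := Num.sqrt (al ^+ 2 + ze ^+ 2).
have [cu1 cu2 cu3] := hu_continuous w y al ze cb sb.
have [b1 b2 b3 b12 [b23 b31]] := helix0 y al ze cb sb w0.
have g0 e : dot (gamma 0).1 e = 0 by rewrite gamma0 dot0l.
have G0 (G : {scalar W}) : G (gamma 0).2 = 0 by rewrite gamma0 linear0.
(* The control determines the curve. The coordinates of x are identified on all of [0, s], because
   they enter the derivative of t. *)
have pos s : 0 < s -> [/\ dot (gamma s).1 e1 = hx1 w y al ze cb sb s,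
    dot (gamma s).1 e2 = hx2 w y al s, dot (gamma s).1 e3 = hx3 w y al ze cb sb s,
    g12 (gamma s).2 = ht12 w y al ze cb sb s &
    g23 (gamma s).2 = ht23 w y al ze cb sb s /\ g31 (gamma s).2 = ht31 w y al ze s].
  move=> s0; have s0' := ltW s0; have hs := gammaP s s0.
  have cx1 := derive_continuous (is_derive_hx1 y al ze cb sb w0).
  have cx2 := derive_continuous (is_derive_hx2 y al w0).
  have cx3 := derive_continuous (is_derive_hx3 y al ze cb sb w0).
  have x1E r : 0 <= r <= s -> dot (gamma r).1 e1 = hx1 w y al ze cb sb r.
    move=> rs; have r0 : 0 <= r by case/andP: rs.
    have [->|r1] := eqVneq r 0; first by rewrite g0 b1.
    have r2 : 0 < r by rewrite lt_neqAle eq_sym r1.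
    apply: (ac_unique r0 (horizontal_coord dot e1 r2 (gammaP r r2))
      (ac_C1 r0 (is_derive_hx1 y al ze cb sb w0) cu1)); first by rewrite g0 b1.
    by move=> q _; have [] := uE q.
  have x2E r : 0 <= r <= s -> dot (gamma r).1 e2 = hx2 w y al r.
    move=> rs; have r0 : 0 <= r by case/andP: rs.
    have [->|r1] := eqVneq r 0; first by rewrite g0 b2.
    have r2 : 0 < r by rewrite lt_neqAle eq_sym r1.
    apply: (ac_unique r0 (horizontal_coord dot e2 r2 (gammaP r r2))
      (ac_C1 r0 (is_derive_hx2 y al w0) cu2)); first by rewrite g0 b2.
    by move=> q _; have [] := uE q.
  have x3E r : 0 <= r <= s -> dot (gamma r).1 e3 = hx3 w y al ze cb sb r.
    move=> rs; have r0 : 0 <= r by case/andP: rs.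
    have [->|r1] := eqVneq r 0; first by rewrite g0 b3.
    have r2 : 0 < r by rewrite lt_neqAle eq_sym r1.
    apply: (ac_unique r0 (horizontal_coord dot e3 r2 (gammaP r r2))
      (ac_C1 r0 (is_derive_hx3 y al ze cb sb w0) cu3)); first by rewrite g0 b3.
    by move=> q _; have [] := uE q.
  have ss : 0 <= s <= s by rewrite s0' lexx.
  split; [exact: x1E|exact: x2E|exact: x3E| |split].
  - have ta := ac_C1 s0' (is_derive_ht12 y al ze cb sb w0) (continuous_area cx1 cx2 cu1 cu2).
    have ga := horizontal_area s0 hs g12E.
    apply: (ac_unique s0' ga ta).
      by rewrite G0 b12.
    by move=> r rs; rewrite x1E// x2E//; have [-> -> _] := uE r.
  - have ta := ac_C1 s0' (is_derive_ht23 y al ze cb sb w0) (continuous_area cx2 cx3 cu2 cu3).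
    have ga := horizontal_area s0 hs g23E.
    apply: (ac_unique s0' ga ta).
      by rewrite G0 b23.
    by move=> r rs; rewrite x2E// x3E//; have [_ -> ->] := uE r.
  - have ta := ac_C1 s0' (is_derive_ht31 y al ze w0 csb) (continuous_area cx3 cx1 cu3 cu1).
    have ga := horizontal_area s0 hs g31E.
    apply: (ac_unique s0' ga ta).
      by rewrite G0 b31.
    by move=> r rs; rewrite x1E// x3E//; have [-> _ ->] := uE r.
have ui T e : 0 < T -> (@lebesgue_measure R).-integrable `[0, T] (EFin \o (fun s => dot (u s) e)).
  by move=> T0; have [] := horizontal_coord dot e T0 (gammaP T T0).
have len s : 0 < s -> length dot s u = (s * c0)%:E.
  move=> s0; rewrite (length_coords dimV on (ltW s0)); last by move=> e; exact: ui.
  congr EFin; rewrite (@Rint_eq _ 0 s _ (fun=> c0)).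
    by rewrite Rintegral_cst//= lebesgue_measure_itv/= lte_fin s0 /= subr0 mulrC.
  by move=> r _; have [-> -> ->] := uE r; rewrite hu_norm.
have minimal s : 0 < s <= y / phi -> length_minimizer dot wedge gamma u s.
  move=> sp; have s0 : 0 < s by case/andP: sp.
  split; first exact: gammaP.
  apply/eqP; rewrite eq_le; apply/andP; split; last first.
    by apply: ereal_inf_lbound; exists s, gamma, u; split => //; exact: gammaP.
  apply: le_ereal_inf_tmp => _ [T [g [v [T0 hg gz gs ->]]]].
  have vi e : (@lebesgue_measure R).-integrable `[0, T] (EFin \o (fun s => dot (v s) e)).
    by have [] := horizontal_coord dot e T0 hg.
  rewrite len// (length_coords dimV on (ltW T0) vi) lee_fin.
  have [q1 q2 q3 q12 [q23 q31]] := pos s s0.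
  apply: (competitor_bound yp norm_a cb0 sb0 csb phi_gt0 E1 E2 T0 sp
    (horizontal_coord dot e1 T0 hg) (horizontal_coord dot e2 T0 hg)
    (horizontal_coord dot e3 T0 hg) (horizontal_area T0 hg g12E)
    (horizontal_area T0 hg g23E) (horizontal_area T0 hg g31E)).
    by rewrite gz !g0 !G0.
  by rewrite gs q1 q2 q3 q12 q23 q31.
split=> //.
apply/eqP; rewrite eq_le; apply/andP; split; last first.
  apply: ereal_sup_ubound; exists (y / phi) => //; split=> //.
  by apply: minimal; rewrite tc0 lexx.
apply: ge_ereal_sup => _ [s [s0 [_ sd]] <-]; rewrite lee_fin leNgt; apply/negP => st.
have [f1 [f2 [f3 [v1 [v2 [v3 [r12 [r23 [r31]]]]]]]]] :=
  helix_shortcut yp norm_a cb0 csb phi_gt0 E1 E2 st.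
move=> [[bv1 bv2 bv3] [a1 a2 a3] [a12 a23 a31] [z1 z2 z3 z12 [z23 z31]]].
move=> [[q1 q2 q3 q12 [q23 q31]] lt].
have [m1 m2 m3 m12 [m23 m31]] := pos s s0.
have hc := horizontal_of_coords dimV wedgeP on s0 bv1 bv2 bv3 a1 a2 a3 a12 a23 a31.
set g := (fun s => _) in hc; set v := (fun s => _) in hc.
have co r : [/\ dot (v r) e1 = v1 r, dot (v r) e2 = v2 r & dot (v r) e3 = v3 r].
  have [n1 n2 n3 [n12 n13 n23]] := on.
  rewrite /v !dotDl !dotZl n1 n2 n3 (dotC _ e2 e1) (dotC _ e3 e1) (dotC _ e3 e2).
  by rewrite n12 n13 n23; split; ring.
have vi e : (@lebesgue_measure R).-integrable `[0, s] (EFin \o (fun r => dot (v r) e)).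
  by have [] := horizontal_coord dot e s0 hc.
have : (length dot s v < length dot s u)%E.
  rewrite len// (length_coords dimV on (ltW s0) vi) lte_fin mulrC.
  rewrite (@Rint_eq _ 0 s _ (fun r => Num.sqrt (v1 r ^+ 2 + v2 r ^+ 2 + v3 r ^+ 2))).
    exact: lt.
  by move=> r _; have [-> -> ->] := co r.
apply/negP; rewrite -leNgt sd; apply: ereal_inf_lbound.
exists s, g, v; split=> //.
- by rewrite gamma0 /g z1 z2 z3 z12 z23 z31 !scale0r !addr0.
- rewrite /g q1 q2 q3 q12 q23 q31 -m1 -m2 -m3 -m12 -m23 -m31.
  (* Equality of coordinates becomes equality of endpoints, in W by the universal property. *)
  rewrite -(orthonormal3_expand _ dimV on).
  rewrite -(exterior_expand dimV wedgeP _ on g12E g23E g31E).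
  by case: (gamma s).
Qed.
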